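(* There does not exist an $\mathrm{Out}(W_4)$-equivariant piecewise Euclidean $\mathrm{CAT}(0)$ metric on McCullough–Miller space $K_4$, nor an $\mathrm{Out}(W_4)$-equivariant piecewise hyperbolic $\mathrm{CAT}(-1)$ metric on $K_4$.
   Context: $W_n=\langle a_1,\dots,a_n\mid a_i^2=1\rangle$, $[n]=\{1,\dots,n\}$. For $i\in[n]$ and nonempty $D\subseteq[n]\setminus\{i\}$, the partial conjugation $x_{i,D}$ sends $a_j\mapsto a_ia_ja_i$ for $j\in D$ and fixes the other generators. $\mathrm{Out}^0(W_n)=\mathrm{Aut}^0(W_n)/\mathrm{Inn}(W_n)$ where $\mathrm{Aut}^0(W_n)$ consists of automorphisms sending each $a_j$ to a conjugate of itself; $\mathrm{Out}(W_n)=\mathrm{Out}^0(W_n)\rtimes\Sigma_n$, with $\Sigma_n$ acting by permuting the generators $a_i$. Hypertrees: a hypertree on $[n]$ is a set of subsets (hyperedges) of $[n]$ of size $\ge2$ such that any two vertices are joined by a unique simple walk (alternating sequence of distinct vertices and distinct hyperedges, consecutive vertices in the intervening hyperedge); $\mathcal{HT}_n$ is the set of them. $\Theta\le\Lambda$ if $\Theta$ is obtained from $\Lambda$ by finitely many folds (a fold replaces two intersecting distinct hyperedges by their union). $\Theta$ carries $x_{i,D}$ if for every $d\in D$, $j\in[n]\setminus(D\cup\{i\})$ the simple walk from $d$ to $j$ visits $i$; $\alpha\in\mathrm{Out}^0(W_n)$ is carried by $\Theta$ if it is a product of partial conjugations carried by $\Theta$. McCullough–Miller space: on $\mathrm{Out}^0(W_n)\times\mathcal{HT}_n$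 set $(\alpha,\Theta)\sim(\beta,\Lambda)$ iff $\Theta=\Lambda$ and $\alpha^{-1}\beta$ is carried by $\Theta$; write $[\alpha,\Theta]$ for classes. Partially order classes by $[\alpha,\Theta]\le[\beta,\Lambda]$ iff $\Theta\le\Lambda$ and $\alpha^{-1}\beta$ is carried by $\Lambda$. $K_n$ is the simplicial realization (order complex) of this poset. $\mathrm{Out}(W_n)$ acts by simplicial automorphisms via $\varphi\sigma\cdot[\alpha,\Theta]=[\varphi\,\sigma\alpha\sigma^{-1},\sigma\Theta]$ ($\varphi\in\mathrm{Out}^0(W_n)$, $\sigma\in\Sigma_n$, $\sigma\Theta$ the hypertree with relabeled vertices). For $n=4$, $K_4$ is 2-dimensional. A piecewise Euclidean (resp. hyperbolic) metric on $K_n$ means: each simplex is metrized as a geodesic simplex in Euclidean space (resp. hyperbolic space $\mathbb{H}^m$), face inclusions are isometries, and $K_n$ carries the induced length metric. It is $G$-equivariant if $G$ acts by isometries. *)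

(* Defs.v *)
From HB Require Import structures.
From mathcomp Require Import all_boot all_order all_fingroup.
From Stdlib Require Import Reals ClassicalDescription.
From Coquelicot Require Import Rbar Lub.

Set Implicit Arguments.
Unset Strict Implicit.
Unset Printing Implicit Defensive.
Local Open Scope nat_scope.

Definition rsum (k : nat) (f : nat -> R) : R :=
  foldr (fun i acc => (f i + acc)%R) 0%R (seq.iota 0 k).

Section McCulloughMiller.
Variable n : nat.

(* ---------- The free Coxeter group W_n = < a_1..a_n | a_i^2 = 1 > ----------
   Elements are represented by words over 'I_n; [red] computes the reduced
   normal form (no two consecutive equal letters); two words represent the
   same element of W_n iff their normal forms coincide. *)
Definition word := seq 'I_n.

Definition cons_red (x : 'I_n) (w : word) : word :=
  if w is y :: w' then (if x == y then w' else x :: w) else [:: x].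

Definition red (w : word) : word := foldr cons_red [::] w.

Definition endo := 'I_n -> word.

Definition wapply (f : endo) (w : word) : word := red (flatten (map f w)).

Definition comp (f g : endo) : endo := fun i => wapply f (g i).

Definition idA : endo := fun i => [:: i].

Definition aeq (f g : endo) : Prop := forall i, red (f i) = red (g i).

Definition isAut0 (f : endo) : Prop :=
  (forall i, exists c : word, red (f i) = red (c ++ i :: rev c)) /\
  exists g : endo, (forall i, red (g i ++ g i) = [::]) /\
                   aeq (comp f g) idA /\ aeq (comp g f) idA.

Definition pc (i : 'I_n) (D : {set 'I_n}) : endo :=
  fun j => if j \in D then [:: i; j; i] else [:: j].

Definition inn (c : word) : endo := fun j => c ++ j :: rev c.

Definition validpc (i : 'I_n) (D : {set 'I_n}) : Prop := D != set0 /\ i \notin D.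

Definition prodpc (ps : seq ('I_n * {set 'I_n})) : endo :=
  foldr (fun p acc => comp (pc p.1 p.2) acc) idA ps.

Definition walk (Th : {set {set 'I_n}}) (u v : 'I_n)
    (vs : seq 'I_n) (es : seq {set 'I_n}) : Prop :=
  [/\ size vs = size es, uniq (u :: vs) /\ uniq es,
      (forall E, E \in es -> E \in Th),
      (forall j, j < size es ->
          (nth u (u :: vs) j \in nth set0 es j) /\
          (nth u (u :: vs) j.+1 \in nth set0 es j))
    & last u vs = v].

Definition hypertree (Th : {set {set 'I_n}}) : Prop :=
  (forall E, E \in Th -> 1 < #|E|) /\
  forall u v : 'I_n, exists vs es, walk Th u v vs es /\
     forall vs2 es2, walk Th u v vs2 es2 -> vs2 = vs /\ es2 = es.

Definition foldb (L L' : {set {set 'I_n}}) : bool :=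
  [exists E : {set 'I_n}, exists F : {set 'I_n},
     [&& E \in L, F \in L, E != F, E :&: F != set0 &
         L' == (L :\ E :\ F) :|: [set E :|: F]]].

Definition htle (Th L : {set {set 'I_n}}) : Prop := connect foldb L Th.

Definition carries (Th : {set {set 'I_n}}) (i : 'I_n) (D : {set 'I_n}) : Prop :=
  forall d j, d \in D -> j \notin D -> j != i ->
    forall vs es, walk Th d j vs es -> i \in d :: vs.

(* rel Th a b : a^{-1} b (in Out^0(W_n)) is carried by Th, i.e.
   b = a o iota o gamma with iota inner and gamma a product of partial
   conjugations carried by Th. *)
Definition rel (Th : {set {set 'I_n}}) (a b : endo) : Prop :=
  exists (c : word) (ps : seq ('I_n * {set 'I_n})),
    (forall p, p \in ps -> validpc p.1 p.2 /\ carries Th p.1 p.2) /\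
    aeq b (comp a (comp (inn c) (prodpc ps))).

(* representatives (alpha, Th) of vertices [alpha, Th] *)
Definition vtx := (endo * {set {set 'I_n}})%type.
Definition v0 : vtx := (idA, set0).

Definition validV (v : vtx) : Prop := isAut0 v.1 /\ hypertree v.2.
Definition veq (v w : vtx) : Prop := v.2 = w.2 /\ rel v.2 v.1 w.1.
Definition vle (v w : vtx) : Prop := htle v.2 w.2 /\ rel w.2 v.1 w.1.
Definition vlt (v w : vtx) : Prop := vle v w /\ ~ veq v w.

Definition chain (s : seq vtx) : Prop :=
  [/\ 0 < size s,
      (forall i, i < size s -> validV (nth v0 s i))
    & (forall i j, i < j -> j < size s -> vlt (nth v0 s i) (nth v0 s j))].

(* a point of the geometric realization: a simplex with barycentric weights *)
Record pt := Pt { psx : seq vtx; pwt : nat -> R }.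

Definition validpt (x : pt) : Prop :=
  chain (psx x) /\ (forall i, i < size (psx x) -> (0 <= pwt x i)%R) /\
  rsum (size (psx x)) (pwt x) = 1%R.

Definition cw (x : pt) (v : vtx) : R :=
  rsum (size (psx x)) (fun i =>
    if excluded_middle_informative (veq (nth v0 (psx x) i) v)
    then pwt x i else 0%R).

Definition samept (x y : pt) : Prop := forall v, cw x v = cw y v.

Inductive model := Euc | Hyp.

(* Euclidean space R^m (coordinates 0..m-1); Minkowski R^{m,1} with
   coordinate 0 the time coordinate, hyperboloid model of H^m. *)
Definition edist (m : nat) (x y : nat -> R) : R :=
  sqrt (rsum m (fun l => (x l - y l) ^ 2)%R).

Definition mink (m : nat) (x y : nat -> R) : R :=
  (- (x O * y O) + rsum m (fun l => x l.+1 * y l.+1))%R.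

Definition acosh (u : R) : R := ln (u + sqrt (u ^ 2 - 1)).

Definition hdist (m : nat) (x y : nat -> R) : R := acosh (- mink m x y).

Definition vdist (kap : model) (m : nat) (x y : nat -> R) : R :=
  match kap with Euc => edist m x y | Hyp => hdist m x y end.

Definition combo (k : nat) (p : nat -> nat -> R) (t : nat -> R) : nat -> R :=
  fun l => rsum k (fun j => (t j * p j l)%R).

(* vertices p 0..k-1 span a (nondegenerate) geodesic simplex in the model *)
Definition goodreal (kap : model) (k m : nat) (p : nat -> nat -> R) : Prop :=
  match kap with
  | Euc => forall c : nat -> R, rsum k c = 0%R ->
             (forall l, l < m -> rsum k (fun j => (c j * p j l)%R) = 0%R) ->
             forall j, j < k -> c j = 0%R
  | Hyp => (forall j, j < k -> mink m (p j) (p j) = (-1)%R /\ (0 < p j O)%R) /\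
           forall c : nat -> R,
             (forall l, l <= m -> rsum k (fun j => (c j * p j l)%R) = 0%R) ->
             forall j, j < k -> c j = 0%R
  end.

Definition spoint (kap : model) (k m : nat) (p : nat -> nat -> R) (t : nat -> R)
    : nat -> R :=
  match kap with
  | Euc => combo k p t
  | Hyp => let u := combo k p t in
           fun l => (u l / sqrt (- mink m u u))%R
  end.

(* A metric datum assigns to every simplex (given as a chain) a dimension m
   and the coordinates of its vertices in the model space. *)
Definition realization := seq vtx -> (nat * (nat -> nat -> R))%type.

Definition sdist (kap : model) (rz : realization) (s : seq vtx) (t t' : nat -> R) : R :=
  vdist kap (rz s).1 (spoint kap (size s) (rz s).1 (rz s).2 t)
                     (spoint kap (size s) (rz s).1 (rz s).2 t').

(* piecewise Euclidean (Euc) / hyperbolic (Hyp) metric: each simplex is a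
   geodesic simplex, and face inclusions are isometries (distances between
   vertices of a common face agree in all simplices containing it). *)
Definition PMetric (kap : model) (rz : realization) : Prop :=
  (forall s, chain s -> goodreal kap (size s) (rz s).1 (rz s).2) /\
  (forall s s' i j i' j', chain s -> chain s' ->
     i < size s -> j < size s -> i' < size s' -> j' < size s' ->
     veq (nth v0 s i) (nth v0 s' i') -> veq (nth v0 s j) (nth v0 s' j') ->
     vdist kap (rz s).1 ((rz s).2 i) ((rz s).2 j) =
     vdist kap (rz s').1 ((rz s').2 i') ((rz s').2 j')).

Fixpoint strOK (x y : pt) (str : seq (seq vtx * (nat -> R) * (nat -> R))) : Prop :=
  match str with
  | [::] => samept x y
  | (s, a, b) :: str' =>
      validpt (Pt s a) /\ validpt (Pt s b) /\ samept x (Pt s a) /\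
      strOK (Pt s b) y str'
  end.

Fixpoint strlen (kap : model) (rz : realization)
    (str : seq (seq vtx * (nat -> R) * (nat -> R))) : R :=
  match str with
  | [::] => 0%R
  | (s, a, b) :: str' => (sdist kap rz s a b + strlen kap rz str')%R
  end.

Definition dlen (kap : model) (rz : realization) (x y : pt) : Rbar :=
  Glb_Rbar (fun r => exists str, strOK x y str /\ r = strlen kap rz str).

Definition geodesic (d : pt -> pt -> Rbar) (c : R -> pt) (L : R) (x y : pt) : Prop :=
  (forall r, (0 <= r <= L)%R -> validpt (c r)) /\
  samept (c 0%R) x /\ samept (c L) y /\
  forall r r', (0 <= r <= L)%R -> (0 <= r' <= L)%R ->
    d (c r) (c r') = Finite (Rabs (r - r')).

(* distance in the comparison triangle (in E^2, resp. H^2) with side lengths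
   a = d(x,y), b = d(x,z), c = d(y,z), between the comparison points of the
   point at distance s from x on [x,y] and at distance t from x on [x,z]. *)
Definition cmpdist (kap : model) (a b c s t : R) : R :=
  match kap with
  | Euc => sqrt (s ^ 2 + t ^ 2 - s * t * (a ^ 2 + b ^ 2 - c ^ 2) / (a * b))
  | Hyp => acosh (cosh s * cosh t -
                  sinh s * sinh t * (cosh a * cosh b - cosh c) / (sinh a * sinh b))
  end.

Definition CAT (kap : model) (d : pt -> pt -> Rbar) : Prop :=
  (forall x y, validpt x -> validpt y -> d x y = Finite 0 -> samept x y) /\
  (forall x y, validpt x -> validpt y ->
     exists L c, d x y = Finite L /\ geodesic d c L x y) /\
  (forall x y z a b c cy cz, validpt x -> validpt y -> validpt z ->
     d x y = Finite a -> d x z = Finite b -> d y z = Finite c ->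
     geodesic d cy a x y -> geodesic d cz b x z ->
     forall s t, (0 <= s <= a)%R -> (0 <= t <= b)%R ->
       Rbar_le (d (cy s) (cz t)) (Finite (cmpdist kap a b c s t))).

(* ---------- The action of Out(W_n) = Out^0(W_n) x| Sigma_n ---------- *)
Definition conjp (sg : {perm 'I_n}) (al : endo) : endo :=
  fun j => map sg (al ((sg^-1)%g j)).

Definition relab (sg : {perm 'I_n}) (Th : {set {set 'I_n}}) : {set {set 'I_n}} :=
  [set (sg @: E) | E : {set 'I_n} in Th].

Definition actv (g : endo * {perm 'I_n}) (v : vtx) : vtx :=
  (comp g.1 (conjp g.2 v.1), relab g.2 v.2).

Definition actpt (g : endo * {perm 'I_n}) (x : pt) : pt :=
  Pt (map (actv g) (psx x)) (pwt x).

Definition equivariant (d : pt -> pt -> Rbar) : Prop :=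
  forall g : endo * {perm 'I_n}, isAut0 g.1 ->
    forall x y, validpt x -> validpt y -> d (actpt g x) (actpt g y) = d x y.

End McCulloughMiller.

(* Main.v *)
Require Import Defs.
From HB Require Import structures.
From mathcomp Require Import all_boot all_order all_fingroup.
From Stdlib Require Import Reals ClassicalDescription.
From Coquelicot Require Import Rbar Lub.
From Stdlib Require Import Lra Psatz Classical.

(** In the flag complex K_4 every vertex has a finite stabilizer acting on its
    link, and a CAT(0) metric forces enough angle around it.  If an involution
    g fixes v and two neighbours p, q lying in different components of the
    g-fixed part of the link of v, then geodesics between g-fixed points near v
    on the edges [v,p], [v,q] are g-fixed, hence run through v; so every fan of
    triangles around v from p to q has total angle at least pi.  Let T1 and T2
    be the triangles (nuclear, middle, path) and (nuclear, middle, star).  Up to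
    symmetry suitable fans give:
      at the nuclear vertex  theta1 + theta2 >= pi/2,
      at the middle vertex   phi1 + phi2 >= pi,
      at the path            psi1 >= pi/4,
      at the star            psi2 >= pi/3.
    The sum 25 pi/12 exceeds the 2 pi available in two Euclidean or hyperbolic
    triangles. *)

Set Implicit Arguments.
Unset Strict Implicit.
Unset Printing Implicit Defensive.
Delimit Scope nat_scope with N.
Delimit Scope R_scope with R.
Local Notation comp := Defs.comp.
Local Notation rel := Defs.rel.

Local Open Scope R_scope.

(** * Finite real sums *)

(** The comparison inequality is used once, on the degenerate triangle x, y, y: geodesics are
    unique, so one joining two g-fixed points is fixed pointwise. That it meets v is then
    connectedness of an interval. The main obstacle is that [dlen] is an infimum over strings
    wandering through an infinite complex. Stars are locally finite because the automorphisms
    carried by a hypertree form a finite group modulo inner ones; this gives a radius around each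
    point inside which strings straighten to a segment of one simplex. Angles of the length metric
    are never defined. Each fan is folded by symmetries onto T1 and T2, giving an inequality between
    simplex distances for all small parameters; rescaling to first order turns it into a planar
    inequality, and suitable parameters give the angle bound. The fans consist of two copies each of
    T1 and T2 (nuclear), one of each (middle), four of T1 (path) and three of T2 (star), whence the
    four constants. In the links of the path and the star the two sides carry markings to be told
    apart as well as trees; a mod 2 count of letters in conjugators distinguishes them. *)

Lemma rsum0 (f : nat -> R) : rsum 0 f = 0.
Proof. by []. Qed.

Lemma rsumS (k : nat) (f : nat -> R) : rsum k.+1 f = rsum k f + f k.
Proof.
rewrite /rsum -[in LHS]addn1 iotaD foldr_cat /= add0n.
elim: (seq.iota 0 k) => [|i s IH] /=; first lra.
rewrite IH; lra.
Qed.

Lemma eq_rsum (k : nat) (f g : nat -> R) :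
  (forall i, (i < k)%N -> f i = g i) -> rsum k f = rsum k g.
Proof.
elim: k => [|k IH] H; first by [].
rewrite !rsumS IH ?H // => i ik; apply: H; exact: ltnW.
Qed.

Lemma rsumD (k : nat) (f g : nat -> R) :
  rsum k (fun i => f i + g i) = rsum k f + rsum k g.
Proof. elim: k => [|k IH]; rewrite ?rsum0 ?rsumS ?IH; lra. Qed.

Lemma rsumZ (k : nat) (c : R) (f : nat -> R) :
  rsum k (fun i => c * f i) = c * rsum k f.
Proof. elim: k => [|k IH]; rewrite ?rsum0 ?rsumS ?IH; lra. Qed.

Lemma rsumZr (k : nat) (c : R) (f : nat -> R) :
  rsum k (fun i => f i * c) = rsum k f * c.
Proof. elim: k => [|k IH]; rewrite ?rsum0 ?rsumS ?IH; lra. Qed.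

Lemma rsumB (k : nat) (f g : nat -> R) :
  rsum k (fun i => f i - g i) = rsum k f - rsum k g.
Proof. elim: k => [|k IH]; rewrite ?rsum0 ?rsumS ?IH; lra. Qed.

Lemma rsum_const0 (k : nat) (f : nat -> R) :
  (forall i, (i < k)%N -> f i = 0) -> rsum k f = 0.
Proof.
move=> H; rewrite (@eq_rsum k f (fun=> 0 * 0)) ?rsumZ; first by lra.
by move=> i /H ->; lra.
Qed.

Lemma rsum_le (k : nat) (f g : nat -> R) :
  (forall i, (i < k)%N -> f i <= g i) -> rsum k f <= rsum k g.
Proof.
elim: k => [|k IH] H; first by rewrite !rsum0; lra.
rewrite !rsumS; have := H k (ltnSn k).
have : rsum k f <= rsum k g by apply: IH => i ik; apply: H; exact: ltnW.
lra.
Qed.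

Lemma rsum_ge0 (k : nat) (f : nat -> R) :
  (forall i, (i < k)%N -> 0 <= f i) -> 0 <= rsum k f.
Proof.
move=> H; rewrite -(@rsum_const0 k (fun=> 0)) //; exact: rsum_le.
Qed.

Lemma rsum_swap (k l : nat) (F : nat -> nat -> R) :
  rsum k (fun i => rsum l (F i)) = rsum l (fun j => rsum k (F^~ j)).
Proof.
elim: k => [|k IH]; first by rewrite rsum0 [RHS]rsum_const0.
by rewrite rsumS IH -rsumD; apply: eq_rsum => j _; rewrite rsumS.
Qed.

Lemma rsum_only (k i : nat) (f : nat -> R) : (i < k)%N ->
  (forall j, (j < k)%N -> j <> i -> f j = 0) -> rsum k f = f i.
Proof.
elim: k => [|k IH] // ik H; rewrite rsumS.
case: (eqVneq i k) => [ek|nik].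
  subst k; rewrite rsum_const0 ?Rplus_0_l // => j ji; apply: H; first exact: ltnW.
  by move=> e; move: ji; rewrite e ltnn.
have ik' : (i < k)%N by rewrite ltn_neqAle nik -ltnS.
rewrite (IH ik') ?(H k) //; [lra| |]; first by move=> e; rewrite e eqxx in nik.
by move=> j jk; apply: H; exact: ltnW.
Qed.

Lemma rsum_ge1 (k i : nat) (f : nat -> R) : (i < k)%N ->
  (forall j, (j < k)%N -> 0 <= f j) -> f i <= rsum k f.
Proof.
elim: k => [|k IH] // ik H; rewrite rsumS.
have Hk : forall j, (j < k)%N -> 0 <= f j by move=> j jk; apply: H; exact: ltnW.
case: (eqVneq i k) => [->|nik].
  have := @rsum_ge0 k f Hk; lra.
have ik' : (i < k)%N by rewrite ltn_neqAle nik -ltnS.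
have := IH ik' Hk; have := H k (ltnSn k); lra.
Qed.

Lemma rsum_pos_ex (k : nat) (f : nat -> R) :
  0 < rsum k f -> exists2 i, (i < k)%N & 0 < f i.
Proof.
elim: k => [|k IH]; first by rewrite rsum0; lra.
rewrite rsumS => H; case: (Rlt_dec 0 (f k)) => fk; first by exists k.
have [|i ik fi] := IH; first lra.
by exists i => //; exact: ltnW.
Qed.

Definition indic (P : Prop) (x : R) : R :=
  if excluded_middle_informative P then x else 0.

Lemma indicT (P : Prop) (x : R) : P -> indic P x = x.
Proof. by rewrite /indic; case: excluded_middle_informative. Qed.

Lemma indicF (P : Prop) (x : R) : ~ P -> indic P x = 0.
Proof. by rewrite /indic; case: excluded_middle_informative. Qed.

Lemma eq_indic (P Q : Prop) (x : R) : (P <-> Q) -> indic P x = indic Q x.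
Proof.
move=> PQ; case: (classic P) => HP.
  by rewrite !indicT //; exact/PQ.
by rewrite !indicF // => /PQ.
Qed.

(** The same point can be given on different chains, so sums over its vertices have different index
    sets. [M] is a partial bijection outside which the terms vanish, and both sums expand to one
    double sum over matched pairs. *)
Lemma rsum_match (k k' : nat) (f f' : nat -> R) (M : nat -> nat -> Prop) :
  (forall i j, (i < k)%N -> (j < k')%N -> M i j -> f i = f' j) ->
  (forall i j j', (i < k)%N -> (j < k')%N -> (j' < k')%N -> M i j -> M i j' -> j = j') ->
  (forall i i' j, (i < k)%N -> (i' < k)%N -> (j < k')%N -> M i j -> M i' j -> i = i') ->
  (forall i, (i < k)%N -> f i <> 0 -> exists2 j, (j < k')%N & M i j) ->
  (forall j, (j < k')%N -> f' j <> 0 -> exists2 i, (i < k)%N & M i j) ->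
  rsum k f = rsum k' f'.
Proof.
move=> eqf inj1 inj2 ex1 ex2.
have -> : rsum k f = rsum k (fun i => rsum k' (fun j => indic (M i j) (f i))).
  apply: eq_rsum => i ik; case: (Req_dec (f i) 0) => f0.
    rewrite f0 rsum_const0 // => j _; rewrite /indic.
    by case: excluded_middle_informative.
  have [j jk Mij] := ex1 i ik f0.
  rewrite (@rsum_only _ j) ?indicT // => j' jk' ne; rewrite indicF // => Mij'.
  by apply: ne; exact: (inj1 i).
have -> : rsum k' f' = rsum k' (fun j => rsum k (fun i => indic (M i j) (f' j))).
  apply: eq_rsum => j jk; case: (Req_dec (f' j) 0) => f0.
    rewrite f0 rsum_const0 // => i _; rewrite /indic.
    by case: excluded_middle_informative.
  have [i ik Mij] := ex2 j jk f0.
  rewrite (@rsum_only _ i) ?indicT // => i' ik' ne; rewrite indicF // => Mij'.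
  by apply: ne; exact: (inj2 i' i j).
rewrite rsum_swap; apply: eq_rsum => j jk; apply: eq_rsum => i ik.
by rewrite /indic; case: excluded_middle_informative => // Mij; exact: eqf.
Qed.

(** * Linear algebra *)

Definition dot (m : nat) (x y : nat -> R) : R := rsum m (fun l => x l * y l).

Lemma dotC (m : nat) (x y : nat -> R) : dot m x y = dot m y x.
Proof. by apply: eq_rsum => l _; exact: Rmult_comm. Qed.

Lemma dot_linl (m : nat) (a b : R) (x y z : nat -> R) :
  dot m (fun l => a * x l + b * y l) z = a * dot m x z + b * dot m y z.
Proof.
by rewrite /dot -!rsumZ -rsumD; apply: eq_rsum => l _; lra.
Qed.

Lemma dot_ge0 (m : nat) (x : nat -> R) : 0 <= dot m x x.
Proof. by apply: rsum_ge0 => l _; nra. Qed.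

Lemma dot_eq0 (m : nat) (x : nat -> R) : dot m x x = 0 ->
  forall l, (l < m)%N -> x l = 0.
Proof.
move=> x0 l lm.
have : x l * x l <= dot m x x by apply: (@rsum_ge1 m l (fun l => x l * x l)) => // j _; nra.
rewrite x0; nra.
Qed.

Lemma dot_combo (m k : nat) (q : nat -> nat -> R) (c y : nat -> R) :
  dot m (combo k q c) y = rsum k (fun j => c j * dot m (q j) y).
Proof.
rewrite /dot /combo.
transitivity (rsum m (fun l => rsum k (fun j => c j * q j l * y l))).
  by apply: eq_rsum => l _; rewrite rsumZr.
rewrite rsum_swap; apply: eq_rsum => j _; rewrite -rsumZ.
by apply: eq_rsum => l _; lra.
Qed.

Lemma quad_disc (a b c : R) :
  (forall s t, 0 <= s ^ 2 * a + 2 * s * t * b + t ^ 2 * c) -> b ^ 2 <= a * c.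
Proof.
move=> H; have a0 := H 1 0; have c0 := H 0 1; have h1 := H (- b) a.
case: (Rle_lt_or_eq_dec 0 a) => [|apos|a00]; first by nra.
  have h2 : 0 <= a * (a * c - b ^ 2) by nra.
  have : 0 <= a * c - b ^ 2 by apply: (Rmult_le_reg_l a) => //; lra.
  lra.
(* For a = 0 the form takes the value -(c + 2) b^2 here, which forces b = 0. *)
have h3 := H (- (c + 1)) b; subst a.
have -> : b = 0 by apply: Rsqr_0_uniq; rewrite /Rsqr; nra.
lra.
Qed.

Lemma dot_CS (m : nat) (x y : nat -> R) : dot m x y ^ 2 <= dot m x x * dot m y y.
Proof.
apply: quad_disc => s t.
have := dot_ge0 m (fun l => s * x l + t * y l).
rewrite dot_linl [dot m x _]dotC [dot m y _]dotC !dot_linl (dotC m y x).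
lra.
Qed.

(** Gram-Schmidt without assuming independence: the induction hypothesis is applied both to [p] and
    to [q k], and the residual of the first is corrected along the residual of the second. *)
Lemma orthogonal_residual (k m : nat) (q : nat -> nat -> R) (p : nat -> R) :
  exists la : nat -> R,
    forall j, (j < k)%N -> dot m (fun l => p l - combo k q la l) (q j) = 0.
Proof.
elim: k p => [|k IH] p; first by exists (fun=> 0).
have [lp Hp] := IH p; have [lq Hq] := IH (q k).
set p' := (fun l => p l - combo k q lp l) in Hp.
set q' := (fun l => q k l - combo k q lq l) in Hq.
pose mu := dot m p' q' / dot m q' q'.
exists (fun j => if (j < k)%N then lp j - mu * lq j else mu).
have E : forall y, dot m (fun l => p l - combo k.+1 q
    (fun j => if (j < k)%N then lp j - mu * lq j else mu) l) y =
    dot m p' y - mu * dot m q' y.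
  move=> y; rewrite -[RHS]/(dot m p' y + - (mu * dot m q' y)).
  have -> : dot m p' y + - (mu * dot m q' y) = 1 * dot m p' y + (- mu) * dot m q' y by lra.
  rewrite -dot_linl; apply: eq_rsum => l _; congr (_ * _).
  rewrite /combo rsumS ltnn /p' /q' /combo.
  rewrite (@eq_rsum k _ (fun j => lp j * q j l - mu * (lq j * q j l))).
    by rewrite rsumB rsumZ; lra.
  by move=> i ik; rewrite ik; lra.
have Eq : dot m p' (q k) - mu * dot m q' (q k) = dot m p' q' - mu * dot m q' q'.
  have X : forall x, (forall j, (j < k)%N -> dot m x (q j) = 0) -> dot m x (q k) = dot m x q'.
    move=> x Hx; rewrite ![dot m x _]dotC.
    have -> : dot m q' x = 1 * dot m (q k) x + (-1) * dot m (combo k q lq) x.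
      by rewrite -dot_linl; apply: eq_rsum => l _; rewrite /q'; lra.
    rewrite dot_combo rsum_const0; first lra.
    by move=> j jk; rewrite dotC Hx //; lra.
  by rewrite (X _ Hp) (X _ Hq).
move=> j; rewrite ltnS leq_eqVlt => /orP[/eqP ->|jk]; last by rewrite E Hp // Hq //; lra.
rewrite E Eq /mu; case: (Req_dec (dot m q' q') 0) => q0; last by field.
(* The division by zero in [mu] is harmless: if q' has norm 0, Cauchy-Schwarz makes the numerator
   vanish as well. *)
rewrite q0; have := dot_CS m p' q'; rewrite q0 => H.
have -> : dot m p' q' = 0 by nra.
by rewrite /Rdiv; lra.
Qed.

(** The residual of [q i] against the other vectors works. It pairs with [q i] to its own squared
    norm, and a zero residual would be a linear relation with coefficient 1 at i. *)
Lemma dual_vector (k m i : nat) (q : nat -> nat -> R) :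
  (forall c : nat -> R,
     (forall l, (l < m)%N -> combo k q c l = 0) -> forall j, (j < k)%N -> c j = 0) ->
  (i < k)%N ->
  exists n : nat -> R, 0 < dot m n (q i) /\
    forall j, (j < k)%N -> j <> i -> dot m n (q j) = 0.
Proof.
move=> indep ik.
pose q' j := if j == i then (fun=> 0) else q j.
have [la Hla] := orthogonal_residual k m q' (q i).
set n := (fun l => _) in Hla.
have on j : (j < k)%N -> j <> i -> dot m n (q j) = 0.
  by move=> jk /eqP ji; have := Hla j jk; rewrite /q' (negbTE ji).
exists n; split => //.
have ni : dot m n (q i) = dot m n n.
  rewrite ![dot m n _]dotC.
  have -> : dot m n n = 1 * dot m (q i) n + (-1) * dot m (combo k q' la) n.
    by rewrite -dot_linl; apply: eq_rsum => l _; rewrite /n; lra.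
  rewrite dot_combo rsum_const0; first lra.
  by move=> j jk; rewrite dotC Hla //; lra.
rewrite ni; case: (Rle_lt_or_eq_dec 0 (dot m n n) (dot_ge0 m n)) => // n0.
exfalso.
have := indep (fun j => if j == i then 1 else - la j) _ i ik.
rewrite eqxx => H; suff: 1 = 0 by lra.
apply: H => l lm; rewrite -(dot_eq0 (esym n0) lm) /n /combo.
have -> : q i l = rsum k (fun j => if j == i then q i l else 0).
  by rewrite (@rsum_only _ i) ?eqxx // => j _ /eqP/negbTE ->.
rewrite -rsumB; apply: eq_rsum => j _; rewrite /q'; case: eqVneq => [->|_]; lra.
Qed.

(** * Hyperbolic functions *)

Lemma cosh_sinh_sqr (x : R) : cosh x ^ 2 - sinh x ^ 2 = 1.
Proof.
rewrite /cosh /sinh; have := exp_plus x (- x); rewrite Rplus_opp_r exp_0; nra.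
Qed.

Lemma cosh_opp (x : R) : cosh (- x) = cosh x.
Proof. rewrite /cosh Ropp_involutive; lra. Qed.

Lemma sinh_opp (x : R) : sinh (- x) = - sinh x.
Proof. rewrite /sinh Ropp_involutive; lra. Qed.

Lemma cosh_add (x y : R) : cosh (x + y) = cosh x * cosh y + sinh x * sinh y.
Proof. rewrite /cosh /sinh Ropp_plus_distr !exp_plus; lra. Qed.

Lemma sinh_add (x y : R) : sinh (x + y) = sinh x * cosh y + cosh x * sinh y.
Proof. rewrite /cosh /sinh Ropp_plus_distr !exp_plus; lra. Qed.

Lemma cosh_gt0 (x : R) : 0 < cosh x.
Proof. rewrite /cosh; have := exp_pos x; have := exp_pos (- x); lra. Qed.

Lemma cosh_ge1 (x : R) : 1 <= cosh x.
Proof. have := cosh_sinh_sqr x; have := cosh_gt0 x; nra. Qed.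

Lemma sinh_ge0 (x : R) : 0 <= x -> 0 <= sinh x.
Proof.
case=> [x0|<-]; last by rewrite sinh_0; lra.
by rewrite -sinh_0; left; exact: sinh_lt.
Qed.

Lemma sinh_gt0 (x : R) : 0 < x -> 0 < sinh x.
Proof. by move=> x0; rewrite -sinh_0; exact: sinh_lt. Qed.

Lemma cosh_le (x y : R) : 0 <= x -> x <= y -> cosh x <= cosh y.
Proof.
move=> x0 xy; have -> : y = x + (y - x) by lra.
rewrite cosh_add; have := sinh_ge0 x0.
have : 0 <= sinh (y - x) by apply: sinh_ge0; lra.
have := cosh_ge1 (y - x); have := cosh_gt0 x; nra.
Qed.

Lemma cosh_lt (x y : R) : 0 <= x -> x < y -> cosh x < cosh y.
Proof.
move=> x0 xy; have := cosh_sinh_sqr x; have := cosh_sinh_sqr y.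
have := sinh_lt _ _ xy; have := sinh_ge0 x0; have := cosh_gt0 x; have := cosh_gt0 y.
nra.
Qed.

Lemma cosh_le_inv (x y : R) : 0 <= y -> cosh x <= cosh y -> x <= y.
Proof.
by move=> y0 H; case: (Rle_lt_dec x y) => // /(cosh_lt y0); lra.
Qed.

Lemma cosh_inj (x y : R) : 0 <= x -> 0 <= y -> cosh x = cosh y -> x = y.
Proof.
move=> x0 y0 e; apply: Rle_antisym; apply: cosh_le_inv => //; lra.
Qed.

Lemma sinh_MVT (y : R) : 0 < y -> exists2 c, 0 < c < y & sinh y = cosh c * y.
Proof.
move=> y0; have [c [e c0]] := MVT_cor2 sinh cosh 0 y y0
  (fun c _ => derivable_pt_lim_sinh c).
by exists c => //; rewrite sinh_0 in e; lra.
Qed.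

Lemma sinh_ge (y : R) : 0 <= y -> y <= sinh y.
Proof.
case=> [y0|<-]; last by rewrite sinh_0; lra.
by have [c _ ->] := sinh_MVT y0; have := cosh_ge1 c; nra.
Qed.

Lemma sinh_le_mul_cosh (y : R) : 0 <= y -> sinh y <= y * cosh y.
Proof.
case=> [y0|<-]; last by rewrite sinh_0; lra.
have [c [c0 cy] ->] := sinh_MVT y0.
have : cosh c <= cosh y by apply: cosh_le; lra.
nra.
Qed.

Lemma cosh_ge_quad (y : R) : 0 <= y -> y ^ 2 <= 2 * (cosh y - 1).
Proof.
move=> y0; have -> : y = y / 2 + y / 2 by field.
rewrite cosh_add; have := cosh_sinh_sqr (y / 2).
have : y / 2 <= sinh (y / 2) by apply: sinh_ge; lra.
nra.
Qed.

Lemma acosh_arg (u : R) : 1 <= u ->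
  0 < u + sqrt (u ^ 2 - 1) /\ / (u + sqrt (u ^ 2 - 1)) = u - sqrt (u ^ 2 - 1).
Proof.
move=> u1; have s0 := sqrt_pos (u ^ 2 - 1).
have := sqrt_sqrt (u ^ 2 - 1) ltac:(nra) => ss.
have p : 0 < u + sqrt (u ^ 2 - 1) by lra.
split => //; apply: (Rmult_eq_reg_l (u + sqrt (u ^ 2 - 1))); last lra.
rewrite Rinv_r; [nra|lra].
Qed.

Lemma cosh_acosh (u : R) : 1 <= u -> cosh (acosh u) = u.
Proof.
move=> u1; have [p e] := acosh_arg u1.
rewrite /cosh /acosh exp_Ropp exp_ln // e; lra.
Qed.

Lemma acosh_ge0 (u : R) : 1 <= u -> 0 <= acosh u.
Proof.
move=> u1; rewrite /acosh -ln_1; have := sqrt_pos (u ^ 2 - 1) => s0.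
by case: (Rle_lt_or_eq_dec 1 (u + sqrt (u ^ 2 - 1))); [lra|move=> h; left; apply: ln_increasing; lra|move=> <-; right].
Qed.

Lemma acosh_cosh (x : R) : 0 <= x -> acosh (cosh x) = x.
Proof.
move=> x0; apply: cosh_inj => //; first by apply: acosh_ge0; exact: cosh_ge1.
by rewrite cosh_acosh //; exact: cosh_ge1.
Qed.

Lemma acosh_le_iff (u d : R) : 1 <= u -> 0 <= d -> (acosh u <= d <-> u <= cosh d).
Proof.
move=> u1 d0; split => H; first by rewrite -[u]cosh_acosh //; apply: cosh_le => //; exact: acosh_ge0.
by apply: cosh_le_inv => //; rewrite cosh_acosh.
Qed.

(** * Geometry of the model spaces *)

Lemma rsumSl (k : nat) (f : nat -> R) : rsum k.+1 f = f 0%N + rsum k (fun i => f i.+1).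
Proof.
elim: k => [|k IH]; first by rewrite rsumS !rsum0; lra.
by rewrite rsumS IH rsumS; lra.
Qed.

(** Changing the sign of the time coordinate turns [mink] into [dot], so bilinearity and dual
    vectors are inherited from the Euclidean lemmas. *)
Definition flip0 (x : nat -> R) : nat -> R := fun l => if l is O then - x O else x l.

Lemma mink_dot (m : nat) (x y : nat -> R) : mink m x y = dot m.+1 (flip0 x) y.
Proof. by rewrite /mink /dot rsumSl /=; lra. Qed.

Lemma mink_dotr (m : nat) (x y : nat -> R) : mink m (flip0 x) y = dot m.+1 x y.
Proof. by rewrite /mink /dot rsumSl /=; lra. Qed.

Lemma minkC (m : nat) (x y : nat -> R) : mink m x y = mink m y x.
Proof. by rewrite /mink -/(dot m (fun l => x l.+1) (fun l => y l.+1)) dotC /dot; lra. Qed.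

Lemma mink_linr (m : nat) (a b : R) (x y z : nat -> R) :
  mink m z (fun l => a * x l + b * y l) = a * mink m z x + b * mink m z y.
Proof. by rewrite !mink_dot [LHS]dotC dot_linl ![dot _ (flip0 z) _]dotC. Qed.

Lemma mink_linl (m : nat) (a b : R) (x y z : nat -> R) :
  mink m (fun l => a * x l + b * y l) z = a * mink m x z + b * mink m y z.
Proof. by rewrite ![mink _ _ z]minkC mink_linr. Qed.

Lemma mink_combor (m k : nat) (p : nat -> nat -> R) (a y : nat -> R) :
  mink m y (combo k p a) = rsum k (fun j => a j * mink m y (p j)).
Proof.
by rewrite mink_dot dotC dot_combo; apply: eq_rsum => j _; rewrite dotC -mink_dot.
Qed.

Lemma mink_combol (m k : nat) (p : nat -> nat -> R) (a y : nat -> R) :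
  mink m (combo k p a) y = rsum k (fun j => a j * mink m (p j) y).
Proof. by rewrite minkC mink_combor; apply: eq_rsum => j _; rewrite minkC. Qed.

Definition inH (m : nat) (x : nat -> R) : Prop := mink m x x = -1 /\ 0 < x O.

Lemma inH_dot (m : nat) (x : nat -> R) : inH m x ->
  dot m (fun l => x l.+1) (fun l => x l.+1) = x O ^ 2 - 1.
Proof. by case; rewrite /mink /dot; lra. Qed.

(** Tangent vectors of the hyperboloid are spacelike: the spatial parts pair to u_0 x_0, and
    Cauchy-Schwarz with spatial norm x_0^2 - 1 of x bounds u_0^2 by the spatial norm of u. *)
Lemma mink_orth_ge0 (m : nat) (x u : nat -> R) :
  inH m x -> mink m u x = 0 -> 0 <= mink m u u.
Proof.
move=> Hx ux; have xx := inH_dot Hx.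
have := dot_CS m (fun l => u l.+1) (fun l => x l.+1); rewrite xx.
have := dot_ge0 m (fun l => u l.+1); have := dot_ge0 m (fun l => x l.+1); rewrite xx.
move: ux; rewrite /mink -/(dot m (fun l => u l.+1) (fun l => x l.+1)) -/(dot m (fun l => u l.+1) (fun l => u l.+1)).
move: (dot m (fun l => u l.+1) (fun l => x l.+1)) => V.
move: (dot m (fun l => u l.+1) (fun l => u l.+1)) => U ux x1 U0 cs.
have e : V = u O * x O by lra.
subst V.
case: (Rle_lt_dec (u O ^ 2) U) => H; first by lra.
have : U * (x O ^ 2 - 1) <= u O ^ 2 * (x O ^ 2 - 1) by apply: Rmult_le_compat_r; lra.
nra.
Qed.

Lemma mink_orth_CS (m : nat) (x u w : nat -> R) :
  inH m x -> mink m u x = 0 -> mink m w x = 0 ->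
  mink m u w ^ 2 <= mink m u u * mink m w w.
Proof.
move=> Hx ux wx; apply: quad_disc => s t.
have := @mink_orth_ge0 m x (fun l => s * u l + t * w l) Hx.
rewrite mink_linl ux wx => /(_ ltac:(lra)).
by rewrite mink_linl !mink_linr (minkC m w u); lra.
Qed.

(** Projection of x to the tangent space at y; the sign is plus because <y,y> = -1. The factor 1
    gives the shape expected by [mink_linl]. *)
Definition perp (m : nat) (y x : nat -> R) : nat -> R := fun l => 1 * x l + mink m x y * y l.

Lemma perp_orth (m : nat) (y x : nat -> R) : inH m y -> mink m (perp m y x) y = 0.
Proof. by case=> yy _; rewrite /perp mink_linl yy; lra. Qed.

Lemma mink_perp (m : nat) (y x z : nat -> R) : inH m y ->
  mink m (perp m y x) (perp m y z) = mink m x z + mink m x y * mink m z y.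
Proof.
move=> Hy; rewrite {2}/perp mink_linr (perp_orth _ Hy) /perp mink_linl (minkC m y z); lra.
Qed.

Lemma mink_le_m1 (m : nat) (x y : nat -> R) : inH m x -> inH m y -> 1 <= - mink m x y.
Proof.
move=> Hx Hy.
have := mink_orth_ge0 Hy (perp_orth x Hy); rewrite mink_perp // (proj1 Hx) => h1.
suff : 0 < - mink m x y by nra.
have := dot_CS m (fun l => x l.+1) (fun l => y l.+1).
have := dot_ge0 m (fun l => x l.+1); have := dot_ge0 m (fun l => y l.+1).
rewrite !inH_dot //; rewrite /mink -/(dot m (fun l => x l.+1) (fun l => y l.+1)).
case: Hx => _ x0; case: Hy => _ y0; set D := dot _ _ _ => h2 h3 h4.
have xy : 0 < x O * y O by exact: Rmult_lt_0_compat.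
have : D ^ 2 < (x O * y O) ^ 2 by nra.
nra.
Qed.

Lemma cosh_hdist (m : nat) (x y : nat -> R) : inH m x -> inH m y ->
  cosh (hdist m x y) = - mink m x y.
Proof. by move=> Hx Hy; rewrite /hdist cosh_acosh //; exact: mink_le_m1. Qed.

Lemma hdist_ge0 (m : nat) (x y : nat -> R) : inH m x -> inH m y -> 0 <= hdist m x y.
Proof. by move=> Hx Hy; apply: acosh_ge0; exact: mink_le_m1. Qed.

(** This is Cauchy-Schwarz for the tangential parts of x and z at y, whose norms are the squared
    sinh of the two distances, combined with the addition formula for cosh. *)
Lemma hdist_triangle (m : nat) (x y z : nat -> R) : inH m x -> inH m y -> inH m z ->
  hdist m x z <= hdist m x y + hdist m y z.
Proof.
move=> Hx Hy Hz.
have a0 := hdist_ge0 Hx Hy; have b0 := hdist_ge0 Hy Hz.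
apply: cosh_le_inv; first lra.
rewrite cosh_add !cosh_hdist //.
have ca := cosh_sinh_sqr (hdist m x y); have cb := cosh_sinh_sqr (hdist m y z).
rewrite !cosh_hdist // in ca cb.
have sa := sinh_ge0 a0; have sb := sinh_ge0 b0.
have := mink_orth_CS Hy (perp_orth x Hy) (perp_orth z Hy).
rewrite !mink_perp // (proj1 Hx) (proj1 Hz) (minkC m z y).
set A := mink m x y in ca *; set B := mink m y z in cb *; set C := mink m x z.
set S := sinh _ in ca sa *; set T := sinh _ in cb sb *.
move=> h.
have h' : (C + A * B) ^ 2 <= (S * T) ^ 2.
  have -> : (S * T) ^ 2 = (- 1 + A * A) * (- 1 + B * B) by nra.
  exact: h.
have := Rmult_le_pos _ _ sa sb; nra.
Qed.

Lemma edist_dot (m : nat) (x y : nat -> R) :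
  edist m x y = sqrt (dot m (fun l => x l - y l) (fun l => x l - y l)).
Proof. by rewrite /edist /dot; congr sqrt; apply: eq_rsum => l _; lra. Qed.

Lemma edist_triangle (m : nat) (x y z : nat -> R) :
  edist m x z <= edist m x y + edist m y z.
Proof.
rewrite !edist_dot.
set u := (fun l => x l - y l); set w := (fun l => y l - z l).
have -> : dot m (fun l => x l - z l) (fun l => x l - z l) =
    dot m u u + 2 * dot m u w + dot m w w.
  by rewrite /dot -!rsumZ -!rsumD; apply: eq_rsum => l _; rewrite /u /w; lra.
have u0 := dot_ge0 m u; have w0 := dot_ge0 m w.
have su := sqrt_sqrt _ u0; have sw := sqrt_sqrt _ w0.
have pu := sqrt_pos (dot m u u); have pw := sqrt_pos (dot m w w).
have cs := dot_CS m u w.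
set a := sqrt (dot m u u) in su pu *; set b := sqrt (dot m w w) in sw pw *.
rewrite -[a + b]sqrt_pow2; last lra.
apply: sqrt_le_1_alt.
have ab : dot m u w ^ 2 <= (a * b) ^ 2 by rewrite -su -sw in cs; nra.
have := Rmult_le_pos _ _ pu pw; nra.
Qed.

Definition inspace (kap : model) (m : nat) (x : nat -> R) : Prop :=
  if kap is Hyp then inH m x else True.

Lemma vdist_triangle (kap : model) (m : nat) (x y z : nat -> R) :
  inspace kap m x -> inspace kap m y -> inspace kap m z ->
  vdist kap m x z <= vdist kap m x y + vdist kap m y z.
Proof.
by case: kap => /= hx hy hz; [exact: edist_triangle | exact: hdist_triangle].
Qed.

Lemma vdist_ge0 (kap : model) (m : nat) (x y : nat -> R) :
  inspace kap m x -> inspace kap m y -> 0 <= vdist kap m x y.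
Proof.
by case: kap => /= hx hy; [exact: sqrt_pos | exact: hdist_ge0].
Qed.

Lemma vdistC (kap : model) (m : nat) (x y : nat -> R) : vdist kap m x y = vdist kap m y x.
Proof.
case: kap => /=; last by rewrite /hdist minkC.
by rewrite /edist; congr sqrt; apply: eq_rsum => l _; lra.
Qed.

Lemma vdist_refl (kap : model) (m : nat) (x : nat -> R) :
  inspace kap m x -> vdist kap m x x = 0.
Proof.
case: kap => /= [_|[xx _]].
  by rewrite /edist rsum_const0 ?sqrt_0 // => l _; lra.
have e : - mink m x x = cosh 0 by rewrite xx cosh_0; lra.
by rewrite /hdist e acosh_cosh //; lra.
Qed.

(** * Geodesic simplices *)

Definition weights (k : nat) (a : nat -> R) : Prop :=
  (forall i, (i < k)%N -> 0 <= a i) /\ rsum k a = 1.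

Definition bil (k : nat) (G : nat -> nat -> R) (a b : nat -> R) : R :=
  rsum k (fun i => rsum k (fun j => a i * b j * G i j)).

(** The entries from which all distances in a simplex can be recovered. For weights a, b the
    bilinear form of these entries gives d^2 = ab - aa/2 - bb/2 in the Euclidean case and cosh d =
    ab / sqrt(aa bb) in the hyperbolic one. Hence distances depend only on weights and side lengths,
    not on the coordinates chosen by the realization. *)
Definition gram (kap : model) (d : R) : R := if kap is Hyp then cosh d else d ^ 2.

Definition gramdist (kap : model) (ab aa bb : R) : R :=
  if kap is Hyp then acosh (ab / (sqrt aa * sqrt bb)) else sqrt (ab - aa / 2 - bb / 2).

Definition vgram (kap : model) (m : nat) (p : nat -> nat -> R) (i j : nat) : R :=
  gram kap (vdist kap m (p i) (p j)).

Lemma bil_euc (k m : nat) (p : nat -> nat -> R) (a b : nat -> R) :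
  bil k (vgram Euc m p) a b =
  rsum k a * rsum k (fun j => b j * dot m (p j) (p j)) +
  rsum k b * rsum k (fun j => a j * dot m (p j) (p j)) -
  2 * dot m (combo k p a) (combo k p b).
Proof.
rewrite dot_combo /bil.
transitivity (rsum k (fun i => a i * rsum k (fun j => b j * dot m (p j) (p j)) +
    rsum k b * (a i * dot m (p i) (p i)) - 2 * (a i * dot m (p i) (combo k p b)))).
  apply: eq_rsum => i _; rewrite dotC dot_combo.
  transitivity (rsum k (fun j => a i * (b j * dot m (p j) (p j)) +
      b j * (a i * dot m (p i) (p i)) - 2 * (a i * (b j * dot m (p j) (p i))))).
    apply: eq_rsum => j _; rewrite /vgram /= edist_dot.
    rewrite Rmult_1_r sqrt_sqrt; last exact: dot_ge0.
    have -> : dot m (fun l => p i l - p j l) (fun l => p i l - p j l) =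
        dot m (p i) (p i) + (-2) * dot m (p j) (p i) + dot m (p j) (p j).
      by rewrite /dot -!rsumZ -!rsumD; apply: eq_rsum => l _; lra.
    lra.
  by rewrite rsumB rsumD !rsumZ rsumZr.
by rewrite rsumB rsumD !rsumZ rsumZr; lra.
Qed.

Lemma bil_hyp (k m : nat) (p : nat -> nat -> R) (a b : nat -> R) :
  (forall j, (j < k)%N -> inH m (p j)) ->
  bil k (vgram Hyp m p) a b = - mink m (combo k p a) (combo k p b).
Proof.
move=> Hp; rewrite mink_combol /bil.
have -> : - rsum k (fun j => a j * mink m (p j) (combo k p b)) =
   (-1) * rsum k (fun j => a j * mink m (p j) (combo k p b)) by lra.
rewrite -rsumZ; apply: eq_rsum => i ik.
rewrite mink_combor -!rsumZ; apply: eq_rsum => j jk.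
by rewrite /vgram /= cosh_hdist; [lra|exact: Hp|exact: Hp].
Qed.

Lemma goodreal_inspace (kap : model) (k m : nat) (p : nat -> nat -> R) (j : nat) :
  goodreal kap k m p -> (j < k)%N -> inspace kap m (p j).
Proof. by case: kap => //= -[H _] /H. Qed.

Lemma bil_hyp_ge1 (k m : nat) (p : nat -> nat -> R) (a b : nat -> R) :
  (forall j, (j < k)%N -> inH m (p j)) -> weights k a -> weights k b ->
  1 <= - mink m (combo k p a) (combo k p b).
Proof.
move=> Hp [a0 a1] [b0 b1]; rewrite -bil_hyp // /bil -{1}a1.
apply: rsum_le => i ik.
apply: (Rle_trans _ (rsum k (fun j => a i * b j))); first by rewrite rsumZ b1; lra.
apply: rsum_le => j jk; rewrite /vgram /=.
have := cosh_ge1 (hdist m (p i) (p j)).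
have := Rmult_le_pos _ _ (a0 i ik) (b0 j jk); nra.
Qed.

Lemma spoint_inspace (kap : model) (k m : nat) (p : nat -> nat -> R) (a : nat -> R) :
  goodreal kap k m p -> weights k a -> inspace kap m (spoint kap k m p a).
Proof.
case: kap => //= -[Hp _] Ha; have h := bil_hyp_ge1 Hp Ha Ha.
set u := combo k p a in h *.
have s0 : 0 < sqrt (- mink m u u) by apply: sqrt_lt_R0; lra.
have ss := sqrt_sqrt (- mink m u u) ltac:(lra).
set s := sqrt _ in s0 ss *.
have E (y : nat -> R) : mink m y (fun l => u l / s) = / s * mink m y u.
  have -> : / s * mink m y u = / s * mink m y u + 0 * mink m y u by lra.
  rewrite -mink_linr !mink_dot; apply: eq_rsum => l _; congr (_ * _); rewrite /Rdiv; lra.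
split.
  rewrite E minkC E; have -> : mink m u u = - (s * s) by lra.
  by field; lra.
apply: Rdiv_lt_0_compat => //; rewrite /u /combo.
case: Ha => a0 a1.
have [i ik ai] : exists2 i, (i < k)%N & 0 < a i by apply: rsum_pos_ex; lra.
have := @rsum_ge1 k i (fun j => a j * p j O) ik.
have := Rmult_lt_0_compat _ _ ai (proj2 (Hp i ik)) => h1 h2.
have : a i * p i O <= rsum k (fun j => a j * p j O).
  by apply: h2 => j jk; apply: Rmult_le_pos; [exact: a0|left; exact: (proj2 (Hp j jk))].
lra.
Qed.

Lemma spoint_gram (kap : model) (k m : nat) (p : nat -> nat -> R) (a b : nat -> R) :
  goodreal kap k m p -> weights k a -> weights k b ->
  let ab := bil k (vgram kap m p) a b in
  let aa := bil k (vgram kap m p) a a in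
  let bb := bil k (vgram kap m p) b b in
  let d := vdist kap m (spoint kap k m p a) (spoint kap k m p b) in
  if kap is Hyp then [/\ 0 < aa, 0 < bb & cosh d = ab / (sqrt aa * sqrt bb)]
  else d ^ 2 = ab - aa / 2 - bb / 2.
Proof.
case: kap => Hp Ha Hb /=.
  rewrite edist_dot Rmult_1_r sqrt_sqrt; last exact: dot_ge0.
  rewrite !bil_euc (proj2 Ha) (proj2 Hb).
  set u := combo k p a; set v := combo k p b.
  have -> : dot m (fun l => u l - v l) (fun l => u l - v l) =
     dot m u u + (-2) * dot m u v + dot m v v.
    by rewrite /dot -!rsumZ -!rsumD; apply: eq_rsum => l _; lra.
  lra.
have Hx := spoint_inspace Hp Ha; have Hy := spoint_inspace Hp Hb.
have e := cosh_hdist Hx Hy; move: e => /=; set d := hdist _ _ _ => {d} ->.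
case: Hp => Hp _; rewrite !bil_hyp //.
have ua := bil_hyp_ge1 Hp Ha Ha; have ub := bil_hyp_ge1 Hp Hb Hb.
set u := combo k p a in ua *; set v := combo k p b in ub *.
have su : 0 < sqrt (- mink m u u) by apply: sqrt_lt_R0; lra.
have sv : 0 < sqrt (- mink m v v) by apply: sqrt_lt_R0; lra.
split; [lra|lra|].
set s := sqrt _ in su *; set t := sqrt _ in sv *.
have E (c : R) (w y : nat -> R) : mink m y (fun l => w l / c) = / c * mink m y w.
  have -> : / c * mink m y w = / c * mink m y w + 0 * mink m y w by lra.
  rewrite -mink_linr !mink_dot; apply: eq_rsum => l _; congr (_ * _); rewrite /Rdiv; lra.
by rewrite E minkC E minkC; field; lra.
Qed.

Lemma vdist_spoint (kap : model) (k m : nat) (p : nat -> nat -> R) (a b : nat -> R) :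
  goodreal kap k m p -> weights k a -> weights k b ->
  vdist kap m (spoint kap k m p a) (spoint kap k m p b) =
  gramdist kap (bil k (vgram kap m p) a b) (bil k (vgram kap m p) a a)
    (bil k (vgram kap m p) b b).
Proof.
move=> Hp Ha Hb; have := spoint_gram Hp Ha Hb.
have := vdist_ge0 (spoint_inspace Hp Ha) (spoint_inspace Hp Hb).
case: kap Hp => Hp; cbv zeta; set d := vdist _ _ _ _ => d0 /=.
  by rewrite Rmult_1_r => <-; rewrite sqrt_square.
by case=> _ _ <-; rewrite acosh_cosh.
Qed.

(* An affine (resp. linear) functional vanishing on the face opposite to the
   vertex [i] separates [spoint a] from that face. *)
Lemma spoint_far_from_face (kap : model) (k m : nat) (p : nat -> nat -> R) (a : nat -> R) (i : nat) :
  goodreal kap k m p -> weights k a -> (i < k)%N -> 0 < a i ->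
  exists2 eta, 0 < eta & forall b, weights k b -> b i = 0 ->
    eta <= vdist kap m (spoint kap k m p a) (spoint kap k m p b).
Proof.
case: kap => /= Hp Ha ik ai.
  (* A new coordinate equal to 1 turns affine into linear independence. The differences of weights
     sum to 0, so this coordinate of [a - b] vanishes and the norm is unchanged. *)
  pose q j := (fun l => if l is l'.+1 then p j l' else 1).
  have [|n [ni nj]] := @dual_vector k m.+1 i q _ ik.
    move=> c Hc; apply: Hp.
      by rewrite -(Hc 0%N) // /combo; apply: eq_rsum => j _ /=; lra.
    by move=> l lm; rewrite -(Hc l.+1).
  have nn := dot_ge0 m.+1 n.
  have sn : 0 < sqrt (dot m.+1 n n + 1) by apply: sqrt_lt_R0; lra.
  exists (a i * dot m.+1 n (q i) / sqrt (dot m.+1 n n + 1)).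
    by apply: Rdiv_lt_0_compat => //; exact: Rmult_lt_0_compat.
  move=> b Hb bi; rewrite edist_dot.
  set w := (fun l => combo k p a l - combo k p b l).
  have E : dot m.+1 (combo k q (fun j => a j - b j)) n = a i * dot m.+1 n (q i).
    rewrite dot_combo (@rsum_only _ i) ?bi ?Rminus_0_r ?[dot _ (q i) _]dotC //.
    by move=> j jk ji; rewrite dotC nj //; lra.
  have E2 : dot m.+1 (combo k q (fun j => a j - b j)) (combo k q (fun j => a j - b j)) = dot m w w.
    rewrite {1}/dot rsumSl {1 2}/combo.
    rewrite (@eq_rsum k (fun j => (a j - b j) * q j 0%N) (fun j => a j - b j)); last by move=> j _ /=; lra.
    rewrite rsumB (proj2 Ha) (proj2 Hb) Rminus_diag Rmult_0_l Rplus_0_l.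
    apply: eq_rsum => l _.
    have -> : combo k q (fun j => a j - b j) l.+1 = w l.
      by rewrite /w /combo -rsumB; apply: eq_rsum => j _ /=; lra.
    by [].
  have := dot_CS m.+1 (combo k q (fun j => a j - b j)) n.
  rewrite E E2 => cs.
  have w0 := dot_ge0 m w.
  apply: (Rmult_le_reg_r (sqrt (dot m.+1 n n + 1))) => //.
  rewrite {1}/Rdiv Rmult_assoc Rinv_l ?Rmult_1_r; last lra.
  rewrite -sqrt_mult //; last lra.
  rewrite -[X in X <= _]sqrt_pow2; last by apply: Rlt_le; exact: Rmult_lt_0_compat.
  by apply: sqrt_le_1_alt; nra.
have [Hj Hi] := Hp.
have [|n [ni nj]] := @dual_vector k m.+1 i p _ ik.
  by move=> c Hc; apply: Hi => l lm; apply: Hc.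
pose nh := flip0 n.
have Hx := @spoint_inspace Hyp k m p a Hp Ha.
set x := spoint Hyp k m p a in Hx *.
have nE (c : nat -> R) : mink m nh (combo k p c) = c i * dot m.+1 n (p i).
  rewrite mink_combor (@rsum_only _ i) //; first by rewrite mink_dotr.
  by move=> j jk ji; rewrite mink_dotr nj //; lra.
have nS (c : nat -> R) : mink m nh (spoint Hyp k m p c) =
    c i * dot m.+1 n (p i) / sqrt (- mink m (combo k p c) (combo k p c)).
  rewrite -nE /=; set s := sqrt _.
  have -> : mink m nh (combo k p c) / s = / s * mink m nh (combo k p c) + 0 * mink m nh (combo k p c).
    by rewrite /Rdiv; lra.
  rewrite -mink_linr !mink_dot; apply: eq_rsum => l _; congr (_ * _); rewrite /Rdiv; lra.
set l0 := mink m nh x.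
have l0p : 0 < l0.
  rewrite /l0 nS; apply: Rdiv_lt_0_compat; first exact: Rmult_lt_0_compat.
  by apply: sqrt_lt_R0; have := bil_hyp_ge1 Hj Ha Ha; lra.
set N := mink m (perp m x nh) (perp m x nh).
have N0 : 0 <= N by exact: (mink_orth_ge0 Hx (perp_orth nh Hx)).
have q0 : 0 < l0 ^ 2 / (N + 1) by apply: Rdiv_lt_0_compat; nra.
have s1 : 1 < sqrt (1 + l0 ^ 2 / (N + 1)).
  by rewrite -{1}sqrt_1; apply: sqrt_lt_1_alt; lra.
exists (acosh (sqrt (1 + l0 ^ 2 / (N + 1)))).
  case: (Rle_lt_or_eq_dec 0 (acosh (sqrt (1 + l0 ^ 2 / (N + 1))))) => //.
    by apply: acosh_ge0; lra.
  by move=> e; have := cosh_acosh (Rlt_le _ _ s1); rewrite -e cosh_0; lra.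
move=> b Hb bi; have Hy := @spoint_inspace Hyp k m p b Hp Hb.
set y := spoint Hyp k m p b in Hy *.
have ny : mink m nh y = 0 by rewrite /y nS bi; rewrite /Rdiv; lra.
apply/acosh_le_iff; [lra|exact: hdist_ge0|].
rewrite cosh_hdist //.
have C1 := mink_le_m1 Hx Hy.
(* With <nh,y> = 0, Cauchy-Schwarz in the tangent space at x reads l0^2 C^2 <= N (C^2 - 1). As C^2
   >= 1, this bounds C^2 - 1 below by l0^2 / (N + 1); the summand 1 avoids a zero denominator. *)
have := mink_orth_CS Hx (perp_orth nh Hx) (perp_orth y Hx).
rewrite mink_perp // -/N mink_perp // (proj1 Hy) ny -/l0 (minkC m y x).
set C := mink m x y in C1 *; move=> cs.
rewrite -[- C]sqrt_pow2; last lra.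
apply: sqrt_le_1_alt.
have : l0 ^ 2 / (N + 1) <= C ^ 2 - 1.
  apply: (Rmult_le_reg_r (N + 1)); first lra.
  rewrite /Rdiv Rmult_assoc Rinv_l ?Rmult_1_r; last lra.
  have C2 : 1 <= C ^ 2 by nra.
  have := Rmult_le_compat_l _ _ _ (pow2_ge_0 l0) C2; nra.
nra.
Qed.

Local Open Scope nat_scope.

(** * Words and endomorphisms *)

Local Open Scope nat_scope.

Section Words.
Variable n : nat.
Implicit Types (u v w c : word n) (f g h : endo n) (i j : 'I_n).

Definition reduced w : bool := sorted (fun x y : 'I_n => x != y) w.

Lemma cons_red_reduced i w : reduced w -> reduced (cons_red i w).
Proof.
case: w => [|j w] //= H; case: eqVneq => [_|ij] /=; last by rewrite ij.
by move: H; rewrite /reduced; case: w => //= k w /andP[].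
Qed.

Lemma red_reduced w : reduced (red w).
Proof. by elim: w => [|i w IH] //=; exact: cons_red_reduced. Qed.

(** Letters act on reduced words by involutions, so W_n acts on them; this is why [red] is
    compatible with concatenation. *)
Lemma cons_redK i w : reduced w -> cons_red i (cons_red i w) = w.
Proof.
case: w => [|j w] //=; first by rewrite eqxx.
case: eqVneq => [->|ij] /=; last by rewrite eqxx.
by case: w => [|k w] //= /andP[/negbTE -> _].
Qed.

Lemma foldr_reduced u w : reduced w -> reduced (foldr (@cons_red n) w u).
Proof. by move=> Hw; elim: u => //= i u; exact: cons_red_reduced. Qed.

Lemma red_id w : reduced w -> red w = w.
Proof.
elim: w => [|i w IH] //= H.
rewrite IH; last by move: H; rewrite /reduced; case: (w) => //= k z /andP[].
by case: w H {IH} => [|k w] //= /andP[/negbTE -> _].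
Qed.

Lemma red_red w : red (red w) = red w.
Proof. exact: red_id (red_reduced w). Qed.

Lemma red_catE u v : red (u ++ v) = foldr (@cons_red n) (red v) u.
Proof. by rewrite /red foldr_cat. Qed.

Lemma red_catr u v : red (u ++ red v) = red (u ++ v).
Proof. by rewrite !red_catE red_red. Qed.

Lemma foldr_cons_red i u w : reduced w ->
  foldr (@cons_red n) w (cons_red i u) = cons_red i (foldr (@cons_red n) w u).
Proof.
move=> Hw; case: u => [|j u] //=; case: eqVneq => [->|] //=.
by rewrite cons_redK //; exact: foldr_reduced.
Qed.

Lemma red_catl u v : red (red u ++ v) = red (u ++ v).
Proof.
rewrite !red_catE; have Hv := red_reduced v.
by elim: u => [|i u IH] //=; rewrite foldr_cons_red // IH.
Qed.

Lemma red_cat u u' v v' : red u = red u' -> red v = red v' -> red (u ++ v) = red (u' ++ v').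
Proof.
move=> eu ev.
by rewrite -[LHS]red_catl -[LHS]red_catr eu ev red_catr red_catl.
Qed.

Lemma red_cons i u v : red u = red v -> red (i :: u) = red (i :: v).
Proof. by move=> /= ->. Qed.

Lemma red_cons2 i w : red (i :: i :: w) = red w.
Proof. by rewrite /= cons_redK //; exact: red_reduced. Qed.

Lemma red_cat_rev u : red (u ++ rev u) = [::].
Proof.
elim: u => [|i u IH] //.
rewrite rev_cons -cats1 -cat1s -catA (catA u).
rewrite (@red_cat _ [:: i] _ [:: i]) //; last by rewrite -red_catl IH.
by rewrite red_cons2.
Qed.

Lemma red_rev_cat u : red (rev u ++ u) = [::].
Proof. by rewrite -{2}[u]revK red_cat_rev. Qed.

Lemma red_rev u v : red u = red v -> red (rev u) = red (rev v).
Proof.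
move=> e; transitivity (red (rev u ++ (v ++ rev v))).
  by rewrite -red_catr red_cat_rev cats0.
rewrite catA (@red_cat _ [::] _ (rev v)) //.
rewrite (@red_cat _ (rev u) _ u) //; exact: red_rev_cat.
Qed.

Lemma red_conj c u v : red u = red v -> red (c ++ u ++ rev c) = red (c ++ v ++ rev c).
Proof. by move=> e; apply: red_cat => //; apply: red_cat. Qed.

Lemma red_rev_catK c u : red (rev c ++ c ++ u) = red u.
Proof. by rewrite catA -red_catl red_rev_cat. Qed.

Definition fm f w : word n := flatten (map f w).

Lemma fm_cat f u v : fm f (u ++ v) = fm f u ++ fm f v.
Proof. by rewrite /fm map_cat flatten_cat. Qed.

Lemma fm_cons f i w : fm f (i :: w) = f i ++ fm f w.
Proof. by []. Qed.

Lemma fm1 f i : fm f [:: i] = f i.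
Proof. by rewrite /fm /= cats0. Qed.

Definition conjugating f : Prop := forall i, exists c, red (f i) = red (c ++ i :: rev c).

(** The images respect a_i^2 = 1, so substitution by f descends to W_n. Compatibility and
    associativity of [comp] require this of the left factor. *)
Definition involutory f : Prop := forall i, red (f i ++ f i) = [::].

Lemma conjugating_involutory f : conjugating f -> involutory f.
Proof.
move=> Hf i; have [c Hc] := Hf i.
rewrite (red_cat Hc Hc) -!catA /=.
transitivity (red (c ++ [:: i] ++ (i :: rev c))).
  by apply: red_cat => //; apply: red_cons; exact: red_rev_catK.
rewrite -[[:: i] ++ _]/([:: i; i] ++ rev c).
by rewrite (@red_conj c [:: i; i] [::]) ?red_cons2 //= red_cat_rev.
Qed.

Lemma fm_red f w : involutory f -> red (fm f (red w)) = red (fm f w).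
Proof.
move=> Hf; elim: w => [|i w IH] //.
have -> : red (i :: w) = cons_red i (red w) by [].
transitivity (red (f i ++ fm f (red w))); last by apply: red_cat.
case: (red w) => [|j w'] //=; case: eqVneq => [<-|//].
rewrite /fm /= catA; symmetry.
by rewrite -red_catl (Hf i).
Qed.

Lemma fm_congr f u v : involutory f -> red u = red v -> red (fm f u) = red (fm f v).
Proof. by move=> Hf e; rewrite -fm_red // e fm_red. Qed.

Lemma fm_aeq f g w : aeq f g -> red (fm f w) = red (fm g w).
Proof. by move=> e; elim: w => [|i w IH] //; exact: red_cat. Qed.

Lemma fm_comp f g w : red (fm (comp f g) w) = red (fm f (fm g w)).
Proof.
elim: w => [|i w IH] //.
rewrite !fm_cons fm_cat; apply: red_cat => //; exact: red_red.
Qed.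

Lemma aeq_refl f : aeq f f. Proof. by []. Qed.

Lemma aeq_sym f g : aeq f g -> aeq g f. Proof. by move=> e i. Qed.

Lemma aeq_trans f g h : aeq f g -> aeq g h -> aeq f h.
Proof. by move=> e e' i; rewrite e. Qed.

Lemma red_comp f g i : red (comp f g i) = red (fm f (g i)).
Proof. exact: red_red. Qed.

Lemma comp_aeql f f' g : aeq f f' -> aeq (comp f g) (comp f' g).
Proof. by move=> e i; rewrite !red_comp; exact: fm_aeq. Qed.

Lemma comp_aeqr f g g' : involutory f -> aeq g g' -> aeq (comp f g) (comp f g').
Proof. by move=> Hf e i; rewrite !red_comp; exact: fm_congr. Qed.

Lemma comp_assoc f g h : involutory f -> aeq (comp f (comp g h)) (comp (comp f g) h).
Proof. by move=> Hf i; rewrite !red_comp fm_comp fm_red. Qed.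

Lemma comp_idl f : aeq (comp (@idA n) f) f.
Proof. by move=> i; rewrite red_comp; congr red; elim: (f i) => //= x w {2}<-. Qed.

Lemma comp_idr f : aeq (comp f (@idA n)) f.
Proof. by move=> i; rewrite red_comp fm1. Qed.

Lemma conjugating_aeq f g : aeq f g -> conjugating f -> conjugating g.
Proof. by move=> e Hf i; have [c Hc] := Hf i; exists c; rewrite -e. Qed.

Lemma fm_rev f w : conjugating f -> red (fm f (rev w)) = red (rev (fm f w)).
Proof.
move=> Hf; elim: w => [|i w IH] //.
rewrite rev_cons -cats1 fm_cat fm1 fm_cons rev_cat.
apply: red_cat => //; have [c Hc] := Hf i.
by rewrite (red_rev Hc) Hc rev_cat rev_cons revK -cats1 -catA.
Qed.

Lemma comp_conj f g i c d : conjugating f ->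
  red (g i) = red (c ++ i :: rev c) -> red (f i) = red (d ++ i :: rev d) ->
  red (comp f g i) = red ((fm f c ++ d) ++ i :: rev (fm f c ++ d)).
Proof.
move=> Hf Hc Hd; rewrite red_comp (fm_congr (conjugating_involutory Hf) Hc).
rewrite fm_cat fm_cons rev_cat -!catA; apply: red_cat => //.
rewrite -cat_cons catA; apply: red_cat => //; exact: fm_rev.
Qed.

Lemma conjugating_comp f g : conjugating f -> conjugating g -> conjugating (comp f g).
Proof.
move=> Hf Hg i; have [c Hc] := Hg i; have [d Hd] := Hf i.
by exists (fm f c ++ d); exact: comp_conj.
Qed.

Lemma conjugating_idA : conjugating (@idA n).
Proof. by move=> i; exists [::]. Qed.

Lemma conjugating_inn c : conjugating (inn c).
Proof. by move=> i; exists c. Qed.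

Lemma conjugating_pc i (D : {set 'I_n}) : conjugating (pc i D).
Proof. by move=> j; rewrite /pc; case: ifP => _; [exists [:: i]|exists [::]]. Qed.

Lemma conjugating_prodpc ps : conjugating (@prodpc n ps).
Proof.
elim: ps => [|p ps IH]; first exact: conjugating_idA.
by apply: conjugating_comp => //; exact: conjugating_pc.
Qed.

Lemma pc_involution i (D : {set 'I_n}) : i \notin D -> aeq (comp (pc i D) (pc i D)) (@idA n).
Proof.
move=> iD j; rewrite red_comp /idA /pc; case jD: (j \in D); last by rewrite fm1 jD.
rewrite /fm /= (negbTE iD) jD cats0.
by rewrite -[LHS]/(red [:: i, i, j, i & [:: i]]) red_cons2 -cat1s -red_catr red_cons2.
Qed.

Lemma fm_inn c w : red (fm (inn c) w) = red (c ++ w ++ rev c).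
Proof.
elim: w => [|i w IH]; first by rewrite red_cat_rev.
rewrite fm_cons (@red_cat _ _ _ _ (erefl _) IH) /inn -!catA.
by apply: red_cat => //; apply: red_cons; rewrite red_rev_catK.
Qed.

Lemma comp_inn f c : conjugating f -> aeq (comp f (inn c)) (comp (inn (fm f c)) f).
Proof.
move=> Hf i; rewrite !red_comp fm_inn /inn fm_cat fm_cons.
by apply: red_cat => //; apply: red_cat => //; exact: fm_rev.
Qed.

Lemma inn_cat c d : aeq (comp (inn c) (inn d)) (inn (c ++ d)).
Proof. by move=> i; rewrite red_comp fm_inn /inn rev_cat -!catA. Qed.

Lemma inn_congr c d : red c = red d -> aeq (inn c) (inn d).
Proof. by move=> e i; apply: red_cat => //; apply: red_cons; exact: red_rev. Qed.

Lemma inn_nil : aeq (inn (Nil 'I_n)) (@idA n).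
Proof. by []. Qed.

(** * Equality modulo inner automorphisms *)

Definition oeq f g : Prop := exists c, aeq f (comp (inn c) g).

Lemma aeq_oeq f g : aeq f g -> oeq f g.
Proof.
move=> e; exists [::]; apply: (aeq_trans e); apply: aeq_sym.
by apply: aeq_trans (comp_aeql _ inn_nil) _; exact: comp_idl.
Qed.

Lemma inn_involutory c : involutory (inn c).
Proof. exact: conjugating_involutory (conjugating_inn c). Qed.

Lemma oeq_sym f g : oeq f g -> oeq g f.
Proof.
case=> c e; exists (rev c); apply: aeq_sym.
apply: aeq_trans (comp_aeqr (@inn_involutory _) e) _.
apply: aeq_trans (comp_assoc _ _ (@inn_involutory _)) _.
apply: aeq_trans (comp_aeql _ (inn_cat _ _)) _.
apply: aeq_trans (comp_aeql _ (inn_congr (d := [::]) (red_rev_cat c))) _.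
by apply: aeq_trans (comp_aeql _ inn_nil) _; exact: comp_idl.
Qed.

Lemma oeq_trans f g h : oeq f g -> oeq g h -> oeq f h.
Proof.
case=> c e [d e']; exists (c ++ d); apply: (aeq_trans e).
apply: aeq_trans (comp_aeqr (@inn_involutory _) e') _.
apply: aeq_trans (comp_assoc _ _ (@inn_involutory _)) _.
exact: comp_aeql (inn_cat _ _).
Qed.

Lemma oeq_compl f g g' : conjugating f -> oeq g g' -> oeq (comp f g) (comp f g').
Proof.
move=> Hf [c e]; have If := conjugating_involutory Hf; exists (fm f c).
apply: aeq_trans (comp_aeqr If e) _.
apply: aeq_trans (comp_assoc _ _ If) _.
apply: aeq_trans (comp_aeql _ (comp_inn _ Hf)) _.
exact: aeq_sym (comp_assoc _ _ (@inn_involutory _)).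
Qed.

Lemma oeq_compr f f' g : oeq f f' -> oeq (comp f g) (comp f' g).
Proof.
case=> c e; exists c; apply: aeq_trans (comp_aeql _ e) _.
exact: aeq_sym (comp_assoc _ _ (@inn_involutory _)).
Qed.

Lemma oeq_conjugating f g : oeq f g -> conjugating g -> conjugating f.
Proof.
case=> c e Hg; apply: conjugating_aeq (aeq_sym e) _.
by apply: conjugating_comp => //; exact: conjugating_inn.
Qed.

(** * A parity invariant of automorphisms modulo inner ones *)

(* Action of W_n on a set of four points factoring through the dihedral group
   of order 8; only the letters [i] and [j] act non-trivially. *)
Definition dact i j (k : 'I_n) (x : bool * bool) : bool * bool :=
  if k == i then (x.2, x.1) else if k == j then (~~ x.1, x.2) else x.

Definition drho i j w (x : bool * bool) := foldr (dact i j) x w.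

(** The letter i swaps the two coordinates and j negates the first one. Conjugating j by a word with
    an odd number of letters i therefore negates the second coordinate instead. *)
Definition dflip (b : bool) (x : bool * bool) : bool * bool :=
  if b then (x.1, ~~ x.2) else (~~ x.1, x.2).

(* The parity of the number of letters [i] in a word conjugating [j] to [f j]. *)
Definition ev i j f : bool := (drho i j (f j) (false, false)).2.

Definition par i w : bool := odd (count_mem i w).

Lemma dactK i j k : involutive (dact i j k).
Proof.
move=> [a b]; rewrite /dact; case: (k == i) => //=; case: (k == j) => //=.
by rewrite negbK.
Qed.

Lemma drho_red i j w x : drho i j (red w) x = drho i j w x.
Proof.
elim: w => [|k w IH] //=; rewrite -IH.
by case: (red w) => [|l u] //=; case: eqVneq => [->|//]; rewrite dactK.
Qed.

Lemma par_red i w : par i (red w) = par i w.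
Proof.
elim: w => [|k w IH] //=; rewrite /par /= oddD -/(par i w) -IH.
case: (red w) => [|l u] /=; first by rewrite /par /= oddD.
case: (eqVneq k l) => [->|_]; rewrite /par /= !oddD //.
by rewrite addbA addbb.
Qed.

Lemma par_cat i u v : par i (u ++ v) = par i u (+) par i v.
Proof. by rewrite /par count_cat oddD. Qed.

Lemma par_rev i u : par i (rev u) = par i u.
Proof. by rewrite /par count_rev. Qed.

Lemma drho_cat i j u v x : drho i j (u ++ v) x = drho i j u (drho i j v x).
Proof. exact: foldr_cat. Qed.

Lemma drho_flip i j w b x : j != i ->
  drho i j w (dflip b x) = dflip (b (+) par i w) (drho i j w x).
Proof.
move=> ji; elim: w b => [|k w IH] b; first by rewrite /par /= addbF.
have -> : par i (k :: w) = (k == i) (+) par i w by rewrite /par /= oddD oddb.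
rewrite /= IH; case: (drho i j w x) => y z; rewrite /dact.
case: (eqVneq k i) => [_|ki] /=; first by case: b; case: (par i w).
by case: (eqVneq k j) => [_|_]; case: (b (+) par i w).
Qed.

Lemma drho_conj i j c x : j != i -> drho i j (c ++ j :: rev c) x = dflip (par i c) x.
Proof.
move=> ji; rewrite drho_cat /=.
have E y : dact i j j y = dflip false y by rewrite /dact (negbTE ji) eqxx.
by rewrite E drho_flip // -drho_cat -drho_red red_cat_rev.
Qed.

(** The conjugator c is not unique. Reading its parity off the action on four points makes it
    independent of that choice. *)
Lemma ev_conj i j f c : j != i -> red (f j) = red (c ++ j :: rev c) -> ev i j f = par i c.
Proof. by move=> ji e; rewrite /ev -drho_red e drho_red drho_conj //; case: (par i c). Qed.

Lemma ev_aeq i j f g : aeq f g -> ev i j f = ev i j g.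
Proof. by move=> e; rewrite /ev -drho_red e drho_red. Qed.

Lemma par_fm i f w : conjugating f -> par i (fm f w) = par i w.
Proof.
move=> Hf; elim: w => [|k w IH] //; rewrite fm_cons -[k :: w]cat1s !par_cat IH.
congr (_ (+) _); have [c Hc] := Hf k.
rewrite -par_red Hc par_red -cat1s !par_cat par_rev.
by rewrite addbC -addbA addbb addbF.
Qed.

(** A conjugator for the composite is f(c) d, and f preserves the parity of each letter, so [ev i j]
    is additive. An inner automorphism shifts [ev i j] by the same amount for all j, so the
    differences of [ev i d] and [ev i j] depend only on the outer class. *)
Lemma ev_comp i j f g : j != i -> conjugating f -> conjugating g ->
  ev i j (comp f g) = ev i j f (+) ev i j g.
Proof.
move=> ji Hf Hg; have [c Hc] := Hg j; have [d Hd] := Hf j.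
rewrite (ev_conj ji (comp_conj Hf Hc Hd)) (ev_conj ji Hc) (ev_conj ji Hd).
by rewrite par_cat par_fm // addbC.
Qed.

Lemma ev_inn i j c : j != i -> ev i j (inn c) = par i c.
Proof. by move=> ji; exact: ev_conj. Qed.

Lemma ev_pc i j k (D : {set 'I_n}) : j != i -> ev i j (pc k D) = (k == i) && (j \in D).
Proof.
move=> ji; case jD: (j \in D).
  rewrite (@ev_conj _ _ _ [:: k]) ?andbT //; first by rewrite /par /= addn0 oddb.
  by rewrite /pc jD.
rewrite (@ev_conj _ _ _ [::]) ?andbF // /pc jD //.
Qed.

Lemma ev_idA i j : j != i -> ev i j (@idA n) = false.
Proof. by move=> ji; rewrite (@ev_conj _ _ _ [::]). Qed.

End Words.

(** * Hypertrees, folds and carried automorphisms *)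

Section Hypertrees.
Variable n : nat.
Implicit Types (i j u v w : 'I_n) (D E F : {set 'I_n}) (T L : {set {set 'I_n}}).

Lemma walk1 T u v E : u != v -> E \in T -> u \in E -> v \in E -> walk T u v [:: v] [:: E].
Proof.
move=> uv ET uE vE; split => //=; first by rewrite inE uv.
  by move=> F; rewrite inE => /eqP ->.
by case.
Qed.

Lemma walk2 T u v w E F : uniq [:: u; v; w] -> E != F -> E \in T -> F \in T ->
  u \in E -> v \in E -> v \in F -> w \in F -> walk T u w [:: v; w] [:: E; F].
Proof.
move=> Hu EF ET FT uE vE vF wF; split => //=.
- by split => //; rewrite inE EF.
- by move=> G; rewrite !inE => /orP[] /eqP ->.
- by case=> [|[|]].
Qed.

Lemma walk_uniq T u v vs es vs' es' : hypertree T ->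
  walk T u v vs es -> walk T u v vs' es' -> vs = vs' /\ es = es'.
Proof.
case=> _ /(_ u v) [vs0 [es0 [_ H]]] /H [-> ->] /H [-> ->] //.
Qed.

Lemma hypertree_meet T u v E F : hypertree T -> u != v -> E \in T -> F \in T ->
  u \in E -> v \in E -> u \in F -> v \in F -> E = F.
Proof.
move=> HT uv ET FT uE vE uF vF.
by have [_ []] := walk_uniq HT (walk1 uv ET uE vE) (walk1 uv FT uF vF).
Qed.

(** Edgewise form of [carries]: a walk avoiding i stays in D one hyperedge at a time. It replaces a
    quantification over walks by a finite check and makes monotonicity under folds immediate. *)
Definition lcarries T i D : Prop := forall E d j, E \in T -> d \in E -> j \in E ->
  d != i -> j != i -> d \in D -> j \in D.

Lemma carriesP T i D : carries T i D <-> lcarries T i D.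
Proof.
split => [H E d j ET dE jE di ji dD|H d j dD jD ji vs es [sz [us _] inT Hn lst]].
  case: (boolP (j \in D)) => // jD.
  have dj : d != j by apply: contraNneq jD => <-.
  have := H d j dD jD ji _ _ (walk1 dj ET dE jE).
  by rewrite !inE => /orP[] /eqP e; rewrite e eqxx in di ji.
case: (boolP (i \in d :: vs)) => // iV.
suff Hk k : k <= size vs -> nth d (d :: vs) k \in D.
  by move: jD; rewrite -lst (last_nth d) Hk.
elim: k => [|k IH] //= ks.
have [nk nk1] := Hn k ltac:(by rewrite -sz).
have ne l : l <= size vs -> nth d (d :: vs) l != i.
  by move=> ls; apply: contraNneq iV => <-; apply: mem_nth.
apply: (H (nth set0 es k)) (nk) _ _ _ (IH (ltnW ks)) => //.
- by apply: inT; apply: mem_nth; rewrite -sz.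
- exact: ne (ltnW ks).
- exact: (ne k.+1).
Qed.

(** Two hyperedges go and at most one new one comes. The number of hyperedges is thus a strict rank,
    which gives antisymmetry of [htle] and later excludes inversions of simplices. *)
Lemma foldb_card L T : foldb L T -> #|T| < #|L|.
Proof.
case/existsP=> E /existsP[F /and5P[EL FL EF _ /eqP ->]].
have c1 : #|L| = (#|L :\ E :\ F|).+2.
  by rewrite (cardsD1 E) EL (cardsD1 F) !inE eq_sym EF FL.
rewrite c1 ltnS; apply: leq_trans (leq_card_setU _ _) _.
by rewrite cards1 addn1.
Qed.

Lemma foldb_refine L T E : foldb L T -> E \in L -> exists2 F, F \in T & E \subset F.
Proof.
case/existsP=> E1 /existsP[E2 /and5P[_ _ _ _ /eqP ->]] EL.
case: (eqVneq E E1) => [->|n1].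
  by exists (E1 :|: E2); rewrite ?subsetUl // !inE eqxx orbT.
case: (eqVneq E E2) => [->|n2].
  by exists (E1 :|: E2); rewrite ?subsetUr // !inE eqxx orbT.
by exists E => //; rewrite !inE n1 n2 EL.
Qed.

Lemma htle_refl T : htle T T.
Proof. exact: connect0. Qed.

Lemma htle_trans T1 T2 T3 : htle T1 T2 -> htle T2 T3 -> htle T1 T3.
Proof. by move=> h1 h2; apply: connect_trans h2 h1. Qed.

Lemma htle_ind (P : {set {set 'I_n}} -> {set {set 'I_n}} -> Prop) :
  (forall T, P T T) -> (forall T L1 L, foldb L L1 -> htle T L1 -> P T L1 -> P T L) ->
  forall T L, htle T L -> P T L.
Proof.
move=> H0 HS T L /connectP[p]; elim: p L => [|L1 p IH] L /=; first by move=> _ ->.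
move=> /andP[f1 pp] e; apply: (HS _ L1) => //; first by apply/connectP; exists p.
exact: IH.
Qed.

Lemma htle_card T L : htle T L -> #|T| <= #|L|.
Proof.
elim/htle_ind => // {}T L1 {}L /foldb_card h _ h1; exact: leq_trans h1 (ltnW h).
Qed.

Lemma htle_card_eq T L : htle T L -> #|L| <= #|T| -> T = L.
Proof.
elim/htle_ind => // {}T L1 {}L /foldb_card h /htle_card h1 _ h2.
by have := leq_trans (leq_trans h h2) h1; rewrite ltnn.
Qed.

Lemma htle_anti T L : htle T L -> htle L T -> T = L.
Proof. by move=> h1 /htle_card; exact: htle_card_eq. Qed.

Lemma htle_refine T L E : htle T L -> E \in L -> exists2 F, F \in T & E \subset F.
Proof.
move=> h; move: h E; elim/htle_ind => [{}T E ET|{}T L1 {}L f1 _ IH E EL]; first by exists E.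
have [F FL1 EF] := foldb_refine f1 EL; have [G GT FG] := IH F FL1.
by exists G => //; exact: subset_trans EF FG.
Qed.

Lemma htle_subset T L : htle T L -> L \subset T -> T = L.
Proof. by move=> h /subset_leq_card; exact: htle_card_eq. Qed.

Lemma carries_mono T L i D : htle T L -> carries T i D -> carries L i D.
Proof.
move=> h /carriesP H; apply/carriesP => E d j EL dE jE.
have [F FT EF] := htle_refine h EL.
by apply: (H F) => //; apply: (subsetP EF).
Qed.

(** * Carried automorphisms *)

Implicit Types (f g a b : endo n) (ps : seq ('I_n * {set 'I_n})).

Definition carriedpc T (p : 'I_n * {set 'I_n}) : Prop :=
  validpc p.1 p.2 /\ carries T p.1 p.2.

Definition carriedf T f : Prop := exists ps,
  (forall p, p \in ps -> carriedpc T p) /\ oeq f (prodpc ps).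

Lemma carriedf_conjugating T f : carriedf T f -> conjugating f.
Proof. by case=> ps [_ /oeq_conjugating]; apply; exact: conjugating_prodpc. Qed.

Lemma carriedf_id T : carriedf T (@idA n).
Proof. by exists [::]; split => //; exact: aeq_oeq. Qed.

Lemma carriedf_inn T c : carriedf T (inn c).
Proof. by exists [::]; split => //; exists c; exact: aeq_sym (comp_idr _). Qed.

Lemma carriedf_pc T i D : i \notin D -> carries T i D -> carriedf T (pc i D).
Proof.
move=> iD H; case: (eqVneq D set0) => [->|D0].
  exists [::]; split => //; apply: aeq_oeq => j; by rewrite /pc inE.
exists [:: (i, D)]; split; first by move=> p; rewrite inE => /eqP ->.
by apply: aeq_oeq; exact: aeq_sym (comp_idr _).
Qed.

Lemma carriedf_aeq T f g : aeq f g -> carriedf T f -> carriedf T g.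
Proof.
move=> e [ps [H1 H2]]; exists ps; split => //.
exact: oeq_trans (aeq_oeq (aeq_sym e)) H2.
Qed.

Lemma prodpc_cat ps qs : aeq (prodpc (ps ++ qs)) (comp (prodpc ps) (prodpc qs)).
Proof.
elim: ps => [|p ps IH] /=; first exact: aeq_sym (comp_idl _).
have Ip := conjugating_involutory (@conjugating_pc n p.1 p.2).
apply: aeq_trans (comp_aeqr Ip IH) _; exact: comp_assoc.
Qed.

Lemma carriedf_comp T f g : carriedf T f -> carriedf T g -> carriedf T (comp f g).
Proof.
move=> Hf [qs [Hq eg]]; have Cf := carriedf_conjugating Hf.
case: Hf => ps [Hp ef]; exists (ps ++ qs); split.
  by move=> p; rewrite mem_cat => /orP[/Hp|/Hq].
apply: oeq_trans (oeq_compl Cf eg) _.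
apply: oeq_trans (oeq_compr _ ef) _.
exact: aeq_oeq (aeq_sym (prodpc_cat _ _)).
Qed.

Lemma prodpc_inverse ps : (forall p, p \in ps -> validpc p.1 p.2) ->
  aeq (comp (prodpc ps) (prodpc (rev ps))) (@idA n).
Proof.
elim: ps => [|p ps IH] H; first exact: comp_idl.
have Ip := conjugating_involutory (@conjugating_pc n p.1 p.2).
have Iq qs := conjugating_involutory (@conjugating_prodpc n qs).
rewrite rev_cons -cats1.
apply: aeq_trans (aeq_sym (comp_assoc _ _ Ip)) _.
apply: aeq_trans (comp_aeqr Ip _) _; last first.
  by apply: pc_involution; case: (H p _) => //; rewrite inE eqxx.
apply: aeq_trans (comp_aeqr (Iq _) (prodpc_cat _ _)) _.
apply: aeq_trans (comp_assoc _ _ (Iq _)) _.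
apply: aeq_trans (comp_aeql _ (IH _)) _; first by move=> q qs; apply: H; rewrite inE qs orbT.
apply: aeq_trans (comp_idl _) _; exact: comp_idr.
Qed.

Lemma carriedf_inverse T f : carriedf T f ->
  exists f', [/\ carriedf T f', aeq (comp f f') (@idA n) & aeq (comp f' f) (@idA n)].
Proof.
case=> ps [Hp [c e]]; pose g := prodpc (rev ps).
have Hv p : p \in ps -> validpc p.1 p.2 by move=> /Hp [].
have Ig : involutory g by apply: conjugating_involutory; exact: conjugating_prodpc.
have IP : involutory (prodpc ps) by apply: conjugating_involutory; exact: conjugating_prodpc.
have Ic d := @inn_involutory n d.
have pg : aeq (comp (prodpc ps) g) (@idA n) by exact: prodpc_inverse.
have gp : aeq (comp g (prodpc ps)) (@idA n).
  by rewrite /g -{2}[ps]revK; apply: prodpc_inverse => p; rewrite mem_rev; exact: Hv.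
have cc d : aeq (comp (inn d) (inn (rev d))) (@idA n).
  apply: aeq_trans (inn_cat _ _) _; exact: (inn_congr (d := [::]) (red_cat_rev d)).
exists (comp g (inn (rev c))); split.
- apply: carriedf_comp (carriedf_inn _ _); exists (rev ps); split; last exact: aeq_oeq.
  by move=> p; rewrite mem_rev; exact: Hp.
- apply: aeq_trans (comp_aeql _ e) _.
  apply: aeq_trans (aeq_sym (comp_assoc _ _ (Ic _))) _.
  apply: aeq_trans (comp_aeqr (Ic _) (comp_assoc _ _ IP)) _.
  apply: aeq_trans (comp_aeqr (Ic _) (comp_aeql _ pg)) _.
  by apply: aeq_trans (comp_aeqr (Ic _) (comp_idl _)) _.
- have If : involutory f.
    apply: conjugating_involutory; apply: (oeq_conjugating (g := prodpc ps)); first by exists c.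
    exact: conjugating_prodpc.
  apply: aeq_trans (comp_aeqr _ e) _.
    apply: conjugating_involutory; apply: conjugating_comp; last exact: conjugating_inn.
    exact: conjugating_prodpc.
  apply: aeq_trans (aeq_sym (comp_assoc _ _ Ig)) _.
  apply: aeq_trans (comp_aeqr Ig (comp_assoc _ _ (Ic _))) _.
  have := cc (rev c); rewrite revK => cc'.
  apply: aeq_trans (comp_aeqr Ig (comp_aeql _ cc')) _.
  by apply: aeq_trans (comp_aeqr Ig (comp_idl _)) _.
Qed.

Lemma rel_carried T a b : rel T a b -> exists2 f, carriedf T f & aeq b (comp a f).
Proof.
case=> c [ps [H e]]; exists (comp (inn c) (prodpc ps)) => //.
by exists ps; split => //; exists c.
Qed.

Lemma carried_rel T a b f : conjugating a -> carriedf T f -> aeq b (comp a f) -> rel T a b.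
Proof.
move=> /conjugating_involutory Ia [ps [H [c ef]]] e; exists c, ps; split => //.
exact: aeq_trans e (comp_aeqr Ia ef).
Qed.

Lemma rel_conjugating T a b : conjugating a -> rel T a b -> conjugating b.
Proof.
move=> Ca /rel_carried[f /carriedf_conjugating Cf e].
by apply: conjugating_aeq (aeq_sym e) _; exact: conjugating_comp.
Qed.

Lemma rel_refl T a : conjugating a -> rel T a a.
Proof. by move=> Ca; apply: (carried_rel Ca (carriedf_id T)); exact: aeq_sym (comp_idr _). Qed.

Lemma rel_sym T a b : conjugating a -> rel T a b -> rel T b a.
Proof.
move=> Ca ab; have Cb := rel_conjugating Ca ab; have Ia := conjugating_involutory Ca.
case/rel_carried: ab => f Hf e; have [f' [Hf' ff' _]] := carriedf_inverse Hf.
apply: (carried_rel Cb Hf'); apply: aeq_sym.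
apply: aeq_trans (comp_aeql _ e) _; apply: aeq_trans (aeq_sym (comp_assoc _ _ Ia)) _.
by apply: aeq_trans (comp_aeqr Ia ff') _; exact: comp_idr.
Qed.

Lemma rel_trans T a b c : conjugating a -> rel T a b -> rel T b c -> rel T a c.
Proof.
move=> Ca /rel_carried[f Hf e] /rel_carried[g Hg e'].
apply: (carried_rel Ca (carriedf_comp Hf Hg)).
apply: aeq_trans e' _; apply: aeq_trans (comp_aeql _ e) _.
exact: aeq_sym (comp_assoc _ _ (conjugating_involutory Ca)).
Qed.

Lemma rel_mono T L a b : htle T L -> rel T a b -> rel L a b.
Proof.
move=> h [c [ps [H e]]]; exists c, ps; split => // p /H [v k]; split => //.
exact: carries_mono k.
Qed.

Lemma rel_compl T f a b : conjugating f -> rel T a b -> rel T (comp f a) (comp f b).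
Proof.
move=> /conjugating_involutory If [c [ps [H e]]]; exists c, ps; split => //.
apply: aeq_trans (comp_aeqr If e) _; exact: comp_assoc.
Qed.

Lemma aeq_rel T a b : conjugating a -> aeq a b -> rel T a b.
Proof.
move=> Ca e; apply: (carried_rel Ca (carriedf_id T)).
exact: aeq_trans (aeq_sym e) (aeq_sym (comp_idr _)).
Qed.

Lemma rel_idA_carried T f : carriedf T f -> rel T (@idA n) f.
Proof.
by move=> Hf; apply: (carried_rel (@conjugating_idA n) Hf); exact: aeq_sym (comp_idl _).
Qed.

(** Two vertices of one hyperedge, both different from i, lie both inside or both outside D for
    every carried x_{i,D}; so the difference of the two parities is unchanged by carried factors. *)
Lemma carriedf_ev T f E i d j : carriedf T f -> E \in T -> d \in E -> j \in E ->
  d != i -> j != i -> ev i d f = ev i j f.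
Proof.
move=> [ps [H [c e]]] ET dE jE di ji; rewrite !(ev_aeq _ _ e).
have CP := @conjugating_prodpc n; have Cc := @conjugating_inn n c.
rewrite !ev_comp // !ev_inn //; congr (_ (+) _).
elim: ps H {e} => [|p ps IH] H; first by rewrite !ev_idA.
rewrite /= !ev_comp //; [|exact: conjugating_pc|exact: conjugating_pc].
rewrite IH; last by move=> q qs; apply: H; rewrite inE qs orbT.
congr (_ (+) _); rewrite !ev_pc //; case: eqP => //= ei.
have [_ /carriesP K] := H p ltac:(by rewrite inE eqxx).
rewrite ei in K; apply/idP/idP => h; [exact: (K E d j)|exact: (K E j d)].
Qed.

Lemma rel_ev T a b E i d j : conjugating a -> rel T a b -> E \in T -> d \in E -> j \in E ->
  d != i -> j != i -> ev i d a (+) ev i d b = ev i j a (+) ev i j b.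
Proof.
move=> Ca /rel_carried[f Hf e] ET dE jE di ji; have Cf := carriedf_conjugating Hf.
rewrite !(ev_aeq _ _ e) !ev_comp // !addbA !addbb.
by rewrite (carriedf_ev Hf ET dE jE).
Qed.

(** * Finiteness of the carried group *)

Lemma pc_comm i k D E : i \notin E -> k \notin D -> i != k -> [disjoint D & E] ->
  aeq (comp (pc i D) (pc k E)) (comp (pc k E) (pc i D)).
Proof.
move=> iE kD ik DE j; rewrite !red_comp /pc.
case jE: (j \in E); case jD: (j \in D).
- by move/pred0P: DE => /(_ j); rewrite /= jD jE.
- by rewrite /fm /= (negbTE kD) jD jE.
- by rewrite /fm /= (negbTE iE) jD jE.
- by rewrite /fm /= jD jE.
Qed.

Lemma pc_comm_same i D E : i \notin E -> i \notin D ->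
  aeq (comp (pc i D) (pc i E)) (comp (pc i E) (pc i D)).
Proof.
move=> iE iD j; rewrite !red_comp /pc.
case jE: (j \in E); case jD: (j \in D).
- by rewrite /fm /= (negbTE iE) (negbTE iD) jD jE.
- by rewrite /fm /= (negbTE iD) jD jE.
- by rewrite /fm /= (negbTE iE) jD jE.
- by rewrite /fm /= jD jE.
Qed.

(** Conjugation by a_i turns x_{i,D} into the partial conjugation on this complement, so modulo
    inner automorphisms D may be replaced by it. *)
Definition copc i D : {set 'I_n} := ~: (i |: D).

Lemma pc_copc i D : i \notin D -> oeq (pc i D) (pc i (copc i D)).
Proof.
move=> iD; exists [:: i] => j; rewrite red_comp /pc !inE negb_or.
case: (eqVneq j i) => [->|ji]; first by rewrite (negbTE iD) andFb fm_inn -[RHS]/(red [:: i, i & [:: i]]) red_cons2.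
case jD: (j \in D); rewrite andTb fm_inn //=.
by rewrite -[RHS]/(red [:: i, i, j, i & [:: i]]) red_cons2 -[RHS]/(red ([:: j] ++ [:: i; i])) -red_catr red_cons2.
Qed.

Lemma carries_copc T i D : i \notin D -> carries T i D -> carries T i (copc i D).
Proof.
move=> iD /carriesP H; apply/carriesP => E d j ET dE jE di ji.
rewrite !inE !negb_or di ji /=; apply: contra; exact: (H E).
Qed.

(** For x in both sets, the walk from x to k leaves D and so visits i. Its initial segment up to i
    leaves E and so visits k, although k is the last vertex of the whole walk and differs from i. *)
Lemma hypertree_disjoint_carried T i k D E : hypertree T ->
  carries T i D -> carries T k E -> i != k -> i \notin D -> k \notin E ->
  i \notin E -> k \notin D -> [disjoint D & E].
Proof.
move=> HT cD cE ik iD kE iE kD; apply/pred0P => x /=; apply/negbTE/negP => /andP[xD xE].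
have [vs [es [W _]]] := proj2 HT x k.
have xi : x != i by apply: contraNneq iD => <-.
have := cD x k xD kD ltac:(by rewrite eq_sym) vs es W.
rewrite inE eq_sym (negbTE xi) /= => iV.
case: W => sz [us ue] inT Hn lst.
(* Cutting the walk at i: the successor accounts for [vs] not containing the starting vertex x. *)
pose m := (index i vs).+1.
have mvs : m <= size vs by rewrite index_mem.
have W' : walk T x i (take m vs) (take m es).
  split.
  - by rewrite !size_take -sz.
  - split; last exact: take_uniq.
    by have := take_uniq m.+1 us.
  - by move=> F /mem_take; exact: inT.
  - rewrite size_takel -?sz // => j jm.
    have := Hn j ltac:(by rewrite -sz; exact: leq_trans jm mvs).
    by rewrite -![x :: take m vs]/(take m.+1 (x :: vs)) !nth_take // ltnW.
  - by rewrite (last_nth x) size_takel // -[x :: _]/(take m.+1 (x :: vs)) nth_take //= nth_index.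
have := cE x i xE iE ik _ _ W'.
rewrite inE => /orP[/eqP xk|]; first by rewrite xk xE in kE.
have e : index k (x :: vs) = size vs by rewrite -lst index_last.
have xk : x != k by apply: contraNneq kD => <-.
rewrite /= (negbTE xk) in e.
have kvs : k \in vs by rewrite -index_mem -e.
rewrite in_take // ltnS => ki.
have ik' : index i vs <= index k vs by rewrite -ltnS e index_mem.
have {ki ik'} ee : index k vs = index i vs by apply/eqP; rewrite eqn_leq ki ik'.
by move: ik; rewrite -(nth_index x iV) -(nth_index x kvs) ee eqxx.
Qed.

(** After passing to complements one may assume k outside D and i outside E. The two sets are then
    disjoint and the partial conjugations commute on the nose. *)
Lemma carried_pc_comm T i D k E : hypertree T -> carriedpc T (i, D) -> carriedpc T (k, E) ->
  oeq (comp (pc i D) (pc k E)) (comp (pc k E) (pc i D)).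
Proof.
move=> HT [[/= _ iD] cD] [[/= _ kE] cE].
case: (eqVneq i k) => [ik|ik]; first by subst k; apply: aeq_oeq; exact: pc_comm_same.
have [D' [iD' cD' kD' eD]] : exists D', [/\ i \notin D', carries T i D', k \notin D' & oeq (pc i D) (pc i D')].
  case: (boolP (k \in D)) => kD; last by exists D; split => //; exact: aeq_oeq.
  exists (copc i D); split; [by rewrite !inE eqxx|exact: carries_copc|by rewrite !inE kD orbT|exact: pc_copc].
have [E' [kE' cE' iE' eE]] : exists E', [/\ k \notin E', carries T k E', i \notin E' & oeq (pc k E) (pc k E')].
  case: (boolP (i \in E)) => iE; last by exists E; split => //; exact: aeq_oeq.
  exists (copc k E); split; [by rewrite !inE eqxx|exact: carries_copc|by rewrite !inE iE orbT|exact: pc_copc].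
have Cp := @conjugating_pc n.
apply: oeq_trans (oeq_compr _ eD) _; apply: oeq_trans (oeq_compl (Cp _ _) eE) _.
apply: oeq_trans (aeq_oeq (pc_comm _ _ _ _)) _ => //.
  exact: (hypertree_disjoint_carried HT cD' cE').
apply: oeq_trans (oeq_compl (Cp _ _) (oeq_sym eD)) _.
exact: oeq_compr (oeq_sym eE).
Qed.

(** Carried partial conjugations are commuting involutions modulo inner ones, so only the parity of
    each generator matters: every new generator doubles the list [Y]. *)
Lemma commuting_products_finite T (gs : seq ('I_n * {set 'I_n})) : hypertree T ->
  (forall p, p \in gs -> carriedpc T p) ->
  exists Y : seq (endo n), (forall y, List.In y Y -> conjugating y) /\
    forall ps, {subset ps <= gs} -> exists2 y, List.In y Y & oeq (prodpc ps) y.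
Proof.
move=> HT; elim: gs => [|q gs IH] Hgs.
  exists [:: @idA n]; split; first by move=> y [<-|//]; exact: conjugating_idA.
  move=> [|p ps] Hps; last by have := Hps p; rewrite !inE eqxx => /(_ isT).
  by exists (@idA n); [left|exact: aeq_oeq].
have [|Y [CY HY]] := IH; first by move=> p pg; apply: Hgs; rewrite inE pg orbT.
have Cp := @conjugating_pc n; have Ip i D := conjugating_involutory (Cp i D).
have [[/= _ qq] _] := Hgs q (mem_head _ _).
pose Q := pc q.1 q.2.
exists (Y ++ map (comp Q) Y); split.
  move=> y /List.in_app_iff[/CY //|/List.in_map_iff[z [<- /CY Cz]]].
  exact: conjugating_comp (Cp _ _) Cz.
move=> ps Hps.
have {Hps} [b [qs Hqs e]] : exists b : bool, exists2 qs : seq ('I_n * {set 'I_n}), {subset qs <= gs} &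
    oeq (prodpc ps) (if b then comp Q (prodpc qs) else prodpc qs).
  elim: ps Hps => [|p ps IHp] Hps; first by exists false, [::] => //; exact: aeq_oeq.
  have [|b [qs Hqs e]] := IHp; first by move=> r rp; apply: Hps; rewrite inE rp orbT.
  have e1 := oeq_compl (Cp p.1 p.2) e.
  move: (Hps p (mem_head _ _)); rewrite inE => /orP[/eqP pq|pg].
    exists (~~ b), qs => //; rewrite /= pq in e1 *; apply: oeq_trans e1 _.
    case: (b) => /=; last exact: aeq_oeq.
    apply: aeq_oeq; apply: aeq_trans (comp_assoc _ _ (Ip _ _)) _.
    apply: aeq_trans (comp_aeql _ (pc_involution qq)) _; exact: comp_idl.
  exists b, (p :: qs); first by move=> r; rewrite inE => /orP[/eqP ->|/Hqs].
  apply: oeq_trans e1 _; case: (b); last exact: aeq_oeq.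
  apply: oeq_trans (aeq_oeq (comp_assoc _ _ (Ip _ _))) _.
  apply: oeq_trans (oeq_compr _ _) (aeq_oeq (aeq_sym (comp_assoc _ _ (Ip _ _)))).
  have H1 : carriedpc T (p.1, p.2) by rewrite -surjective_pairing; apply: Hgs; rewrite inE pg orbT.
  have H2 : carriedpc T (q.1, q.2) by rewrite -surjective_pairing; apply: Hgs; rewrite inE eqxx.
  exact: (carried_pc_comm HT H1 H2).
have [y yY ey] := HY qs Hqs; case: (b) e => e.
  exists (comp Q y); first by apply/List.in_app_iff; right; exact: List.in_map.
  exact: oeq_trans e (oeq_compl (Cp _ _) ey).
exists y; first by apply/List.in_app_iff; left.
exact: oeq_trans e ey.
Qed.

Lemma carried_finite T : hypertree T ->
  exists Y : seq (endo n), (forall y, List.In y Y -> conjugating y) /\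
    forall f, carriedf T f -> exists2 y, List.In y Y & oeq f y.
Proof.
move=> HT.
pose ok p : bool := if excluded_middle_informative (carriedpc T p) then true else false.
have okP p : reflect (carriedpc T p) (ok p).
  by rewrite /ok; case: excluded_middle_informative => h; constructor.
have [p /[!mem_filter] /andP[/okP] //|Y [CY HY]] :=
  @commuting_products_finite T [seq p <- enum {: 'I_n * {set 'I_n}} | ok p] HT.
exists Y; split => // f [ps [Hps e]].
have [|y yY ey] := HY ps.
  by move=> p /Hps h; rewrite mem_filter mem_enum andbT; exact/okP.
by exists y => //; exact: oeq_trans e ey.
Qed.

End Hypertrees.

(** * Vertices, chains and points *)

Section Points.
Variable n : nat.
Implicit Types (u v w : vtx n) (s : seq (vtx n)) (x y z : pt n).

Definition vconj v : Prop := conjugating v.1.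

Lemma valid_vconj v : validV v -> vconj v.
Proof. by case=> -[]. Qed.

Lemma veq_refl v : vconj v -> veq v v.
Proof. by move=> Cv; split => //; exact: rel_refl. Qed.

Lemma veq_vconj v w : vconj v -> veq v w -> vconj w.
Proof. by move=> Cv [_ /(rel_conjugating Cv)]. Qed.

Lemma veq_sym v w : vconj v -> veq v w -> veq w v.
Proof. by move=> Cv [e r]; split => //; rewrite -e; exact: rel_sym. Qed.

Lemma veq_trans u v w : vconj u -> veq u v -> veq v w -> veq u w.
Proof.
by move=> Cu [e r] [e' r']; split; [rewrite e|rewrite -e in r'; exact: rel_trans Cu r r'].
Qed.

Lemma veq_vle v w : veq v w -> vle v w.
Proof. by case=> e r; split; rewrite ?e //; [exact: htle_refl|rewrite -e]. Qed.

Lemma vle_veq v w : vle v w -> v.2 = w.2 -> veq v w.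
Proof. by case=> _ r e; split => //; rewrite e. Qed.

Lemma vle_trans u v w : vconj u -> vle u v -> vle v w -> vle u w.
Proof.
move=> Cu [h r] [h' r']; split; first exact: htle_trans h h'.
exact: rel_trans Cu (rel_mono h' r) r'.
Qed.

(** * Local finiteness of the poset *)

Lemma List_In_nth (T : Type) (d y : T) (s : seq T) : List.In y s ->
  exists2 k, k < size s & nth d s k = y.
Proof.
elim: s => //= z s IH [->|/IH[k ks e]]; first by exists 0.
by exists k.+1.
Qed.

Lemma oeq_inn_right T (f y : endo n) : carriedf T f -> oeq y f ->
  exists d, aeq y (comp f (inn d)).
Proof.
move=> Hf [c e]; have [f' [Hf' ff' f'f]] := carriedf_inverse Hf.
have Cf := carriedf_conjugating Hf; have Cf' := carriedf_conjugating Hf'.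
have If := conjugating_involutory Cf.
exists (fm f' c); apply: (aeq_trans e); apply: aeq_sym.
apply: aeq_trans (comp_inn _ Cf) _; apply: comp_aeql.
apply: inn_congr; rewrite -fm_comp (fm_aeq _ ff').
by congr red; elim: (c) => //= i w {2}<-.
Qed.

Definition comparable v w : Prop := vle v w \/ vle w v.

(** A vertex below [w, T] has marking w f with f carried by T, which leaves finitely many outer
    classes. A vertex above it is represented with marking w itself. In both cases the tree ranges
    over a finite set. *)
Lemma comparable_finite w : validV w -> exists N : seq (vtx n),
  forall v, validV v -> comparable v w -> exists2 k, k < size N & veq v (nth (v0 n) N k).
Proof.
case=> [[Cw _] Hw]; have [Y [CY HY]] := carried_finite Hw.
pose N := [seq (p.1, p.2) | p <- allpairs pair (w.1 :: map (comp w.1) Y) (enum {: {set {set 'I_n}}})].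
suff H v : validV v -> comparable v w -> exists2 u, List.In u N & veq v u.
  exists N => v Hv /(H v Hv)[u uN vu]; have [k kN e] := List_In_nth (v0 n) uN.
  by exists k => //; rewrite e.
have inE T : List.In T (enum {: {set {set 'I_n}}}).
  by have := mem_enum {: {set {set 'I_n}}} T; elim: (enum _) => //= a l IH; rewrite !inE => /orP[/eqP ->|/IH]; [left|right].
have inN f T : List.In f (w.1 :: map (comp w.1) Y) -> List.In (f, T) N.
  move=> Hf; apply/List.in_map_iff; exists (f, T); split => //.
  elim: (_ :: _) Hf => //= g l IH Hf; apply/List.in_app_iff; case: Hf => [->|/IH]; last by right.
  by left; apply: List.in_map.
move=> Hv [[h r]|[h r]].
  have r' := rel_sym (valid_vconj Hv) r.
  have [f Hf e] := rel_carried r'; have [y yY ey] := HY f Hf.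
  have [d ed] := oeq_inn_right Hf (oeq_sym ey).
  exists (comp w.1 y, v.2).
    by apply: inN; right; exact: List.in_map.
  split => //=; have Iw := conjugating_involutory Cw.
  apply: (carried_rel (valid_vconj Hv) (carriedf_inn _ d)).
  apply: aeq_trans (comp_aeqr Iw ed) _; apply: aeq_trans (comp_assoc _ _ Iw) _.
  exact: comp_aeql (aeq_sym e).
exists (w.1, v.2); first by apply: inN; left.
by split => //=; exact: rel_sym Cw r.
Qed.

Lemma chain_valid s i : chain s -> i < size s -> validV (nth (v0 n) s i).
Proof. by case=> _ + _; exact. Qed.

Lemma chain_vconj s i : chain s -> i < size s -> vconj (nth (v0 n) s i).
Proof. by move=> Hs /(chain_valid Hs); exact: valid_vconj. Qed.

Lemma chain_inj s i j : chain s -> i < size s -> j < size s ->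
  veq (nth (v0 n) s i) (nth (v0 n) s j) -> i = j.
Proof.
move=> Hs si sj e; have [_ _ H] := Hs.
case: (ltngtP i j) => // ij.
  by have [_ []] := H i j ij sj.
by have [_ []] := H j i ij si; exact: veq_sym (chain_vconj Hs si) e.
Qed.

Lemma chain_comparable s i j : chain s -> i < size s -> j < size s ->
  comparable (nth (v0 n) s i) (nth (v0 n) s j).
Proof.
move=> Hs si sj; have [_ _ H] := Hs; case: (ltngtP i j) => ij.
- by left; have [] := H i j ij sj.
- by right; have [] := H j i ij si.
- by left; rewrite ij; apply: veq_vle; apply: veq_refl; exact: chain_vconj.
Qed.

Lemma chain_inj2 s i j : chain s -> i < size s -> j < size s ->
  (nth (v0 n) s i).2 = (nth (v0 n) s j).2 -> i = j.
Proof.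
move=> Hs si sj e; case: (chain_comparable Hs si sj) => h.
  exact: (chain_inj Hs si sj (vle_veq h e)).
exact: esym (chain_inj Hs sj si (vle_veq h (esym e))).
Qed.

(** * Barycentric weights and supports of points *)

Lemma cwE x v : cw x v = rsum (size (psx x)) (fun i => indic (veq (nth (v0 n) (psx x) i) v) (pwt x i)).
Proof. by []. Qed.

Lemma cw_eq x v i : validpt x -> i < size (psx x) -> veq (nth (v0 n) (psx x) i) v ->
  cw x v = pwt x i.
Proof.
move=> [Hs _] si e; rewrite cwE (@rsum_only _ i) ?indicT // => j sj ji.
rewrite indicF // => e'; apply: ji; apply: (chain_inj Hs) => //.
have Cj := chain_vconj Hs sj.
exact: veq_trans Cj e' (veq_sym (chain_vconj Hs si) e).
Qed.

Lemma cw_nth x i : validpt x -> i < size (psx x) -> cw x (nth (v0 n) (psx x) i) = pwt x i.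
Proof. by move=> Hx si; apply: cw_eq => //; apply: veq_refl; case: Hx => Hs _; exact: chain_vconj. Qed.

Lemma cw_neq0 x v : validpt x -> cw x v <> 0%R ->
  exists i, [/\ i < size (psx x), veq (nth (v0 n) (psx x) i) v & cw x v = pwt x i].
Proof.
move=> Hx H.
have [i [si e]] : exists i, i < size (psx x) /\ veq (nth (v0 n) (psx x) i) v.
  apply: NNPP => K; apply: H; rewrite cwE rsum_const0 // => i si.
  by rewrite indicF // => e; apply: K; exists i.
by exists i; split => //; exact: cw_eq.
Qed.

Lemma cw_ge0 x v : validpt x -> (0 <= cw x v)%R.
Proof.
move=> Hx; case: (Req_dec (cw x v) 0) => [->|/(cw_neq0 Hx)[i [si _ ->]]]; first exact: Rle_refl.
by case: Hx => _ [+ _]; exact.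
Qed.

Lemma cw_veq x v w : validpt x -> vconj v -> veq v w -> cw x v = cw x w.
Proof.
move=> [Hs _] Cv e; rewrite !cwE; apply: eq_rsum => i si; apply: eq_indic.
have Ci := chain_vconj Hs si.
by split => h; [exact: veq_trans Ci h e|exact: veq_trans Ci h (veq_sym Cv e)].
Qed.

Lemma samept_refl x : samept x x. Proof. by []. Qed.

Lemma samept_sym x y : samept x y -> samept y x. Proof. by move=> H v. Qed.

Lemma samept_trans x y z : samept x y -> samept y z -> samept x z.
Proof. by move=> H K v; rewrite H. Qed.

Definition inside x s : Prop := forall i, i < size (psx x) -> (0 < pwt x i)%R ->
  exists2 k, k < size s & veq (nth (v0 n) (psx x) i) (nth (v0 n) s k).

(** Allows a point to be rewritten on any chain containing its support; this is how two points are
    brought into a common simplex. *)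
Lemma inside_rep x s : validpt x -> chain s -> inside x s ->
  validpt (Pt s (fun k => cw x (nth (v0 n) s k))) /\
  samept x (Pt s (fun k => cw x (nth (v0 n) s k))).
Proof.
move=> Hx Hs Hin; set y := Pt s _.
have Hsx := proj1 Hx.
have M1 f f' : (forall i j, i < size (psx x) -> j < size s ->
     veq (nth (v0 n) (psx x) i) (nth (v0 n) s j) -> f i = f' j) ->
   (forall i, i < size (psx x) -> pwt x i = 0%R -> f i = 0%R) ->
   (forall j, j < size s -> cw x (nth (v0 n) s j) = 0%R -> f' j = 0%R) ->
   rsum (size (psx x)) f = rsum (size s) f'.
  move=> H1 H2 H3.
  apply: (@rsum_match _ _ _ _ (fun i j => veq (nth (v0 n) (psx x) i) (nth (v0 n) s j))).
  - exact: H1.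
  - move=> i j j' si sj sj' e e'; apply: (chain_inj Hs) => //.
    have Ci := chain_vconj Hsx si.
    exact: veq_trans (veq_vconj Ci e) (veq_sym Ci e) e'.
  - move=> i i' j si si' sj e e'; apply: (chain_inj Hsx) => //.
    have Ci' := chain_vconj Hsx si'.
    exact: veq_trans (chain_vconj Hsx si) e (veq_sym Ci' e').
  - move=> i si fi; apply: Hin => //.
    case: (Req_dec (pwt x i) 0) => [/(H2 i si)//|ne].
    by have [_ [/(_ i si)]] := Hx; lra.
  - move=> j sj fj; case: (Req_dec (cw x (nth (v0 n) s j)) 0) => [/(H3 j sj)//|ne].
    by have [i [si e _]] := cw_neq0 Hx ne; exists i.
have Hy : validpt y.
  split => //; split; first by move=> i si; exact: cw_ge0.
  have [_ [_ <-]] := Hx; symmetry; apply: M1 => //.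
  by move=> i j si sj e /=; rewrite (cw_eq Hx si e).
split => // v; rewrite !cwE /=; apply: M1.
- move=> i j si sj e; rewrite (cw_eq Hx si e).
  have Ci := chain_vconj Hsx si.
  apply: eq_indic; split => h; last exact: veq_trans Ci e h.
  exact: veq_trans (veq_vconj Ci e) (veq_sym Ci e) h.
- by move=> i si ->; rewrite /indic; case: excluded_middle_informative.
- by move=> i si ->; rewrite /indic; case: excluded_middle_informative.
Qed.

Lemma samept_inside x y : validpt x -> validpt y -> samept x y -> inside x (psx y).
Proof.
move=> Hx Hy e i si pi; have := e (nth (v0 n) (psx x) i).
rewrite cw_nth // => e'; have [|k [sk h _]] := @cw_neq0 y (nth (v0 n) (psx x) i) Hy.
  by rewrite -e'; lra.
by exists k => //; exact: veq_sym (chain_vconj (proj1 Hy) sk) h.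
Qed.

Lemma samept_wt (s : seq (vtx n)) a b k : validpt (Pt s a) -> validpt (Pt s b) ->
  samept (Pt s a) (Pt s b) -> k < size s -> a k = b k.
Proof.
by move=> Ha Hb e sk; have := e (nth (v0 n) s k); rewrite (@cw_nth (Pt s a)) // (@cw_nth (Pt s b)).
Qed.

(** * Involutions of the poset *)

(** The properties of a symmetry of order two that the fixed-point argument uses. They are stated up
    to [veq] since the action is defined on representatives. *)
Record vinvol (F : vtx n -> vtx n) : Prop := VInvol {
  vinvol_valid : forall v, validV v -> validV (F v);
  vinvol_vle : forall v w, validV v -> validV w -> vle v w -> vle (F v) (F w);
  vinvol_veq : forall v w, vconj v -> veq v w -> veq (F v) (F w);
  vinvol_conj : forall v, vconj v -> vconj (F v);
  vinvolK : forall v, vconj v -> veq (F (F v)) v;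
  vinvol_card : forall v, #|(F v).2| = #|v.2| }.

Section Involution.
Variable F : vtx n -> vtx n.
Hypothesis HF : vinvol F.

Lemma vinvol_veq_inv v w : vconj v -> vconj w -> veq (F v) (F w) -> veq v w.
Proof.
move=> Cv Cw e; have C := vinvol_conj HF.
have := vinvol_veq HF (C _ Cv) e => e'.
apply: (veq_trans Cv) (veq_trans (C _ (C _ Cv)) e' (vinvolK HF Cw)).
exact: veq_sym (C _ (C _ Cv)) (vinvolK HF Cv).
Qed.

Lemma vinvol_chain s : chain s -> chain (map F s).
Proof.
move=> Hs; have [s0 Hv Hlt] := Hs; split; rewrite ?size_map //.
  move=> i si; rewrite (nth_map (v0 n)) //; apply: (vinvol_valid HF); exact: Hv.
move=> i j ij sj; have si := ltn_trans ij sj.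
rewrite !(nth_map (v0 n)) //; have [h ne] := Hlt i j ij sj; split.
  by apply: (vinvol_vle HF) => //; exact: Hv.
by move=> e; apply: ne; apply: vinvol_veq_inv e; exact: chain_vconj.
Qed.

Definition mappt x := Pt (map F (psx x)) (pwt x).

Lemma vinvol_validpt x : validpt x -> validpt (mappt x).
Proof.
by case=> [Hs [H0 H1]]; split; first exact: vinvol_chain; rewrite /= size_map.
Qed.

Lemma cw_mappt x v : validpt x -> vconj v -> cw (mappt x) (F v) = cw x v.
Proof.
move=> [Hs _] Cv; rewrite !cwE /= size_map; apply: eq_rsum => i si.
rewrite (nth_map (v0 n)) //; apply: eq_indic; have Ci := chain_vconj Hs si.
by split => [/(vinvol_veq_inv Ci Cv)|/(vinvol_veq HF Ci)].
Qed.

Lemma cw_mappt_neq0 x v : validpt x -> cw (mappt x) v <> 0%R -> vconj v.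
Proof.
move=> Hx /(cw_neq0 (vinvol_validpt Hx))[i [si e _]].
exact: veq_vconj (chain_vconj (proj1 (vinvol_validpt Hx)) si) e.
Qed.

Lemma cw_mapptK x v : validpt x -> vconj v -> cw (mappt x) v = cw x (F v).
Proof.
move=> Hx Cv; have C := vinvol_conj HF.
rewrite -(cw_mappt Hx (C _ Cv)); symmetry; apply: cw_veq (vinvolK HF Cv).
  exact: vinvol_validpt.
exact: C (C _ Cv).
Qed.

Lemma mappt_samept x y : validpt x -> validpt y -> samept x y -> samept (mappt x) (mappt y).
Proof.
move=> Hx Hy e v; case: (classic (vconj v)) => Cv; first by rewrite !cw_mapptK // e.
have E z : validpt z -> cw (mappt z) v = 0%R by move=> Hz; apply: NNPP => /(cw_mappt_neq0 Hz).
by rewrite !E.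
Qed.

(* No inversions: distinct vertices of a simplex carry hypertrees of different
   sizes, and [F] preserves the size. *)
Lemma mappt_fixed x i : validpt x -> samept x (mappt x) ->
  i < size (psx x) -> (0 < pwt x i)%R ->
  veq (F (nth (v0 n) (psx x) i)) (nth (v0 n) (psx x) i).
Proof.
move=> Hx e si pi; have Hs := proj1 Hx; have Ci := chain_vconj Hs si.
have := cw_mappt Hx Ci; rewrite cw_nth // -e => h.
have [|k [sk ek _]] := @cw_neq0 x (F (nth (v0 n) (psx x) i)) Hx; first by rewrite h; lra.
have Ck := chain_vconj Hs sk.
have ck : #|(nth (v0 n) (psx x) k).2| = #|(nth (v0 n) (psx x) i).2|.
  by case: ek => -> _; exact: vinvol_card.
have ke : k = i.
  apply: (chain_inj2 Hs) => //.
  case: (chain_comparable Hs sk si) => -[h' _].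
    by apply: (htle_card_eq h'); rewrite ck.
  by symmetry; apply: (htle_card_eq h'); rewrite ck.
by rewrite ke in ek; exact: veq_sym Ci ek.
Qed.

End Involution.
End Points.

Local Open Scope R_scope.

(** * The length metric near a point *)

Lemma common_eps (T : eqType) (l : seq T) (Q : T -> R -> Prop) :
  (forall t eta eta', eta' <= eta -> Q t eta -> Q t eta') ->
  (forall t, t \in l -> exists2 eta, 0 < eta & Q t eta) ->
  exists2 eta, 0 < eta & forall t, t \in l -> Q t eta.
Proof.
move=> mono; elim: l => [|t l IH] H; first by exists 1 => //; lra.
have [e e0 Qe] := H t (mem_head _ _).
have [|e' e0' Qe'] := IH; first by move=> u ul; apply: H; rewrite inE ul orbT.
exists (Rmin e e'); first exact: Rmin_pos.
move=> u; rewrite inE => /orP[/eqP ->|ul].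
  exact: mono (Rmin_l _ _) Qe.
exact: mono (Rmin_r _ _) (Qe' u ul).
Qed.

(** A finite search space with two uses: index patterns of the chains in a star, and candidate walks
    in a hypergraph on four vertices. *)
Fixpoint bounded_seqs (K m : nat) : seq (seq nat) :=
  if m is m'.+1 then
    [::] :: [seq k :: l | k <- seq.iota 0 K, l <- bounded_seqs K m']
  else [:: [::]].

Lemma bounded_seqsP (K m : nat) (l : seq nat) :
  all (fun k => (k < K)%N) l -> (size l <= m)%N -> l \in bounded_seqs K m.
Proof.
elim: m l => [|m IH] [|k l] //= /andP[kK lK] sl.
rewrite inE; apply/orP; right; apply: allpairs_f; first by rewrite mem_iota.
exact: IH.
Qed.

(** Connectedness of [0, L]: the supremum of the times up to which A holds throughout can belong
    neither to A nor to B. *)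
Lemma interval_connected (A B : R -> Prop) (L : R) : 0 <= L ->
  (forall r, 0 <= r <= L -> A r \/ B r) ->
  (forall r, A r -> B r -> False) ->
  (forall r, 0 <= r <= L -> A r -> exists2 e, 0 < e &
     forall t, 0 <= t <= L -> Rabs (r - t) < e -> A t) ->
  (forall r, 0 <= r <= L -> B r -> exists2 e, 0 < e &
     forall t, 0 <= t <= L -> Rabs (r - t) < e -> B t) ->
  A 0 -> B L -> False.
Proof.
move=> L0 AB nAB oA oB A0 BL.
pose E r := 0 <= r <= L /\ forall t, 0 <= t <= r -> A t.
have E0 : E 0.
  split; first lra.
  by move=> t t0; have -> : t = 0 by lra.
have [m [ub lub]] : {m | is_lub E m}.
  by apply: completeness; [exists L => r [] ?; lra|exists 0].
have m0 : 0 <= m by exact: ub.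
have mL : m <= L by apply: lub => r [] ?; lra.
case: (AB m ltac:(lra)) => Hm; last first.
  have [e e0 He] := oB m ltac:(lra) Hm.
  have [r [Er rm]] : exists r, E r /\ m - e < r.
    apply: NNPP => K; have : m <= m - e; last lra.
    apply: lub => r Er; case: (Rle_lt_dec r (m - e)) => // h.
    by exfalso; apply: K; exists r.
  have rm' := ub r Er; case: (Er) => rL HA.
  apply: (nAB r); first by apply: HA; lra.
  apply: He; first lra.
  by rewrite Rabs_pos_eq; lra.
have [e e0 He] := oA m ltac:(lra) Hm.
have HA t : 0 <= t <= L -> t < m + e -> A t.
  move=> tL tm; case: (Rle_lt_dec m t) => mt.
    by apply: He => //; rewrite Rabs_left1; lra.
  have [r [[_ Er] rm]] : exists r, E r /\ t < r.
    apply: NNPP => K; have : m <= t; last lra.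
    apply: lub => r Er; case: (Rle_lt_dec r t) => // h.
    by exfalso; apply: K; exists r.
  by apply: Er; lra.
case: (Rle_lt_dec L (m + e / 2)) => h.
  by apply: (nAB L) => //; apply: HA; lra.
have : m + e / 2 <= m; last lra.
apply: ub; split; first lra.
by move=> t th; apply: HA; lra.
Qed.

Section Metric.
Variables (n : nat) (kap : model) (rz : realization n).
Hypothesis HP : PMetric kap rz.
Implicit Types (u v w : vtx n) (s : seq (vtx n)) (x y z : pt n).

Notation sd := (sdist kap rz).
Notation nthv := (nth (v0 n)).

Lemma rsum_points x y (f f' : nat -> R) : validpt x -> validpt y -> samept x y ->
  (forall i j, (i < size (psx x))%N -> (j < size (psx y))%N ->
     veq (nthv (psx x) i) (nthv (psx y) j) -> f i = f' j) ->
  (forall i, (i < size (psx x))%N -> pwt x i = 0 -> f i = 0) ->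
  (forall j, (j < size (psx y))%N -> pwt y j = 0 -> f' j = 0) ->
  rsum (size (psx x)) f = rsum (size (psx y)) f'.
Proof.
move=> Hx Hy e H1 H2 H3; have Hsx := proj1 Hx; have Hsy := proj1 Hy.
apply: (@rsum_match _ _ _ _ (fun i j => veq (nthv (psx x) i) (nthv (psx y) j))).
- exact: H1.
- move=> i j j' si sj sj' h h'; apply: (chain_inj Hsy) => //.
  have Ci := chain_vconj Hsx si.
  exact: veq_trans (veq_vconj Ci h) (veq_sym Ci h) h'.
- move=> i i' j si si' sj h h'; apply: (chain_inj Hsx) => //.
  have Ci' := chain_vconj Hsx si'.
  exact: veq_trans (chain_vconj Hsx si) h (veq_sym Ci' h').
- move=> i si fi; apply: (samept_inside Hx Hy e si).
  case: (Req_dec (pwt x i) 0) => [/(H2 i si)//|ne].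
  by have [_ [/(_ i si)]] := Hx; lra.
- move=> j sj fj.
  have [|i si h] := samept_inside Hy Hx (samept_sym e) sj.
    case: (Req_dec (pwt y j) 0) => [/(H3 j sj)//|ne].
    by have [_ [/(_ j sj)]] := Hy; lra.
  by exists i => //; exact: veq_sym (chain_vconj Hsy sj) h.
Qed.

Lemma samept_wt2 x y i j : validpt x -> validpt y -> samept x y ->
  (i < size (psx x))%N -> (j < size (psx y))%N ->
  veq (nthv (psx x) i) (nthv (psx y) j) -> pwt x i = pwt y j.
Proof.
by move=> Hx Hy e si sj h; rewrite -(cw_eq Hx si h) e cw_nth.
Qed.

Definition sgram s : nat -> nat -> R := vgram kap (rz s).1 (rz s).2.

Lemma bil_samept s s' a a' b b' :
  validpt (Pt s a) -> validpt (Pt s' a') -> samept (Pt s a) (Pt s' a') ->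
  validpt (Pt s b) -> validpt (Pt s' b') -> samept (Pt s b) (Pt s' b') ->
  bil (size s) (sgram s) a b = bil (size s') (sgram s') a' b'.
Proof.
move=> Ha Ha' ea Hb Hb' eb; rewrite /bil.
apply: (rsum_points Ha Ha' ea) => /=.
- move=> i i' si si' h; apply: (rsum_points Hb Hb' eb) => /=.
  + move=> j j' sj sj' h'.
    have -> : a i = a' i' := samept_wt2 Ha Ha' ea si si' h.
    have -> : b j = b' j' := samept_wt2 Hb Hb' eb sj sj' h'.
    by congr (_ * gram _ _); apply: (proj2 HP) => //; [case: Ha|case: Ha'].
  + by move=> j _ ->; lra.
  + by move=> j _ ->; lra.
- by move=> i _ ai; apply: rsum_const0 => j _; rewrite ai; lra.
- by move=> i _ ai; apply: rsum_const0 => j _; rewrite ai; lra.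
Qed.

Lemma validpt_weights s a : validpt (Pt s a) -> weights (size s) a.
Proof. by case. Qed.

Lemma sdistE s a b : validpt (Pt s a) -> validpt (Pt s b) ->
  sd s a b = gramdist kap (bil (size s) (sgram s) a b) (bil (size s) (sgram s) a a)
    (bil (size s) (sgram s) b b).
Proof.
move=> Ha Hb; apply: vdist_spoint; try exact: validpt_weights.
by apply: (proj1 HP); case: Ha.
Qed.

(** Simplex distance is a function of the two points alone: the Gram form sees only weights and
    vertex distances, the latter agree between chains by the face condition of [PMetric], and
    vertices of weight 0 drop out. *)
Lemma sdist_samept s s' a a' b b' :
  validpt (Pt s a) -> validpt (Pt s' a') -> samept (Pt s a) (Pt s' a') ->
  validpt (Pt s b) -> validpt (Pt s' b') -> samept (Pt s b) (Pt s' b') ->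
  sd s a b = sd s' a' b'.
Proof.
move=> Ha Ha' ea Hb Hb' eb; rewrite !sdistE //.
by rewrite (bil_samept Ha Ha' ea Hb Hb' eb) (bil_samept Ha Ha' ea Ha Ha' ea)
  (bil_samept Hb Hb' eb Hb Hb' eb).
Qed.

Lemma spoint_in s a : validpt (Pt s a) ->
  inspace kap (rz s).1 (spoint kap (size s) (rz s).1 (rz s).2 a).
Proof.
move=> Ha; apply: spoint_inspace; last exact: validpt_weights.
by apply: (proj1 HP); case: Ha.
Qed.

Lemma sdist_ge0 s a b : validpt (Pt s a) -> validpt (Pt s b) -> 0 <= sd s a b.
Proof. by move=> Ha Hb; apply: vdist_ge0; exact: spoint_in. Qed.

Lemma sdistC s a b : sd s a b = sd s b a.
Proof. exact: vdistC. Qed.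

Lemma sdist_triangle s a b c : validpt (Pt s a) -> validpt (Pt s b) -> validpt (Pt s c) ->
  sd s a c <= sd s a b + sd s b c.
Proof. by move=> Ha Hb Hc; apply: vdist_triangle; exact: spoint_in. Qed.

Lemma sdist_far_from_faces s a : validpt (Pt s a) ->
  exists2 eta, 0 < eta & forall b i, validpt (Pt s b) -> (i < size s)%N ->
    0 < a i -> b i = 0 -> eta <= sd s a b.
Proof.
move=> Ha.
have [||eta e0 H] := @common_eps _ (seq.iota 0 (size s))
  (fun i eta => forall b, validpt (Pt s b) -> 0 < a i -> b i = 0 -> eta <= sd s a b).
- by move=> i e e' ee H b Hb ai bi; have := H b Hb ai bi; lra.
- move=> i; rewrite mem_iota /= add0n => si.
  case: (Rlt_dec 0 (a i)) => ai; last by exists 1; [lra|move=> b _ /ai].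
  have [||eta e0 H] := @spoint_far_from_face kap (size s) (rz s).1 (rz s).2 a i _ _ si ai.
  + by apply: (proj1 HP); case: Ha.
  + exact: validpt_weights.
  + by exists eta => // b Hb _ bi; apply: H => //; exact: validpt_weights.
- exists eta => // b i Hb si ai bi; apply: (H i) => //.
  by rewrite mem_iota /= add0n.
Qed.

Lemma samept_veq_seq s s' b : chain s -> chain s' -> size s = size s' ->
  (forall k, (k < size s)%N -> veq (nthv s k) (nthv s' k)) ->
  samept (Pt s b) (Pt s' b).
Proof.
move=> Hs Hs' e H v; rewrite !cwE /= -e; apply: eq_rsum => k sk.
have Ck := chain_vconj Hs sk; apply: eq_indic.
by split => h; [exact: veq_trans (veq_vconj Ck (H k sk)) (veq_sym Ck (H k sk)) h|exact: veq_trans Ck (H k sk) h].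
Qed.

(** Up to [veq] such a chain is an injective list of indices into N. Finitely many patterns thus
    stand for the infinitely many chains of representatives in a star. *)
Lemma chain_pattern s (N : seq (vtx n)) : chain s ->
  (forall k, (k < size s)%N -> exists2 j, (j < size N)%N & veq (nthv s k) (nthv N j)) ->
  exists2 l, l \in bounded_seqs (size N) (size N) & size l = size s /\
    forall k, (k < size s)%N -> veq (nthv s k) (nthv N (nth 0%N l k)).
Proof.
move=> Hs H.
have [l [sl lN Hl]] : exists l, [/\ size l = size s, all (fun j => (j < size N)%N) l &
    forall k, (k < size s)%N -> veq (nthv s k) (nthv N (nth 0%N l k))].
  suff K m : (m <= size s)%N -> exists l, [/\ size l = m, all (fun j => (j < size N)%N) l &
    forall k, (k < m)%N -> veq (nthv s k) (nthv N (nth 0%N l k))] by exact: K.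
  elim: m => [|m IH] ms; first by exists [::].
  have [l [sl lN Hl]] := IH (ltnW ms); have [j jN hj] := H m ms.
  exists (rcons l j); split; first by rewrite size_rcons sl.
    by rewrite all_rcons jN.
  move=> k; rewrite ltnS leq_eqVlt nth_rcons sl => /orP[/eqP ->|km]; last by rewrite km; exact: Hl.
  by rewrite ltnn eqxx.
exists l => //; apply: bounded_seqsP => //.
have ul : uniq l.
  apply/(uniqP 0%N) => i j; rewrite !inE sl => si sj e.
  apply: (chain_inj Hs) => //; apply: (veq_trans (chain_vconj Hs si) (Hl i si)).
  by rewrite e; exact: veq_sym (chain_vconj Hs sj) (Hl j sj).
rewrite -(size_iota 0 (size N)); apply: uniq_leq_size => // j jl.
by rewrite mem_iota /= add0n; exact: (allP lN).
Qed.

(** A short step from x inside one simplex cannot reach the faces missing part of the support of x.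
    The bound is uniform since all simplices containing x have their vertices, up to [veq], in a
    finite list. *)
Lemma local_support x : validpt x -> exists2 eps, 0 < eps &
  forall s a b, validpt (Pt s a) -> samept x (Pt s a) -> validpt (Pt s b) ->
    sd s a b < eps -> forall i, (i < size s)%N -> 0 < a i -> 0 < b i.
Proof.
move=> Hx.
have [i0 si0 pi0] : exists2 i, (i < size (psx x))%N & 0 < pwt x i.
  by apply: rsum_pos_ex; case: Hx => _ [_ ->]; lra.
have Vw := chain_valid (proj1 Hx) si0.
have [N HN] := comparable_finite Vw.
pose matches s (l : seq nat) := size l = size s /\
    forall k, (k < size s)%N -> veq (nthv s k) (nthv N (nth 0%N l k)).
have [||eps e0 H] := @common_eps _ (bounded_seqs (size N) (size N))
  (fun l eta => forall s a b i, matches s l -> validpt (Pt s a) -> samept x (Pt s a) ->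
     validpt (Pt s b) -> (i < size s)%N -> 0 < a i -> b i = 0 -> eta <= sd s a b).
- move=> l e e' ee H s a b i m Ha xa Hb si ai bi.
  by have := H s a b i m Ha xa Hb si ai bi; lra.
- move=> l _.
  (* One chain per pattern suffices, as distances do not depend on representatives; a pattern not
     realized at x gets the dummy bound 1. *)
  case: (classic (exists s a, [/\ matches s l, validpt (Pt s a) & samept x (Pt s a)])); last first.
    by move=> K; exists 1; [lra|move=> s a b i m Ha xa; exfalso; apply: K; exists s, a].
  case=> s0 [a0 [[sl m0] Ha0 xa0]].
  have [eta e0 H] := sdist_far_from_faces Ha0.
  exists eta => // s a b i [sl' m] Ha xa Hb si ai bi.
  have Hs0 := proj1 Ha0; have Hs := proj1 Ha.
  have es : size s = size s0 by rewrite -sl.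
  have Hv c : samept (Pt s c) (Pt s0 c).
    apply: samept_veq_seq => // k sk; have Ck := chain_vconj Hs sk.
    have sk0 : (k < size s0)%N by rewrite -es.
    apply: (veq_trans Ck (m k sk)); exact: veq_sym (chain_vconj Hs0 sk0) (m0 k sk0).
  have V0 c : validpt (Pt s c) -> validpt (Pt s0 c) by case=> _ [h1 h2]; split => //=; rewrite -es.
  have e1 : samept (Pt s a) (Pt s0 a0) by apply: samept_trans (samept_sym xa) xa0.
  rewrite (sdist_samept Ha Ha0 e1 Hb (V0 b Hb) (Hv b)).
  apply: (H _ i) => //; [exact: V0|by rewrite -es|].
  rewrite -(samept_wt (V0 _ Ha) Ha0) ?es //; last by rewrite -es.
  exact: samept_trans (samept_sym (Hv a)) e1.
exists eps => // s a b Ha xa Hb lt i si ai.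
case: (Rle_lt_or_eq_dec 0 (b i)) => // [|bi]; first by case: Hb => _ [+ _]; exact.
have Hs := proj1 Ha.
have [j sj wj] : exists2 j, (j < size s)%N & veq (nthv (psx x) i0) (nthv s j).
  exact: (samept_inside Hx Ha xa si0 pi0).
have [k sk|l lN m] := @chain_pattern s N Hs.
  apply: HN; first exact: chain_valid Hs sk.
  have Ck := chain_vconj Hs sk; have Cj := chain_vconj Hs sj.
  have wj' := veq_sym (valid_vconj Vw) wj.
  case: (chain_comparable Hs sk sj) => h; [left|right].
    exact: vle_trans Ck h (veq_vle wj').
  exact: vle_trans (valid_vconj Vw) (veq_vle wj) h.
by have := H l lN s a b i m Ha xa Hb si ai (esym bi); lra.
Qed.

(* [reached x y r]: some string of length at most [r] leads from [x] to [y]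
   without leaving the open star of [x]. *)
Definition reached x y (r : R) : Prop :=
  [/\ validpt y, forall v, 0 < cw x v -> 0 < cw y v &
   forall s b, validpt (Pt s b) -> samept y (Pt s b) ->
     exists a, [/\ validpt (Pt s a), samept x (Pt s a) & sd s a b <= r]].

(** While the string is short, every simplex it enters still contains the support of x. The triangle
    inequality in that simplex replaces the string so far by one segment from x. *)
Lemma reached_strings x : validpt x -> exists2 eps, 0 < eps &
  forall str y r z, validpt z -> reached x y r -> strOK y z str ->
    r + strlen kap rz str < eps -> reached x z (r + strlen kap rz str).
Proof.
move=> Hx; have [eps e0 Heps] := local_support Hx; exists eps => //.
elim=> [|[[s a] b] str IH] y r z Hz [Hy sup rep] /=.
  move=> yz _; split => // [v|s b Hb zb]; first by rewrite -yz; exact: sup.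
  have [a [Ha xa le]] := rep s b Hb (samept_trans yz zb).
  by exists a; split => //; lra.
case=> Ha [Hb [ya ok]] lt.
have len0 : 0 <= strlen kap rz str.
  elim: (str) (Pt s b) ok => [|[[s' a'] b'] str' IH'] y' /=; first lra.
  by case=> h1 [h2 [_ /IH']]; have := sdist_ge0 h1 h2; lra.
have [a' [Ha' xa' le]] := rep s a Ha ya.
have tri := sdist_triangle Ha' Ha Hb.
rewrite -Rplus_assoc; apply: (IH (Pt s b)) => //; last by lra.
have pos i : (i < size s)%N -> 0 < a' i -> 0 < b i.
  by move=> si; apply: (Heps s a' b Ha' xa' Hb) => //; lra.
split => //.
  move=> v; rewrite xa' => h.
  have [|i [si ei ci]] := @cw_neq0 n (Pt s a') v Ha'; first lra.
  rewrite (@cw_eq n (Pt s b) v i Hb si ei); apply: pos => //.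
  by rewrite ci in h.
move=> s' b' Hb' bb'.
have ins : inside x s'.
  move=> i si pi; have [k sk ek] := samept_inside Hx Ha' xa' si pi.
  have pk : 0 < a' k.
    by have /= <- := samept_wt2 Hx Ha' xa' si sk ek.
  have [l sl el] := samept_inside Hb Hb' bb' sk (pos k sk pk).
  by exists l => //; exact: veq_trans (chain_vconj (proj1 Hx) si) ek el.
have [Hc xc] := inside_rep Hx (proj1 Hb') ins.
exists (fun k => cw x (nthv s' k)); split => //.
rewrite (sdist_samept Hc Ha' (samept_trans (samept_sym xc) xa') Hb' Hb (samept_sym bb')).
lra.
Qed.

(** * The length pseudometric and its agreement with simplex distances near a point *)

Notation d := (dlen kap rz).

Lemma strlen_ge0 x y str : strOK x y str -> 0 <= strlen kap rz str.
Proof.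
elim: str x => [|[[s a] b] str IH] x /=; first lra.
by case=> h1 [h2 [_ /IH]]; have := sdist_ge0 h1 h2; lra.
Qed.

Lemma dlen_le x y str : strOK x y str -> Rbar_le (d x y) (strlen kap rz str).
Proof.
by move=> H; apply: (proj1 (Glb_Rbar_correct _)); exists str.
Qed.

Lemma dlen_lt x y (r e : R) : d x y = Finite r -> r < e ->
  exists2 str, strOK x y str & strlen kap rz str < e.
Proof.
move=> dr re; apply: NNPP => K.
have : Rbar_le e (d x y).
  apply: (proj2 (Glb_Rbar_correct _)) => t [str [ok ->]] /=.
  by case: (Rle_lt_dec e (strlen kap rz str)) => // h; exfalso; apply: K; exists str.
rewrite dr /=; lra.
Qed.

Lemma dlen_ge0 x y (r : R) : d x y = Finite r -> 0 <= r.
Proof.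
move=> dr; case: (Rle_lt_dec 0 r) => // r0.
by have [str /strlen_ge0] := dlen_lt dr r0; lra.
Qed.

Lemma strOK_headl x x' y str : samept x x' -> strOK x' y str -> strOK x y str.
Proof.
move=> e; case: str => [|[[s a] b] str] /=; first exact: samept_trans.
by case=> h1 [h2 [h3 h4]]; split => //; split => //; split => //; exact: samept_trans e h3.
Qed.

Lemma strOK_cat x y z (s1 s2 : seq (seq (vtx n) * (nat -> R) * (nat -> R))) : strOK x y s1 -> strOK y z s2 -> strOK x z (s1 ++ s2).
Proof.
elim: s1 x => [|[[s a] b] s1 IH] x /=; first exact: strOK_headl.
by case=> h1 [h2 [h3 h4]] h; split => //; split => //; split => //; exact: IH.
Qed.

Lemma strlen_cat (s1 s2 : seq (seq (vtx n) * (nat -> R) * (nat -> R))) :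
  strlen kap rz (s1 ++ s2) = strlen kap rz s1 + strlen kap rz s2.
Proof. by elim: s1 => [|[[s a] b] s1 IH] /=; rewrite ?IH; lra. Qed.

Lemma strOK_rev x y str : strOK x y str ->
  exists2 str', strOK y x str' & strlen kap rz str' = strlen kap rz str.
Proof.
elim: str x => [|[[s a] b] str IH] x /=; first by exists [::] => //; exact: samept_sym.
case=> h1 [h2 [h3 /IH[str' ok e]]]; exists (str' ++ [:: (s, b, a)]).
  apply: strOK_cat ok _; split => //; split => //.
  by split; [exact: samept_refl|exact: samept_sym].
by rewrite strlen_cat e /= sdistC; lra.
Qed.

Lemma dlen_sym x y : d x y = d y x.
Proof.
apply: Glb_Rbar_eqset => r; split=> -[str [/strOK_rev[str' ok e] ->]]; by exists str'.
Qed.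

Lemma dlen_samept x x' y y' : samept x x' -> samept y y' -> d x y = d x' y'.
Proof.
move=> ex ey; rewrite (_ : d x y = d x' y); last first.
  apply: Glb_Rbar_eqset => r; split=> -[str [ok ->]]; exists str; split => //.
    exact: strOK_headl (samept_sym ex) ok.
  exact: strOK_headl ex ok.
rewrite dlen_sym [RHS]dlen_sym; apply: Glb_Rbar_eqset => r; split=> -[str [ok ->]]; exists str; split => //.
  exact: strOK_headl (samept_sym ey) ok.
exact: strOK_headl ey ok.
Qed.

Lemma dlen_triangle x y z (a b c : R) : d x y = Finite a -> d y z = Finite b ->
  d x z = Finite c -> c <= a + b.
Proof.
move=> da db dc; case: (Rle_lt_dec c (a + b)) => // h.
have [|s1 ok1 l1] := @dlen_lt x y a (a + (c - (a + b)) / 2) da; first lra.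
have [|s2 ok2 l2] := @dlen_lt y z b (b + (c - (a + b)) / 2) db; first lra.
have := dlen_le (strOK_cat ok1 ok2); rewrite dc strlen_cat /=; lra.
Qed.

Lemma dlen_simplex s a b r : validpt (Pt s a) -> validpt (Pt s b) ->
  d (Pt s a) (Pt s b) = Finite r -> r <= sd s a b.
Proof.
move=> Ha Hb dr.
have := @dlen_le (Pt s a) (Pt s b) [:: (s, a, b)]; rewrite dr /= Rplus_0_r.
by apply; split => //; split => //.
Qed.

(** Near x, strings straighten, so the length metric does not undercut the distance inside a common
    simplex; [dlen_simplex] is the reverse estimate. The support of x also persists nearby, that is,
    its open star is a neighbourhood. *)
Lemma local_metric x : validpt x -> exists2 eps, 0 < eps &
  forall y r, validpt y -> d x y = Finite r -> r < eps ->
    (forall v, 0 < cw x v -> 0 < cw y v) /\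
    (forall s a b, validpt (Pt s a) -> validpt (Pt s b) ->
       samept x (Pt s a) -> samept y (Pt s b) -> sd s a b <= r).
Proof.
move=> Hx; have [eps e0 H] := reached_strings Hx; exists eps => // y r Hy dr re.
have rx : reached x x 0.
  split => // s b Hb xb; exists b; split => //.
  by rewrite /sdist vdist_refl; [lra|exact: spoint_in].
have R str : strOK x y str -> strlen kap rz str < eps -> reached x y (strlen kap rz str).
  by move=> ok lt; rewrite -[strlen _ _ _]Rplus_0_l; apply: (H _ x) => //; rewrite Rplus_0_l.
split.
  have [str ok lt] := dlen_lt dr re; by have [] := R str ok lt.
move=> s a b Ha Hb xa yb; case: (Rle_lt_dec (sd s a b) r) => // h.
have [str ok lt] := dlen_lt dr (Rmin_glb_lt _ _ _ h re).
have l1 := Rmin_l (sd s a b) eps; have l2 := Rmin_r (sd s a b) eps.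
have [|_ _ /(_ s b Hb yb)[a' [Ha' xa']]] := R str ok; first lra.
rewrite -(sdist_samept Ha Ha' (samept_trans (samept_sym xa) xa') Hb Hb (@samept_refl n _)); lra.
Qed.

(** * Uniqueness of geodesics and separation by fixed links *)

Section CATspace.
Hypothesis HC : CAT kap d.

Definition dd x y : R := real (d x y).

Lemma dlen_dd x y : validpt x -> validpt y -> d x y = Finite (dd x y).
Proof. by move=> Hx Hy; have [L [c [e _]]] := proj1 (proj2 HC) x y Hx Hy; rewrite /dd e. Qed.

Lemma dd_sym x y : dd x y = dd y x.
Proof. by rewrite /dd dlen_sym. Qed.

Lemma dd_triangle x y z : validpt x -> validpt y -> validpt z -> dd x z <= dd x y + dd y z.
Proof. by move=> Hx Hy Hz; apply: (dlen_triangle (y := y)); exact: dlen_dd. Qed.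

Lemma dd_ge0 x y : validpt x -> validpt y -> 0 <= dd x y.
Proof. by move=> Hx Hy; exact: dlen_ge0 (dlen_dd Hx Hy). Qed.

Lemma dd_simplex s a b : validpt (Pt s a) -> validpt (Pt s b) -> dd (Pt s a) (Pt s b) <= sd s a b.
Proof. by move=> Ha Hb; apply: dlen_simplex => //; exact: dlen_dd. Qed.

Lemma dd_samept x x' y y' : samept x x' -> samept y y' -> dd x y = dd x' y'.
Proof. by move=> ex ey; rewrite /dd (dlen_samept ex ey). Qed.

Lemma cmpdist_same (L s : R) : 0 <= s <= L -> cmpdist kap L L 0 s s = 0.
Proof.
move=> sL; case: (kap) => /=.
  rewrite (_ : _ - _ = 0) ?sqrt_0 //.
  (* For L = 0 the comparison formula divides by zero, but then s = 0 and the quotient has numerator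
     0. *)
  case: (Req_dec L 0) => L0; last by field.
  have -> : s = 0 by lra.
  by rewrite /Rdiv; ring.
transitivity (acosh (cosh 0)); last by rewrite acosh_cosh //; lra.
congr acosh.
rewrite cosh_0; case: (Req_dec L 0) => L0.
  have -> : s = 0 by lra.
  by rewrite sinh_0 cosh_0 /Rdiv; ring.
have := sinh_gt0 (_ : 0 < L) => /(_ ltac:(lra)) sp.
have cL := cosh_sinh_sqr L; have cs := cosh_sinh_sqr s.
rewrite (_ : cosh L * cosh L - 1 = sinh L * sinh L); last lra.
field_simplify; [lra|lra].
Qed.

(** The two geodesics are taken as two sides of the degenerate triangle x, y, y, whose comparison
    points at equal times coincide. *)
Lemma geodesic_unique x y (L : R) c c' : validpt x -> validpt y -> d x y = Finite L ->
  geodesic d c L x y -> geodesic d c' L x y ->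
  forall r, 0 <= r <= L -> samept (c r) (c' r).
Proof.
move=> Hx Hy dL gc gc' r rL.
have dyy : d y y = Finite 0.
  have [HL H0] : 0 <= dd y y /\ dd y y <= 0.
    split; first exact: dd_ge0.
    by have := @dlen_le y y [::] (@samept_refl n y); rewrite dlen_dd.
  by rewrite dlen_dd //; congr Finite; lra.
have := proj2 (proj2 HC) x y y L L 0 c c' Hx Hy Hy dL dL dyy gc gc' r r rL rL.
rewrite cmpdist_same // => h.
have V := proj1 gc r rL; have V' := proj1 gc' r rL.
apply: (proj1 HC) => //; rewrite dlen_dd // in h *; congr Finite.
have := dd_ge0 V V'; move: h => /=; lra.
Qed.

Section Separation.
Variable F : vtx n -> vtx n.
Hypothesis HF : vinvol F.
Hypothesis iso : forall x y, validpt x -> validpt y -> d (mappt F x) (mappt F y) = d x y.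

(** The image of the geodesic under F is a geodesic with the same endpoints, hence equal to it. *)
Lemma fixed_geodesic x y (L : R) c : validpt x -> validpt y -> d x y = Finite L ->
  samept x (mappt F x) -> samept y (mappt F y) -> geodesic d c L x y ->
  forall r, 0 <= r <= L -> samept (c r) (mappt F (c r)).
Proof.
move=> Hx Hy dL fx fy gc; apply: (geodesic_unique Hx Hy dL gc).
have [V [e0 [eL D]]] := gc.
have L0 : 0 <= L by exact: dlen_ge0 dL.
split; first by move=> r rL; apply: vinvol_validpt => //; exact: V.
split.
  apply: samept_trans (samept_sym fx); apply: mappt_samept => //; apply: V; lra.
split.
  apply: samept_trans (samept_sym fy); apply: mappt_samept => //; apply: V; lra.
by move=> r r' rL rL'; rewrite iso; [exact: D|exact: V|exact: V].
Qed.

Definition vpt v : pt n := Pt [:: v] (fun=> 1).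

Lemma vpt_valid v : validV v -> validpt (vpt v).
Proof.
move=> Hv; split; last by split => [i _ /=|]; rewrite /= ?rsumS ?rsum0; lra.
split => //; first by case.
by case=> [|i] [|j].
Qed.

Lemma cw_vpt v w : cw (vpt v) w = indic (veq v w) 1.
Proof. by rewrite cwE /= rsumS rsum0 Rplus_0_l. Qed.

Lemma samept_vpt x v : validpt x -> validV v ->
  (forall i, (i < size (psx x))%N -> 0 < pwt x i -> veq (nthv (psx x) i) v) ->
  samept x (vpt v).
Proof.
move=> Hx Hv H.
have [||Hc e] := @inside_rep n x [:: v] Hx.
- by case: (vpt_valid Hv).
- by move=> i si pi; exists 0%N => //; exact: H.
apply: (samept_trans e) => w; rewrite cw_vpt cwE /= rsumS rsum0 Rplus_0_l.
congr indic; have := proj2 (proj2 Hc); by rewrite /= rsumS rsum0 Rplus_0_l.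
Qed.

(* If [P] separates the [F]-fixed vertices of the link of [v], then geodesics
   between fixed points on different sides pass through [v]. *)
Lemma separation v (P : vtx n -> Prop) : validV v ->
  (forall w w', validV w -> validV w' -> veq w w' -> P w -> P w') ->
  (forall w w', validV w -> validV w' -> veq (F w) w -> veq (F w') w' ->
     ~ veq w v -> ~ veq w' v -> comparable w v -> comparable w' v -> vle w w' ->
     (P w <-> P w')) ->
  exists2 eps, 0 < eps & forall x y, validpt x -> validpt y ->
    samept x (mappt F x) -> samept y (mappt F y) ->
    (forall i, (i < size (psx x))%N -> 0 < pwt x i ->
       veq (nthv (psx x) i) v \/ P (nthv (psx x) i)) ->
    (forall i, (i < size (psx y))%N -> 0 < pwt y i ->
       veq (nthv (psx y) i) v \/ ~ P (nthv (psx y) i)) ->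
    dd (vpt v) x < eps -> dd (vpt v) y < eps ->
    dd (vpt v) x + dd (vpt v) y <= dd x y.
Proof.
move=> Hv Pveq Pcomp; have HV := vpt_valid Hv; have Cv := valid_vconj Hv.
have [eps e0 loc] := local_metric HV.
(* The geodesic starts within eps/3 of v and is shorter than 2 eps/3, so all of it stays in the
   eps-ball of v, inside the open star of v. *)
exists (eps / 3); first lra.
move=> x y Hx Hy fx fy Px Py dx dy.
have tr := dd_triangle Hx HV Hy; rewrite (dd_sym x (vpt v)) in tr.
have xy0 := dd_ge0 Hx Hy.
have [L [c [dL gc]]] := proj1 (proj2 HC) x y Hx Hy.
have eL : L = dd x y by rewrite /dd dL.
have [V [c0 [cL D]]] := gc.
have V0 : validpt (c 0) by apply: V; lra.
have VL : validpt (c L) by apply: V; lra.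
have fixc := fixed_geodesic Hx Hy dL fx fy gc.
have near r : 0 <= r <= L -> 0 < cw (c r) v.
  move=> rL; have Vr := V r rL.
  have d0r : dd (c 0) (c r) = r by rewrite /dd D ?Rabs_left1 /=; lra.
  have := dd_triangle HV V0 Vr; rewrite d0r (dd_samept (@samept_refl n _) c0) => h.
  have [|sup _] := loc (c r) _ Vr (dlen_dd HV Vr); first lra.
  by apply: sup; rewrite cw_vpt indicT; [lra|exact: veq_refl].
have vert r i : 0 <= r <= L -> (i < size (psx (c r)))%N -> 0 < pwt (c r) i ->
    let w := nthv (psx (c r)) i in [/\ validV w, veq (F w) w & comparable w v].
  move=> rL si pi w; have Vr := V r rL; have Hs := proj1 Vr.
  split; [exact: chain_valid|exact: (mappt_fixed HF Vr (fixc r rL) si pi)|].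
  have [|k [sk ek _]] := cw_neq0 (v := v) Vr; first by have := near r rL; lra.
  have Cw := chain_vconj Hs si; have Ck := chain_vconj Hs sk.
  case: (chain_comparable Hs si sk) => h; [left|right].
    exact: vle_trans Cw h (veq_vle ek).
  exact: vle_trans Cv (veq_vle (veq_sym Ck ek)) h.
(* A and B record on which side of the fixed link the support of c(r) has vertices. If v is never
   met they cover [0, L]; they are disjoint because vertices of one simplex are comparable, and open
   because supports persist nearby. *)
pose A r := exists i, [/\ (i < size (psx (c r)))%N, 0 < pwt (c r) i,
  ~ veq (nthv (psx (c r)) i) v & P (nthv (psx (c r)) i)].
pose B r := exists i, [/\ (i < size (psx (c r)))%N, 0 < pwt (c r) i,
  ~ veq (nthv (psx (c r)) i) v & ~ P (nthv (psx (c r)) i)].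
case: (classic (exists2 r, 0 <= r <= L & samept (c r) (vpt v))) => [[r rL er]|K].
  rewrite -eL -(dd_samept er (samept_refl x)) -(dd_samept er (samept_refl y)).
  rewrite -(dd_samept (samept_refl (c r)) c0) -(dd_samept (samept_refl (c r)) cL).
  rewrite /dd !D /=; try lra.
  rewrite Rabs_pos_eq ?Rabs_left1; lra.
have AB r : 0 <= r <= L -> A r \/ B r.
  move=> rL; apply: NNPP => nAB; apply: K; exists r => //.
  apply: samept_vpt => //; first exact: V.
  move=> i si pi; apply: NNPP => ne; apply: nAB.
  case: (classic (P (nthv (psx (c r)) i))) => h; [left|right]; by exists i.
have sync r r' i i' : 0 <= r <= L -> 0 <= r' <= L ->
    (i < size (psx (c r)))%N -> 0 < pwt (c r) i ->
    (i' < size (psx (c r')))%N -> veq (nthv (psx (c r')) i') (nthv (psx (c r)) i) ->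
    (veq (nthv (psx (c r')) i') v -> veq (nthv (psx (c r)) i) v) /\
    (P (nthv (psx (c r')) i') <-> P (nthv (psx (c r)) i)).
  move=> rL rL' si pi si' e; have Vr := V r rL; have Vr' := V r' rL'.
  have Hw := chain_valid (proj1 Vr) si; have Hw' := chain_valid (proj1 Vr') si'.
  have e' := veq_sym (valid_vconj Hw') e.
  split; first by move=> h; exact: veq_trans (valid_vconj Hw) e' h.
  by split; apply: Pveq.
have nAB r : 0 <= r <= L -> A r -> B r -> False.
  move=> rL [i [si pi nv Pi]] [j [sj pj nv' nPj]]; apply: nPj.
  have [Hi fi ci] := vert r i rL si pi; have [Hj fj cj] := vert r j rL sj pj.
  case: (chain_comparable (proj1 (V r rL)) si sj) => h.
    exact: (proj1 (Pcomp _ _ Hi Hj fi fj nv nv' ci cj h)).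
  exact: (proj2 (Pcomp _ _ Hj Hi fj fi nv' nv cj ci h)).
have open (Q : vtx n -> Prop) : (forall w w', validV w -> validV w' -> veq w w' -> Q w -> Q w') ->
    forall r i, 0 <= r <= L -> (i < size (psx (c r)))%N -> 0 < pwt (c r) i ->
      ~ veq (nthv (psx (c r)) i) v -> Q (nthv (psx (c r)) i) ->
    exists2 e, 0 < e & forall t, 0 <= t <= L -> Rabs (r - t) < e ->
      exists i, [/\ (i < size (psx (c t)))%N, 0 < pwt (c t) i,
        ~ veq (nthv (psx (c t)) i) v & Q (nthv (psx (c t)) i)].
  move=> Qveq r i rL si pi nv Qi; have Vr := V r rL.
  have [e ep H] := local_metric Vr; exists e => // t tL rt; have Vt := V t tL.
  have [sup _] := H (c t) _ Vt (D r t rL tL) rt.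
  have := sup (nthv (psx (c r)) i); rewrite cw_nth // => /(_ pi) pt.
  have [|k [sk ek ck]] := cw_neq0 (v := nthv (psx (c r)) i) Vt; first lra.
  have Hk := chain_valid (proj1 Vt) sk; have Hi := chain_valid (proj1 Vr) si.
  exists k; split => //; first by rewrite -ck.
    move=> h; apply: nv; exact: veq_trans (valid_vconj Hi) (veq_sym (valid_vconj Hk) ek) h.
  exact: (Qveq _ _ Hi Hk (veq_sym (valid_vconj Hk) ek)).
have nPveq w w' : validV w -> validV w' -> veq w w' -> ~ P w -> ~ P w'.
  move=> Hw Hw' e nP Pw'; apply: nP; apply: (Pveq w' w) => //.
  exact: veq_sym (valid_vconj Hw) e.
have side z t (Q : vtx n -> Prop) (Q' : vtx n -> Prop) : 0 <= t <= L -> validpt z -> samept (c t) z ->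
   (forall w w', validV w -> validV w' -> veq w w' -> Q w -> Q w') ->
   (forall i, (i < size (psx z))%N -> 0 < pwt z i -> veq (nthv (psx z) i) v \/ Q (nthv (psx z) i)) ->
   forall i, (i < size (psx (c t)))%N -> 0 < pwt (c t) i -> ~ veq (nthv (psx (c t)) i) v ->
     Q (nthv (psx (c t)) i).
  move=> tL Hz ez Qveq HQ i si pi nv; have Vt := V t tL.
  have [k sk ek] := samept_inside Vt Hz ez si pi.
  have pk : 0 < pwt z k by rewrite -(samept_wt2 Vt Hz ez si sk ek).
  have Hi := chain_valid (proj1 Vt) si; have Hk := chain_valid (proj1 Hz) sk.
  have ek' := veq_sym (valid_vconj Hi) ek.
  case: (HQ k sk pk) => [h|h]; last exact: Qveq ek' h.
  by exfalso; apply: nv; exact: veq_trans (valid_vconj Hi) ek h.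
exfalso.
apply: (@interval_connected (fun r => 0 <= r <= L /\ A r) (fun r => 0 <= r <= L /\ B r) L).
- lra.
- by move=> r rL; case: (AB r rL); [left|right].
- by move=> r [rL Ar] [_ Br]; exact: nAB Ar Br.
- move=> r rL [_ [i [si pi nv Pi]]].
  have [e ep H] := open P Pveq r i rL si pi nv Pi.
  by exists e => // t tL rt; split => //; exact: H.
- move=> r rL [_ [i [si pi nv Pi]]].
  have [e ep H] := open (fun w => ~ P w) nPveq r i rL si pi nv Pi.
  by exists e => // t tL rt; split => //; exact: H.
- have L0 : 0 <= 0 <= L by lra.
  split => //; case: (AB 0 L0) => // -[i [si pi nv nP]]; exfalso; apply: nP.
  exact: (side x 0 P P L0 Hx c0 Pveq Px i si pi nv).
- have LL : 0 <= L <= L by lra.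
  split => //; case: (AB L LL) => // -[i [si pi nv HPi]]; exfalso.
  exact: (side y L (fun w => ~ P w) P LL Hy cL nPveq Py i si pi nv HPi).
Qed.

End Separation.
End CATspace.
End Metric.

(** * The action of Out(W_n) on vertices *)

Local Open Scope nat_scope.

Section Action.
Variable n : nat.
Implicit Types (i j : 'I_n) (D E : {set 'I_n}) (T L : {set {set 'I_n}}) (f g a b : endo n).
Implicit Types (sg : {perm 'I_n}) (u v w : vtx n).

Lemma red_map sg (w : word n) : red (map sg w) = map sg (red w).
Proof.
elim: w => [|i w IH] //=; rewrite IH; case: (red w) => [|j z] //=.
by rewrite (inj_eq perm_inj); case: (i == j).
Qed.

Lemma fm_conjp sg f (w : word n) : fm (conjp sg f) (map sg w) = map sg (fm f w).
Proof.
by elim: w => [|i w IH] //; rewrite /= !fm_cons IH map_cat /conjp permK.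
Qed.

Lemma aeq_conjp sg f g : aeq f g -> aeq (conjp sg f) (conjp sg g).
Proof. by move=> e i; rewrite /conjp !red_map e. Qed.

Lemma conjp_comp sg f g : aeq (conjp sg (comp f g)) (comp (conjp sg f) (conjp sg g)).
Proof. by move=> i; rewrite red_comp fm_conjp !red_map red_comp. Qed.

Lemma conjp_idA sg : aeq (conjp sg (@idA n)) (@idA n).
Proof. by move=> i; rewrite /conjp /= permKV. Qed.

Lemma conjp_inn sg c : aeq (conjp sg (inn c)) (inn (map sg c)).
Proof. by move=> i; rewrite /conjp /inn map_cat /= permKV map_rev. Qed.

Lemma conjp_pc sg i D : aeq (conjp sg (pc i D)) (pc (sg i) (sg @: D)).
Proof.
move=> j; rewrite /conjp /pc.
have -> : (j \in sg @: D) = ((sg^-1)%g j \in D).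
  by rewrite -{1}(permKV sg j) mem_imset //; exact: perm_inj.
by case: ifP => _ /=; rewrite permKV.
Qed.

Lemma conjugating_conjp sg f : conjugating f -> conjugating (conjp sg f).
Proof.
move=> Hf j; have [c Hc] := Hf ((sg^-1)%g j); exists (map sg c).
by rewrite /conjp red_map Hc -red_map map_cat /= permKV map_rev.
Qed.

Definition relabpc sg (p : 'I_n * {set 'I_n}) : 'I_n * {set 'I_n} := (sg p.1, sg @: p.2).

Lemma conjp_prodpc sg (ps : seq ('I_n * {set 'I_n})) :
  aeq (conjp sg (prodpc ps)) (prodpc (map (relabpc sg) ps)).
Proof.
elim: ps => [|p ps IH] /=; first exact: conjp_idA.
apply: aeq_trans (conjp_comp _ _ _) _; apply: aeq_trans (comp_aeql _ (conjp_pc _ _ _)) _.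
by apply: comp_aeqr IH; exact: conjugating_involutory (@conjugating_pc n _ _).
Qed.

Lemma mem_relab sg T E : (sg @: E \in relab sg T) = (E \in T).
Proof. by rewrite mem_imset //; exact: imset_inj perm_inj. Qed.

Lemma relabP sg T E : reflect (exists2 F, F \in T & E = sg @: F) (E \in relab sg T).
Proof. exact: imsetP. Qed.

Lemma relabM sg sg' T : relab sg (relab sg' T) = relab (sg' * sg)%g T.
Proof.
apply/setP => E; apply/relabP/relabP => [[F /relabP[G GT ->] ->]|[G GT ->]].
  by exists G => //; rewrite -imset_comp; apply: eq_imset => x; rewrite permM.
exists (sg' @: G); first by rewrite mem_relab.
by rewrite -imset_comp; apply: eq_imset => x; rewrite permM.
Qed.

Lemma relab1 T : relab 1%g T = T.
Proof.
have e E : (1%g : {perm 'I_n}) @: E = E.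
  by rewrite -[RHS]imset_id; apply: eq_imset => x; rewrite perm1.
apply/setP => E; apply/relabP/idP => [[F FT ->]|ET]; first by rewrite e.
by exists E.
Qed.

Lemma card_relab sg T : #|relab sg T| = #|T|.
Proof. by rewrite card_imset //; exact: imset_inj perm_inj. Qed.

Lemma carries_relab sg T i D : carries T i D -> carries (relab sg T) (sg i) (sg @: D).
Proof.
move=> /carriesP H; apply/carriesP => E d j /relabP[F FT ->] /imsetP[d' d'F ->] /imsetP[j' j'F ->].
rewrite !(inj_eq perm_inj) !mem_imset; try exact: perm_inj.
exact: (H F).
Qed.

Lemma carriedf_conjp sg T f : carriedf T f -> carriedf (relab sg T) (conjp sg f).
Proof.
case=> ps [H [c e]]; exists (map (relabpc sg) ps); split.
  move=> q /mapP[p /H[[p1 p2] cp] ->]; split => /=; last exact: carries_relab.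
  split; rewrite /= ?mem_imset //; last exact: perm_inj.
  by apply: contraNneq p1 => /eqP; rewrite imset_eq0.
exists (map sg c); apply: aeq_trans (aeq_conjp sg e) _.
apply: aeq_trans (conjp_comp _ _ _) _; apply: aeq_trans (comp_aeql _ (conjp_inn _ _)) _.
by apply: comp_aeqr (conjp_prodpc _ _); exact: inn_involutory.
Qed.

Lemma rel_conjp sg T a b : conjugating a -> rel T a b -> rel (relab sg T) (conjp sg a) (conjp sg b).
Proof.
move=> Ca /rel_carried[f Hf e].
apply: (carried_rel (conjugating_conjp sg Ca) (carriedf_conjp sg Hf)).
exact: aeq_trans (aeq_conjp sg e) (conjp_comp _ _ _).
Qed.

Lemma isAut0_idA : isAut0 (@idA n).
Proof.
split; first exact: conjugating_idA.
exists (@idA n); split; first exact: conjugating_involutory (@conjugating_idA n).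
by split; exact: comp_idl.
Qed.

Lemma isAut0_pc i D : i \notin D -> isAut0 (pc i D).
Proof.
move=> iD; split; first exact: conjugating_pc.
exists (pc i D); split; first exact: conjugating_involutory (@conjugating_pc n _ _).
by split; exact: pc_involution.
Qed.

Lemma isAut0_comp f g : isAut0 f -> isAut0 g -> isAut0 (comp f g).
Proof.
case=> Cf [f' [If' [ff' f'f]]] [Cg [g' [Ig' [gg' g'g]]]].
have If := conjugating_involutory Cf; have Ig := conjugating_involutory Cg.
split; first exact: conjugating_comp.
have inv2 a b a' b' : involutory a -> involutory b -> aeq (comp a a') (@idA n) ->
    aeq (comp b b') (@idA n) -> aeq (comp (comp a b) (comp b' a')) (@idA n).
  move=> Ia Ib e e'; apply: aeq_trans (aeq_sym (comp_assoc _ _ Ia)) _.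
  apply: aeq_trans e; apply: comp_aeqr => //.
  apply: aeq_trans (comp_assoc _ _ Ib) _.
  by apply: aeq_trans (comp_aeql _ e') _; exact: comp_idl.
exists (comp g' f'); split; last by split; exact: inv2.
move=> i; rewrite (@red_cat _ _ (fm g' (f' i)) _ (fm g' (f' i))) ?red_comp //.
by rewrite -fm_cat (@fm_congr _ _ _ [::]).
Qed.

Lemma isAut0_conjp sg f : isAut0 f -> isAut0 (conjp sg f).
Proof.
case=> Cf [g [Ig [fg gf]]]; split; first exact: conjugating_conjp.
exists (conjp sg g); split.
  by move=> i; rewrite /conjp -map_cat red_map Ig.
by split; apply: aeq_trans (aeq_sym (conjp_comp _ _ _)) _;
  apply: aeq_trans (aeq_conjp _ _) (conjp_idA sg).
Qed.

Lemma walk_relab sg T i j vs es : walk T i j vs es ->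
  walk (relab sg T) (sg i) (sg j) (map sg vs) (map (fun E : {set 'I_n} => sg @: E) es).
Proof.
case=> sz [us ue] inT Hn lst; split.
- by rewrite !size_map.
- split; first by rewrite -map_cons map_inj_uniq //; exact: perm_inj.
  by rewrite map_inj_uniq //; exact: imset_inj perm_inj.
- by move=> _ /mapP[F /inT FT ->]; rewrite mem_relab.
- rewrite size_map => k ks; have [h1 h2] := Hn k ks.
  have k2 : k.+1 < size (i :: vs) by rewrite /= sz.
  rewrite (nth_map set0) // -map_cons (nth_map i _ _ (ltnW k2)) (nth_map i _ _ k2).
  by rewrite !mem_imset //; exact: perm_inj.
- by rewrite last_map lst.
Qed.

Lemma hypertree_relab sg T : hypertree T -> hypertree (relab sg T).
Proof.
case=> H1 H2; split.
  by move=> _ /relabP[F FT ->]; rewrite card_imset ?H1 //; exact: perm_inj.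
move=> u v; have [vs [es [W U]]] := H2 ((sg^-1)%g u) ((sg^-1)%g v).
exists (map sg vs), (map (fun E : {set 'I_n} => sg @: E) es); split.
  by have := walk_relab sg W; rewrite !permKV.
move=> vs2 es2 /(walk_relab (sg^-1)%g).
rewrite relabM mulgV relab1 => /U[<- <-].
rewrite -!map_comp; split; symmetry; rewrite -[RHS]map_id; apply: eq_map => x /=.
  by rewrite permKV.
by rewrite -imset_comp -[RHS]imset_id; apply: eq_imset => y /=; rewrite permKV.
Qed.

Lemma foldb_relab sg L T : foldb L T -> foldb (relab sg L) (relab sg T).
Proof.
case/existsP=> E /existsP[F /and5P[EL FL EF EF0 /eqP ->]].
apply/existsP; exists (sg @: E); apply/existsP; exists (sg @: F).
have inj : injective (fun E : {set 'I_n} => sg @: E) by exact: imset_inj perm_inj.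
rewrite !mem_relab EL FL (inj_eq inj) EF -imsetI ?imset_eq0 ?EF0 /=; last by move=> x y _ _; exact: perm_inj.
apply/eqP/setP => X; apply/relabP/idP => [[Y + ->]|].
  rewrite !inE => /orP[/and3P[n1 n2 YL]|/eqP ->]; last by rewrite imsetU eqxx orbT.
  by rewrite !(inj_eq inj) n1 n2 mem_relab YL.
rewrite !inE => /orP[/and3P[n1 n2 /relabP[Y YL e]]|/eqP ->].
  exists Y => //; move: n1 n2; rewrite e !(inj_eq inj) => n1 n2.
  by rewrite !inE n1 n2 YL.
by exists (E :|: F); rewrite ?imsetU // !inE eqxx orbT.
Qed.

Lemma htle_relab sg T L : htle T L -> htle (relab sg T) (relab sg L).
Proof.
elim/htle_ind => [{}T|{}T L1 {}L f1 _]; first exact: htle_refl.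
by apply: connect_trans; apply: connect1; exact: foldb_relab.
Qed.

Section Element.
Variable g : endo n * {perm 'I_n}.
Hypothesis Hg : isAut0 g.1.

Lemma actv_valid v : validV v -> validV (actv g v).
Proof.
case=> H1 H2; split; last exact: hypertree_relab.
by apply: isAut0_comp => //; exact: isAut0_conjp.
Qed.

Lemma actv_conj v : vconj v -> vconj (actv g v).
Proof.
by move=> Cv; apply: conjugating_comp; [case: Hg|exact: conjugating_conjp].
Qed.

Lemma actv_rel T a b : conjugating a -> rel T a b ->
  rel (relab g.2 T) (comp g.1 (conjp g.2 a)) (comp g.1 (conjp g.2 b)).
Proof. by move=> Ca r; apply: rel_compl; [case: Hg|exact: rel_conjp]. Qed.

Lemma actv_veq v w : vconj v -> veq v w -> veq (actv g v) (actv g w).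
Proof. by move=> Cv [e r]; split; rewrite /= ?e //; rewrite -e; exact: actv_rel. Qed.

Lemma actv_vle v w : vconj v -> vle v w -> vle (actv g v) (actv g w).
Proof. by move=> Cv [h r]; split; [exact: htle_relab|exact: actv_rel]. Qed.

Lemma actv_vinvol : (forall v, vconj v -> veq (actv g (actv g v)) v) -> vinvol (actv g).
Proof.
move=> HK; split => //.
- exact: actv_valid.
- by move=> v w Hv Hw; apply: actv_vle; exact: valid_vconj.
- exact: actv_veq.
- exact: actv_conj.
- by move=> v; exact: card_relab.
Qed.

End Element.

Lemma conjp1 f : aeq (conjp 1%g f) f.
Proof.
move=> i; rewrite /conjp invg1 perm1 (_ : map _ _ = f i) // -[RHS]map_id.
by apply: eq_map => x; rewrite perm1.
Qed.

Definition actp sg : vtx n -> vtx n := actv (@idA n, sg).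

Definition actc i D : vtx n -> vtx n := actv (pc i D, 1%g).

Lemma actp_aeq sg v : aeq (actp sg v).1 (conjp sg v.1).
Proof. exact: comp_idl. Qed.

Lemma actc_aeq i D v : aeq (actc i D v).1 (comp (pc i D) v.1).
Proof. by apply: comp_aeqr (conjp1 _); exact: conjugating_involutory (@conjugating_pc n _ _). Qed.

Lemma aeq_veq v w : vconj v -> v.2 = w.2 -> aeq v.1 w.1 -> veq v w.
Proof. by move=> Cv e h; split => //; exact: aeq_rel. Qed.

Lemma vinvol_actp sg : (sg * sg)%g = 1%g -> vinvol (actp sg).
Proof.
move=> ss; have A := isAut0_idA; apply: actv_vinvol => // v Cv; apply: aeq_veq.
- by do 2 apply: actv_conj => //.
- by rewrite /= relabM ss relab1.
apply: aeq_trans (actp_aeq _ _) _; apply: aeq_trans (aeq_conjp sg (actp_aeq _ _)) _.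
move=> j; rewrite /conjp -map_comp (_ : map _ _ = v.1 j) //.
rewrite -[RHS]map_id -[j in RHS](perm1 j) -(_ : (sg^-1 * sg^-1)%g = 1%g) ?permM; last by rewrite -invMg ss invg1.
by apply: eq_map => x /=; rewrite -permM ss perm1.
Qed.

Lemma vinvol_actc i D : i \notin D -> vinvol (actc i D).
Proof.
move=> iD; have Cp := @conjugating_pc n i D; have Ip := conjugating_involutory Cp.
have A := isAut0_pc iD.
apply: actv_vinvol => // v Cv; apply: aeq_veq.
- by do 2 apply: actv_conj => //.
- by rewrite /= !relab1.
apply: aeq_trans (actc_aeq _ _ _) _; apply: aeq_trans (comp_aeqr Ip (actc_aeq _ _ _)) _.
apply: aeq_trans (comp_assoc _ _ Ip) _.
by apply: aeq_trans (comp_aeql _ (pc_involution iD)) _; exact: comp_idl.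
Qed.

Lemma actp_base sg T : veq (actp sg (@idA n, T)) (@idA n, relab sg T).
Proof.
apply: aeq_veq => //; last by apply: aeq_trans (actp_aeq _ _) _; exact: conjp_idA.
by apply: actv_conj; [exact: isAut0_idA|exact: conjugating_idA].
Qed.

Lemma actc_base i D T : i \notin D -> carries T i D -> veq (actc i D (@idA n, T)) (@idA n, T).
Proof.
move=> iD cD; apply: veq_sym; first exact: conjugating_idA.
split; first by rewrite /= relab1.
apply: rel_idA_carried; apply: carriedf_aeq (carriedf_pc iD cD).
apply: aeq_sym; apply: aeq_trans (actc_aeq _ _ _) _; exact: comp_idr.
Qed.

Lemma mappt_fixed_pt F (x : pt n) : vinvol F -> validpt x ->
  (forall i : nat, i < size (psx x) -> (0 < pwt x i)%R ->
     veq (F (nth (v0 n) (psx x) i)) (nth (v0 n) (psx x) i)) ->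
  samept x (mappt F x).
Proof.
move=> HF Hx H v; rewrite !cwE /= size_map; apply: eq_rsum => i si.
rewrite (nth_map (v0 n)) //; have [Hs [H0 _]] := Hx.
case: (Rle_lt_or_eq_dec 0 (pwt x i) (H0 i si)) => [pi|<-].
  have e := H i si pi; have Ci := chain_vconj Hs si; have Fi := vinvol_conj HF Ci.
  apply: eq_indic; split => h; first exact: veq_trans Fi e h.
  exact: veq_trans Ci (veq_sym Fi e) h.
by rewrite /indic; do 2 case: excluded_middle_informative.
Qed.

End Action.

Local Open Scope R_scope.

(** * Hypertrees on four vertices *)

Local Open Scope nat_scope.

(* Walks in a hypergraph given by an incidence matrix, edges being numbered. *)
Definition walkb (inc : nat -> nat -> bool) (u v : nat) (p : seq nat * seq nat) : bool :=
  [&& size p.1 == size p.2, uniq (u :: p.1), uniq p.2,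
      all (fun j => inc (nth 0 p.2 j) (nth 0 (u :: p.1) j) &&
                    inc (nth 0 p.2 j) (nth 0 (u :: p.1) j.+1)) (seq.iota 0 (size p.2)) &
      last u p.1 == v].

Definition unique_walks (inc : nat -> nat -> bool) (m : nat) : bool :=
  all (fun u => all (fun v =>
    size [seq p <- allpairs pair (bounded_seqs 4 3) (bounded_seqs m 3) | walkb inc u v p] == 1)
  (seq.iota 0 4)) (seq.iota 0 4).

Lemma bounded_seqs_all (K m : nat) (l : seq nat) :
  l \in bounded_seqs K m -> all (fun k => k < K) l.
Proof.
elim: m l => [|m IH] l /=; first by rewrite inE => /eqP ->.
rewrite inE => /orP[/eqP -> //|/allpairsP[[k l'] /= [kK /IH H ->]]] /=.
by rewrite mem_iota in kK; rewrite H andbT.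
Qed.

(** The vertices of a walk are distinct, so it has at most three steps. It is encoded by vertex
    numbers and positions in [Es], which turns existence and uniqueness into a count done by
    computation. *)
Lemma unique_walks_hypertree (inc : nat -> nat -> bool) (Es : seq {set 'I_4}) (T : {set {set 'I_4}}) :
  (forall E, E \in Es -> 1 < #|E|) -> T =i Es -> uniq Es ->
  (forall k (i : 'I_4), k < size Es -> (i \in nth set0 Es k) = inc k i) ->
  unique_walks inc (size Es) -> hypertree T.
Proof.
move=> H1 TE uE Hinc Huw; split => [E|u v]; first by rewrite TE; exact: H1.
have /allP /(_ (val u)) := Huw; rewrite mem_iota ltn_ord => /(_ isT).
move=> /allP /(_ (val v)); rewrite mem_iota ltn_ord => /(_ isT).
case def: [seq p <- _ | _] => [|p [|]] // _.
have pp : p \in [seq p <- allpairs pair (bounded_seqs 4 3) (bounded_seqs (size Es) 3) | walkb inc u v p].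
  by rewrite def mem_head.
have code vs es : walk T u v vs es ->
    (map val vs, map (index^~ Es) es) = p /\ (forall E, E \in es -> E \in Es).
  case=> sz [us ue] inT Hn lst.
  have inEs E : E \in es -> E \in Es by move=> /inT; rewrite TE.
  split => //.
  have idx_inj : {in es &, injective (index^~ Es)}.
    by move=> E F /inEs EE /inEs FE e; rewrite -(nth_index set0 EE) -(nth_index set0 FE) /= e.
  have szv : size vs <= 3.
    by have := max_card [in u :: vs]; rewrite (card_uniqP us) card_ord.
  suff : (map val vs, map (index^~ Es) es) \in [:: p] by rewrite mem_seq1 => /eqP.
  rewrite -def mem_filter; apply/andP; split; last first.
    apply: allpairs_f; apply: bounded_seqsP; rewrite ?size_map -?sz //.
      by apply/allP => _ /mapP[x _ ->]; exact: ltn_ord.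
    by apply/allP => _ /mapP[E /inEs EE ->]; rewrite index_mem.
  apply/and5P; split.
  - by rewrite /= !size_map sz.
  - by rewrite -[_ :: _]/(map val (u :: vs)) (map_inj_uniq val_inj).
  - by rewrite map_inj_in_uniq.
  - apply/allP => j; rewrite mem_iota add0n size_map /= => js.
    have [h1 h2] := Hn j js; have EE := inEs _ (mem_nth set0 js).
    have kv : j.+1 < size (u :: vs) by rewrite /= sz.
    rewrite (nth_map set0) // -[_ :: map _ _]/(map val (u :: vs)).
    rewrite (nth_map u _ _ (ltnW kv)) -[nth 0 (map _ vs) j]/(nth 0 (map val (u :: vs)) j.+1) (nth_map u _ _ kv).
    by rewrite -!Hinc ?index_mem // nth_index // h1 h2.
  - by rewrite /= last_map lst.
have : exists vs es, walk T u v vs es.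
  move: pp; rewrite mem_filter => /andP[W /allpairsP[[pv pe] [pvb peb ep]]].
  move/allP: (bounded_seqs_all pvb) => {}pvb; move/allP: (bounded_seqs_all peb) => {}peb.
  case/and5P: W; rewrite ep /= => /eqP sz us ue /allP Hn /eqP lst.
  pose vs : seq 'I_4 := map inord pv; pose es := map (nth set0 Es) pe.
  have ev : map val vs = pv.
    by rewrite -map_comp; apply: map_id_in => k kp /=; rewrite inordK //; exact: pvb.
  have ss : size vs = size es by rewrite !size_map.
  exists vs, es; split => //.
  - split.
      by rewrite -(map_inj_uniq val_inj) /= ev.
    rewrite map_inj_in_uniq // => k l kp lp /eqP.
    by rewrite nth_uniq ?peb // => /eqP.
  - by move=> _ /mapP[k /peb kp ->]; rewrite TE mem_nth.
  - move=> j js; have js' : j < size pe by rewrite size_map in js.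
    have := Hn j; rewrite mem_iota add0n /= => /(_ js').
    have kE : nth 0 pe j < size Es by apply: peb; exact: mem_nth.
    have vE k : k < size (u :: vs) -> nth 0 (val u :: pv) k = nth u (u :: vs) k :> nat.
      by move=> kv; rewrite -ev -[_ :: map _ _]/(map val (u :: vs)) (nth_map u).
    have kv : j.+1 < size (u :: vs) by rewrite /= ss.
    rewrite -[nth 0 pv j]/(nth 0 (val u :: pv) j.+1) !vE // 1?ltnW //.
    by rewrite -!Hinc // (nth_map 0) // => /andP[].
  - by apply: val_inj; rewrite -[RHS]lst -ev last_map.
case=> vs [es W]; exists vs, es; split => // vs2 es2 W2.
have [e1 inE1] := code _ _ W; have [e2 inE2] := code _ _ W2.
rewrite -e1 in e2; case: e2 => /(inj_map val_inj) -> e2; split => //.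
have idE (l : seq {set 'I_4}) : (forall E, E \in l -> E \in Es) ->
    [seq nth set0 Es k | k <- [seq index E Es | E <- l]] = l.
  by move=> H; rewrite -map_comp; apply: map_id_in => E /H EE /=; rewrite nth_index.
by rewrite -(idE es2) // e2 idE.
Qed.

Definition o0 : 'I_4 := @Ordinal 4 0 isT.
Definition o1 : 'I_4 := @Ordinal 4 1 isT.
Definition o2 : 'I_4 := @Ordinal 4 2 isT.
Definition o3 : 'I_4 := @Ordinal 4 3 isT.

Lemma ord4P (P : 'I_4 -> Prop) : P o0 -> P o1 -> P o2 -> P o3 -> forall i, P i.
Proof.
move=> h0 h1 h2 h3 i; have : val i \in [:: 0; 1; 2; 3] by case: i => [[|[|[|[|k]]]] lt].
by rewrite !inE => /or4P[] /eqP e; [have -> : i = o0|have -> : i = o1|have -> : i = o2|have -> : i = o3];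
  rewrite //; apply: val_inj.
Qed.

Definition e01 : {set 'I_4} := [set o0; o1].
Definition e12 : {set 'I_4} := [set o1; o2].
Definition e13 : {set 'I_4} := [set o1; o3].
Definition e23 : {set 'I_4} := [set o2; o3].
Definition e123 : {set 'I_4} := [set o1; o2; o3].

(** The trees of the two base triangles: [Pth] is the path 0-1-3-2 and [Str] the star with centre 1.
    Both fold onto [Mid] by merging the two edges other than {0,1}. *)
Definition Nuc : {set {set 'I_4}} := [set setT].
Definition Mid : {set {set 'I_4}} := [set e01; e123].
Definition Pth : {set {set 'I_4}} := [set e01; e13; e23].
Definition Str : {set {set 'I_4}} := [set e01; e12; e13].

Lemma set4P (A B : {set 'I_4}) :
  (o0 \in A) = (o0 \in B) -> (o1 \in A) = (o1 \in B) -> (o2 \in A) = (o2 \in B) ->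
  (o3 \in A) = (o3 \in B) -> A = B.
Proof. by move=> h0 h1 h2 h3; apply/setP; apply: ord4P. Qed.

Lemma set_neq (A B : {set 'I_4}) i : i \in A -> i \notin B -> A != B.
Proof. by move=> iA; apply: contraNneq => <-. Qed.

Lemma nth_inc (Es : seq {set 'I_4}) (inc : nat -> nat -> bool) m :
  (forall k, k < m -> [/\ (o0 \in nth set0 Es k) = inc k 0, (o1 \in nth set0 Es k) = inc k 1,
     (o2 \in nth set0 Es k) = inc k 2 & (o3 \in nth set0 Es k) = inc k 3]) ->
  forall k (i : 'I_4), k < m -> (i \in nth set0 Es k) = inc k i.
Proof. by move=> H k i km; have [h0 h1 h2 h3] := H k km; move: i; apply: ord4P. Qed.

Definition inc_of (l : seq (seq nat)) (k i : nat) : bool := i \in nth [::] l k.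

Lemma hypertree_Nuc : hypertree Nuc.
Proof.
apply: (@unique_walks_hypertree (inc_of [:: [:: 0; 1; 2; 3]]) [:: setT]) => //.
- by move=> E; rewrite inE => /eqP ->; rewrite cardsT card_ord.
- by move=> E; rewrite !inE.
- by apply: nth_inc => -[|k] // _; rewrite /= !inE.
Qed.

Lemma e01_e123 : e01 != e123. Proof. by apply: (@set_neq _ _ o0); rewrite !inE. Qed.
Lemma e01_e12 : e01 != e12. Proof. by apply: (@set_neq _ _ o0); rewrite !inE. Qed.
Lemma e01_e13 : e01 != e13. Proof. by apply: (@set_neq _ _ o0); rewrite !inE. Qed.
Lemma e01_e23 : e01 != e23. Proof. by apply: (@set_neq _ _ o0); rewrite !inE. Qed.
Lemma e12_e13 : e12 != e13. Proof. by apply: (@set_neq _ _ o2); rewrite !inE. Qed.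
Lemma e13_e23 : e13 != e23. Proof. by apply: (@set_neq _ _ o1); rewrite !inE. Qed.
Lemma e12_e23 : e12 != e23. Proof. by apply: (@set_neq _ _ o1); rewrite !inE. Qed.
Lemma card_e01 : #|e01| = 2. Proof. by rewrite cards2. Qed.
Lemma card_e12 : #|e12| = 2. Proof. by rewrite cards2. Qed.
Lemma card_e13 : #|e13| = 2. Proof. by rewrite cards2. Qed.
Lemma card_e23 : #|e23| = 2. Proof. by rewrite cards2. Qed.
Lemma card_e123 : #|e123| = 3.
Proof. by rewrite /e123 setUC cardsU1 !inE cards2. Qed.

Lemma hypertree_Mid : hypertree Mid.
Proof.
apply: (@unique_walks_hypertree (inc_of [:: [:: 0; 1]; [:: 1; 2; 3]]) [:: e01; e123]) => //.
- by move=> E; rewrite !inE => /orP[] /eqP ->; rewrite ?card_e01 ?card_e123.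
- by move=> E; rewrite !inE.
- by rewrite /= inE e01_e123.
- by apply: nth_inc => -[|[|k]] // _; rewrite /= !inE.
Qed.

Lemma hypertree_Pth : hypertree Pth.
Proof.
apply: (@unique_walks_hypertree (inc_of [:: [:: 0; 1]; [:: 1; 3]; [:: 2; 3]]) [:: e01; e13; e23]) => //.
- by move=> E; rewrite !inE => /or3P[] /eqP ->; rewrite ?card_e01 ?card_e13 ?card_e23.
- by move=> E; rewrite !inE orbA.
- by rewrite /= !inE negb_or e01_e13 e01_e23 e13_e23.
- by apply: nth_inc => -[|[|[|k]]] // _; rewrite /= !inE.
Qed.

Lemma hypertree_Str : hypertree Str.
Proof.
apply: (@unique_walks_hypertree (inc_of [:: [:: 0; 1]; [:: 1; 2]; [:: 1; 3]]) [:: e01; e12; e13]) => //.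
- by move=> E; rewrite !inE => /or3P[] /eqP ->; rewrite ?card_e01 ?card_e13 ?card_e12.
- by move=> E; rewrite !inE orbA.
- by rewrite /= !inE negb_or e01_e13 e01_e12 e12_e13.
- by apply: nth_inc => -[|[|[|k]]] // _; rewrite /= !inE.
Qed.

Lemma foldb_Mid_Nuc : foldb Mid Nuc.
Proof.
apply/existsP; exists e01; apply/existsP; exists e123.
apply/and5P; split; rewrite ?inE ?eqxx ?orbT ?e01_e123 //.
  by apply/set0Pn; exists o1; rewrite !inE.
apply/eqP/setP => E; rewrite !inE.
have -> : e01 :|: e123 = setT by apply: set4P; rewrite !inE.
by case: (E == e01); case: (E == e123).
Qed.

Lemma foldb_Pth_Mid : foldb Pth Mid.
Proof.
apply/existsP; exists e13; apply/existsP; exists e23.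
apply/and5P; split; rewrite ?inE ?eqxx ?orbT ?e13_e23 //.
  by apply/set0Pn; exists o3; rewrite !inE.
apply/eqP/setP => E; rewrite !inE.
have -> : e13 :|: e23 = e123 by apply: set4P; rewrite !inE.
case: (eqVneq E e01) => [->|_]; first by rewrite e01_e13 e01_e23.
by case: (E == e13); case: (E == e23).
Qed.

Lemma foldb_Str_Mid : foldb Str Mid.
Proof.
apply/existsP; exists e12; apply/existsP; exists e13.
apply/and5P; split; rewrite ?inE ?eqxx ?orbT ?e12_e13 //.
  by apply/set0Pn; exists o1; rewrite !inE.
apply/eqP/setP => E; rewrite !inE.
have -> : e12 :|: e13 = e123 by apply: set4P; rewrite !inE.
case: (eqVneq E e01) => [->|_]; first by rewrite e01_e13 e01_e12.
by case: (E == e12); case: (E == e13).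
Qed.

Lemma htle_Nuc_Mid : htle Nuc Mid. Proof. exact: connect1 foldb_Mid_Nuc. Qed.
Lemma htle_Mid_Pth : htle Mid Pth. Proof. exact: connect1 foldb_Pth_Mid. Qed.
Lemma htle_Mid_Str : htle Mid Str. Proof. exact: connect1 foldb_Str_Mid. Qed.

Lemma Nuc_Mid : Nuc <> Mid.
Proof. by move=> e; have := card_e01; have : e01 \in Nuc by [rewrite e !inE eqxx]; rewrite inE => /eqP ->; rewrite cardsT card_ord. Qed.

Lemma card_Mid : #|Mid| = 2. Proof. by rewrite cards2 e01_e123. Qed.
Lemma card_Pth : #|Pth| = 3.
Proof. by rewrite /Pth setUC cardsU1 cards2 !inE e01_e13 eq_sym (negbTE e01_e23) eq_sym (negbTE e13_e23). Qed.
Lemma card_Str : #|Str| = 3.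
Proof. by rewrite /Str setUC cardsU1 cards2 !inE e01_e12 eq_sym (negbTE e01_e13) eq_sym (negbTE e12_e13). Qed.

(** * The base chains *)

Definition base (T : {set {set 'I_4}}) : vtx 4 := (@idA 4, T).

Lemma base_valid T : hypertree T -> validV (base T).
Proof. by move=> HT; split => //; exact: isAut0_idA. Qed.

Lemma base_vle T L : htle T L -> vle (base T) (base L).
Proof. by move=> h; split => //; exact: rel_refl (@conjugating_idA 4). Qed.

Definition chain3 (L : {set {set 'I_4}}) : seq (vtx 4) := [:: base Nuc; base Mid; base L].

Lemma chain3_chain L : hypertree L -> htle Mid L -> Mid <> L -> chain (chain3 L).
Proof.
move=> HL ML nML.
have vl T T' : htle T T' -> T <> T' -> vlt (base T) (base T').
  by move=> h ne; split; [exact: base_vle|case].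
split => //.
  move=> [|[|[|i]]] // _; apply: base_valid => //.
    exact: hypertree_Nuc.
  exact: hypertree_Mid.
move=> [|[|[|i]]] [|[|[|j]]] // _ _ /=; apply: vl => //.
- exact: htle_Nuc_Mid.
- exact: Nuc_Mid.
- exact: htle_trans htle_Nuc_Mid ML.
- move=> e; rewrite -e in ML; apply: Nuc_Mid; exact: htle_anti htle_Nuc_Mid ML.
Qed.

Definition T1 := chain3 Pth.
Definition T2 := chain3 Str.

Lemma chain_T1 : chain T1.
Proof.
apply: chain3_chain hypertree_Pth htle_Mid_Pth _ => e.
by have := card_Pth; rewrite -e card_Mid.
Qed.

Lemma chain_T2 : chain T2.
Proof.
apply: chain3_chain hypertree_Str htle_Mid_Str _ => e.
by have := card_Str; rewrite -e card_Mid.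
Qed.

(** * Separating the fixed links *)

Lemma set4_eq (A B : {set 'I_4}) : B \subset A ->
  (o0 \in A -> o0 \in B) -> (o1 \in A -> o1 \in B) -> (o2 \in A -> o2 \in B) ->
  (o3 \in A -> o3 \in B) -> A = B.
Proof.
move=> /subsetP BA h0 h1 h2 h3; apply: set4P; apply/idP/idP; auto.
Qed.

(** Holds for an arbitrary marking by the parity invariant: x_{i,D} changes the relative parity of d
    and j exactly when one of them lies in D, while for d and j in a common hyperedge a fixed vertex
    allows no change. *)
Lemma actc_fixed_carries (n : nat) (i : 'I_n) (D : {set 'I_n}) (w : vtx n) :
  vconj w -> veq (actc i D w) w -> carries w.2 i D.
Proof.
move=> Cw [_ r]; apply/carriesP => E d j ET dE jE di ji dD.
have Cp := @conjugating_pc n i D.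
have C1 : conjugating (actc i D w).1.
  by apply: conjugating_aeq (aeq_sym (actc_aeq _ _ _)) _; exact: conjugating_comp.
rewrite /= relab1 in r.
have := rel_ev C1 r ET dE jE di ji; rewrite !(ev_aeq _ _ (actc_aeq i D w)).
rewrite !ev_comp // !ev_pc // eqxx dD /=.
by case: (j \in D); case: (ev i d w.1); case: (ev i j w.1).
Qed.

Lemma actp_fixed_relab (n : nat) (sg : {perm 'I_n}) (w : vtx n) :
  veq (actp sg w) w -> relab sg w.2 = w.2.
Proof. by case. Qed.

Lemma graph_maximal (n : nat) (T L : {set {set 'I_n}}) :
  (forall E, E \in T -> #|E| = 2) -> hypertree L -> htle T L -> T = L.
Proof.
move=> T2 [HL _] h; apply: htle_subset => //; apply/subsetP => E EL.
have [F FT EF] := htle_refine h EL; suff -> : E = F by [].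
by apply/eqP; rewrite eqEcard EF T2 // HL.
Qed.

(** Trees with all hyperedges of size 2 are maximal, so their links consist of lower vertices
    only. *)
Lemma below_graph (n : nat) (T : {set {set 'I_n}}) (w : vtx n) :
  (forall E, E \in T -> #|E| = 2) -> validV w -> ~ veq w (@idA n, T) ->
  comparable w (@idA n, T) -> htle w.2 T /\ w.2 <> T.
Proof.
move=> T2 Hw ne [h|h].
  by split; [case: h|move=> e; apply: ne; exact: vle_veq h e].
exfalso; apply: ne; have Cb := @conjugating_idA n.
have e : T = w.2 by apply: graph_maximal => //; [case: Hw|case: h].
apply: veq_sym => //; exact: vle_veq h e.
Qed.

Definition sw02 : {perm 'I_4} := tperm o0 o2.

Lemma sw02E : [/\ sw02 o0 = o2, sw02 o1 = o1, sw02 o2 = o0 & sw02 o3 = o3].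
Proof. by split; rewrite /sw02 ?tpermL ?tpermR // tpermD. Qed.

Lemma sw02K : (sw02 * sw02)%g = 1%g.
Proof. by apply/permP => x; rewrite permM perm1 /sw02 tpermK. Qed.

Lemma mem_sw02 (E : {set 'I_4}) : [/\ (o0 \in sw02 @: E) = (o2 \in E), (o1 \in sw02 @: E) = (o1 \in E),
  (o2 \in sw02 @: E) = (o0 \in E) & (o3 \in sw02 @: E) = (o3 \in E)].
Proof.
have [h0 h1 h2 h3] := sw02E; have inj : injective sw02 by exact: perm_inj.
by split; [rewrite -{1}h2|rewrite -{1}h1|rewrite -{1}h0|rewrite -{1}h3]; rewrite mem_imset.
Qed.

Lemma relab_sw02_mem (T : {set {set 'I_4}}) E : relab sw02 T = T -> E \in T -> sw02 @: E \in T.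
Proof. by move=> e ET; rewrite -e mem_relab. Qed.

Definition D02 : {set 'I_4} := [set o0; o2].

Lemma nuc_link_exclusive (T : {set {set 'I_4}}) : hypertree T ->
  carries T o1 D02 -> carries T o3 D02 -> False.
Proof.
move=> HT c1 c3.
have := hypertree_disjoint_carried HT c1 c3; rewrite !inE => /(_ isT isT isT isT isT).
by move/pred0P => /(_ o0); rewrite /= !inE.
Qed.

(** If both fail, invariance yields a hyperedge through 0 and 3 and one through 0 and 1. Together
    with their mirror images these give two different walks from 0 to 2, unless both are the full
    vertex set. *)
Lemma nuc_link_exhaustive (T : {set {set 'I_4}}) : hypertree T -> relab sw02 T = T ->
  T <> Nuc -> carries T o1 D02 \/ carries T o3 D02.
Proof.
move=> HT inv nN; apply: NNPP => K.
have ex (k l : 'I_4) : (k == o1) && (l == o3) || (k == o3) && (l == o1) -> ~ carries T k D02 ->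
    exists E, [/\ E \in T, l \in E & o0 \in E].
  move=> kl nc; apply: NNPP => K'; apply: nc; apply/carriesP => E d j ET dE jE dk jk dD.
  rewrite /D02 !inE; apply: NNPP => /negP; rewrite negb_or => /andP[j0 j2]; apply: K'.
  have jl : j = l.
    move: jk j0 j2; case/orP: kl => /andP[/eqP -> /eqP ->]; move: (j).
      by apply: ord4P.
    by apply: ord4P.
  have [h0 h1 h2 h3] := mem_sw02 E.
  move: dD; rewrite !inE => /orP[] /eqP ed; rewrite jl ed in jE dE.
    by exists E.
  exists (sw02 @: E); rewrite relab_sw02_mem // h0; split => //.
  by case/orP: kl => /andP[_ /eqP el]; rewrite el ?h3 ?h1 -?el.
have [E [ET E3 E0]] := ex o1 o3 isT (fun c => K (or_introl c)).
have [F [FT F1 F0]] := ex o3 o1 isT (fun c => K (or_intror c)).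
have [e0 e1 e2 e3] := mem_sw02 E; have [f0 f1 f2 f3] := mem_sw02 F.
have ET' := relab_sw02_mem inv ET; have FT' := relab_sw02_mem inv FT.
set E' := sw02 @: E in e0 e1 e2 e3 ET'; set F' := sw02 @: F in f0 f1 f2 f3 FT'.
rewrite E0 in e2; rewrite E3 in e3; rewrite F0 in f2; rewrite F1 in f1.
have meet := fun u v (uv : u != v) A B => @hypertree_meet _ T u v A B HT uv.
case: (eqVneq E E') => EE; case: (eqVneq F F') => FF.
- have E2 : o2 \in E by rewrite EE.
  have F2 : o2 \in F by rewrite FF.
  have eEF : E = F by apply: (meet o0 o2).
  have Efull : E = setT by apply: set4P; rewrite !inE ?E0 ?E2 ?E3 // eEF F1.
  apply: nN; apply/setP => G; rewrite inE; apply/idP/eqP => [GT|->]; last by rewrite -Efull.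
  rewrite -Efull; have [/(_ G GT)/card_gt1P[u [v [uG vG uv]]] _] := HT.
  by apply: (meet u v) => //; rewrite Efull inE.
- have E2 : o2 \in E by rewrite EE.
  have W := @walk2 _ T o0 o1 o2 F F' isT FF FT FT' F0 F1 f1 f2.
  by have [] := walk_uniq HT W (@walk1 _ T o0 o2 E isT ET E0 E2).
- have F2 : o2 \in F by rewrite FF.
  have W := @walk2 _ T o0 o3 o2 E E' isT EE ET ET' E0 E3 e3 e2.
  by have [] := walk_uniq HT W (@walk1 _ T o0 o2 F isT FT F0 F2).
- have W := @walk2 _ T o0 o3 o2 E E' isT EE ET ET' E0 E3 e3 e2.
  have W' := @walk2 _ T o0 o1 o2 F F' isT FF FT FT' F0 F1 f1 f2.
  by have [] := walk_uniq HT W W'.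
Qed.

(** Exactly one of x_{1,{0,2}} and x_{3,{0,2}} is carried by each fixed neighbour, and both
    conditions persist upwards, so comparable neighbours agree. *)
Lemma nuc_separated (w w' : vtx 4) : validV w -> validV w' ->
  veq (actp sw02 w) w -> veq (actp sw02 w') w' ->
  ~ veq w (base Nuc) -> ~ veq w' (base Nuc) ->
  comparable w (base Nuc) -> comparable w' (base Nuc) -> vle w w' ->
  (carries w.2 o1 D02 <-> carries w'.2 o1 D02).
Proof.
move=> Hw Hw' fw fw' nw nw' cw cw' [h _].
have nN (u : vtx 4) : validV u -> ~ veq u (base Nuc) -> comparable u (base Nuc) -> u.2 <> Nuc.
  move=> Hu nu [l|l] e; apply: nu; first exact: vle_veq l e.
  by apply: veq_sym; [exact: conjugating_idA|exact: vle_veq l (esym e)].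
split; first exact: carries_mono.
move=> c'; have [//|c3] := nuc_link_exhaustive (proj2 Hw) (actp_fixed_relab fw) (nN w Hw nw cw).
by case: (nuc_link_exclusive (proj2 Hw') c' (carries_mono h c3)).
Qed.

Definition D0 : {set 'I_4} := [set o0].

Lemma e01_below (T : {set {set 'I_4}}) E : carries T o1 D0 -> E \in T ->
  o0 \in E -> (o2 \notin E) /\ (o3 \notin E).
Proof.
move=> /carriesP c ET E0.
by split; apply/negP => h; have := c E o0 _ ET E0 h isT isT; rewrite !inE => /(_ isT).
Qed.

Lemma Mid_e01 : e01 \in Mid. Proof. by rewrite !inE eqxx. Qed.
Lemma Mid_e123 : e123 \in Mid. Proof. by rewrite !inE eqxx orbT. Qed.
Lemma Pth_e01 : e01 \in Pth. Proof. by rewrite !inE eqxx. Qed.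
Lemma Pth_e13 : e13 \in Pth. Proof. by rewrite !inE eqxx orbT. Qed.
Lemma Pth_e23 : e23 \in Pth. Proof. by rewrite !inE eqxx !orbT. Qed.
Lemma Str_e01 : e01 \in Str. Proof. by rewrite !inE eqxx. Qed.
Lemma Str_e12 : e12 \in Str. Proof. by rewrite !inE eqxx orbT. Qed.
Lemma Str_e13 : e13 \in Str. Proof. by rewrite !inE eqxx !orbT. Qed.

(** Below the middle vertex x_{1,{0}} is not carried, so fixed neighbours lie above it, where the
    trees are graphs and hence maximal. The fixed link is therefore discrete, and membership of
    {2,3} is constant on its components. *)
Lemma mid_fixed_above (w : vtx 4) : validV w -> veq (actc o1 D0 w) w ->
  ~ veq w (base Mid) -> comparable w (base Mid) ->
  htle Mid w.2 /\ forall E, E \in w.2 -> #|E| = 2.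
Proof.
move=> Hw fw nw cw; have Cw := valid_vconj Hw; have [H1 _] := proj2 Hw.
have car := actc_fixed_carries Cw fw.
have hM : htle Mid w.2.
  case: cw => [h|[]//]; exfalso; apply: nw; apply: (vle_veq h); case: h => h _.
  have [E ET /subsetP sE] := htle_refine h Mid_e01.
  have [F FT /subsetP sF] := htle_refine h Mid_e123.
  have [E2 E3] := e01_below car ET (sE o0 ltac:(by rewrite !inE)).
  have eE : E = e01.
    apply: set4_eq; [exact/subsetP| | | |]; rewrite !inE // => h'; [by rewrite h' in E2|by rewrite h' in E3].
  have eF : F = e123.
    apply: set4_eq; [exact/subsetP| | | |]; rewrite !inE // => h'.
    by have [/negP] := e01_below car FT h'; case; apply: sF; rewrite !inE.
  apply: (htle_subset h); apply/subsetP => G; rewrite !inE => /orP[] /eqP ->; [by rewrite -eE|by rewrite -eF].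
split => // E ET; have [F + sub] := htle_refine hM ET; have E1 := H1 E ET.
rewrite !inE => /orP[] /eqP eF; rewrite {}eF in sub.
  by apply/eqP; rewrite eqn_leq E1 andbT; have := subset_leq_card sub; rewrite card_e01.
suff : #|E| < #|e123| by rewrite card_e123 ltnS => E2; apply/eqP; rewrite eqn_leq E1 andbT.
apply: proper_card; rewrite properEneq sub andbT; apply/eqP => eE; apply: nw.
suff e : Mid = w.2.
  case: cw => h'; first exact: vle_veq h' (esym e).
  by apply: veq_sym; [exact: conjugating_idA|exact: vle_veq h' e].
apply: (htle_subset hM); apply/subsetP => G GT.
have [F' + sG] := htle_refine hM GT; have /card_gt1P[u [v [uG vG uv]]] := H1 G GT.
rewrite !inE => /orP[] /eqP eF; rewrite {}eF {F'} in sG.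
  by apply/orP; left; rewrite eqEcard sG card_e01 H1.
rewrite -eE in sG *; apply/orP; right; apply/eqP.
by apply: (hypertree_meet (proj2 Hw) uv GT ET) => //; apply: (subsetP sG).
Qed.

Lemma mid_separated (w w' : vtx 4) : validV w -> validV w' ->
  veq (actc o1 D0 w) w -> veq (actc o1 D0 w') w' ->
  ~ veq w (base Mid) -> ~ veq w' (base Mid) ->
  comparable w (base Mid) -> comparable w' (base Mid) -> vle w w' ->
  (e23 \in w.2 <-> e23 \in w'.2).
Proof.
move=> Hw Hw' fw fw' nw nw' cw cw' [h _].
have [_ g] := mid_fixed_above Hw fw nw cw.
by rewrite (graph_maximal g (proj2 Hw') h).
Qed.

Lemma Pth_graph E : E \in Pth -> #|E| = 2.
Proof. by rewrite !inE -orbA => /or3P[] /eqP ->; rewrite ?card_e01 ?card_e13 ?card_e23. Qed.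

Lemma Str_graph E : E \in Str -> #|E| = 2.
Proof. by rewrite !inE -orbA => /or3P[] /eqP ->; rewrite ?card_e01 ?card_e13 ?card_e12. Qed.

(** Relative parity of a and b at i. The hyperedge through a and b is what makes it independent of
    the representative and constant along the order, by [rel_ev]. *)
Definition parity_side (i a b : 'I_4) (w : vtx 4) : Prop :=
  (exists E, [/\ E \in w.2, a \in E & b \in E]) /\ ev i a w.1 = ev i b w.1.

Lemma parity_side_rel i a b (u w : vtx 4) E : vconj u -> rel w.2 u.1 w.1 ->
  E \in w.2 -> a \in E -> b \in E -> a != i -> b != i ->
  (ev i a u.1 = ev i b u.1 <-> ev i a w.1 = ev i b w.1).
Proof.
move=> Cu r ET aE bE ai bi; have := rel_ev Cu r ET aE bE ai bi.
by case: (ev i a u.1); case: (ev i b u.1); case: (ev i a w.1); case: (ev i b w.1).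
Qed.

Lemma parity_side_veq i a b (u w : vtx 4) : a != i -> b != i -> vconj u -> veq u w ->
  parity_side i a b u -> parity_side i a b w.
Proof.
move=> ai bi Cu [e r] [[E [ET aE bE]] h]; rewrite e in r ET; split; first by exists E.
exact/(parity_side_rel Cu r ET aE bE ai bi).
Qed.

Lemma parity_side_separated i a b (u w : vtx 4) : a != i -> b != i -> vconj u ->
  (exists E, [/\ E \in u.2, a \in E & b \in E]) ->
  (exists E, [/\ E \in w.2, a \in E & b \in E]) ->
  vle u w -> (parity_side i a b u <-> parity_side i a b w).
Proof.
move=> ai bi Cu exu [E [ET aE bE]] [_ r].
have H := parity_side_rel Cu r ET aE bE ai bi.
by split=> -[_ h]; split => //; [exists E|exact/H|exact/H].
Qed.

(** A coarsening of the path carrying x_{1,{0}} keeps 0 apart from 2 and 3. Were 1 and 2 also never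
    in one hyperedge, the three path edges would all survive and the tree would be the path
    itself. *)
Lemma path_fixed_edge (w : vtx 4) : validV w -> veq (actc o1 D0 w) w ->
  ~ veq w (base Pth) -> comparable w (base Pth) ->
  exists E, [/\ E \in w.2, o2 \in E & o1 \in E].
Proof.
move=> Hw fw nw cw; have car := actc_fixed_carries (valid_vconj Hw) fw.
have [h ne] := below_graph Pth_graph Hw nw cw.
apply: NNPP => K; apply: ne; apply: (htle_subset h).
have n12 E : E \in w.2 -> o1 \in E -> o2 \notin E.
  by move=> ET E1; apply/negP => E2; apply: K; exists E.
have [E1 ET1 /subsetP s1] := htle_refine h Pth_e01.
have [E2 ET2 /subsetP s2] := htle_refine h Pth_e13.
have [E3 ET3 /subsetP s3] := htle_refine h Pth_e23.
have i10 : o0 \in E1 by apply: s1; rewrite !inE.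
have i21 : o1 \in E2 by apply: s2; rewrite !inE.
have i23 : o3 \in E2 by apply: s2; rewrite !inE.
have i32 : o2 \in E3 by apply: s3; rewrite !inE.
have q1 : E1 = e01.
  have [h2 h3] := e01_below car ET1 i10.
  by apply: set4_eq; [exact/subsetP| | | |]; rewrite !inE // => h'; [rewrite h' in h2|rewrite h' in h3].
have q2 : E2 = e13.
  apply: set4_eq; [exact/subsetP| | | |]; rewrite !inE // => h'.
    by have [_ /negP] := e01_below car ET2 h'.
  by have /negP := n12 E2 ET2 i21.
have q3 : E3 = e23.
  apply: set4_eq; [exact/subsetP| | | |]; rewrite !inE // => h'.
    by have [/negP] := e01_below car ET3 h'.
  by have /negP := n12 E3 ET3 h'.
by apply/subsetP => G; rewrite !inE -orbA => /or3P[] /eqP ->; [rewrite -q1|rewrite -q2|rewrite -q3].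
Qed.

(** Suppose 0 and 2 never meet. The hyperedge through 1 and 3 equals its mirror image, so it
    contains neither of them; all three edges of the star then survive unchanged. *)
Lemma star_fixed_edge (w : vtx 4) : validV w -> veq (actp sw02 w) w ->
  ~ veq w (base Str) -> comparable w (base Str) ->
  exists E, [/\ E \in w.2, o0 \in E & o2 \in E].
Proof.
move=> Hw fw nw cw; have inv := actp_fixed_relab fw; have HT := proj2 Hw.
have [h ne] := below_graph Str_graph Hw nw cw.
apply: NNPP => K; apply: ne; apply: (htle_subset h).
have n02 E : E \in w.2 -> o0 \in E -> o2 \in E -> False.
  by move=> ET E0 E2; apply: K; exists E.
have [E1 ET1 /subsetP s1] := htle_refine h Str_e01.
have [E2 ET2 /subsetP s2] := htle_refine h Str_e12.
have [E3 ET3 /subsetP s3] := htle_refine h Str_e13.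
have i10 : o0 \in E1 by apply: s1; rewrite !inE.
have i11 : o1 \in E1 by apply: s1; rewrite !inE.
have i21 : o1 \in E2 by apply: s2; rewrite !inE.
have i22 : o2 \in E2 by apply: s2; rewrite !inE.
have i31 : o1 \in E3 by apply: s3; rewrite !inE.
have i33 : o3 \in E3 by apply: s3; rewrite !inE.
have n3 E : E \in w.2 -> o1 \in E -> o3 \in E -> (o0 \notin E) /\ (o2 \notin E).
  move=> ET E1' E3'; have [h0 h1 h2 h3] := mem_sw02 E.
  have e : sw02 @: E = E.
    by apply: (@hypertree_meet _ w.2 o1 o3) => //; [exact: relab_sw02_mem|rewrite h1|rewrite h3].
  rewrite e in h0; split; apply/negP => i; apply: (n02 E) => //; first by rewrite -h0.
  by rewrite h0.
have q1 : E1 = e01.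
  apply: set4_eq; [exact/subsetP| | | |]; rewrite !inE // => h'.
    by case: (n02 E1 ET1).
  by have [/negP] := n3 E1 ET1 i11 h'.
have q2 : E2 = e12.
  apply: set4_eq; [exact/subsetP| | | |]; rewrite !inE // => h'.
    by case: (n02 E2 ET2).
  by have [_ /negP] := n3 E2 ET2 i21 h'.
have q3 : E3 = e13.
  have [h0 h2] := n3 E3 ET3 i31 i33.
  by apply: set4_eq; [exact/subsetP| | | |]; rewrite !inE // => h'; [rewrite h' in h0|rewrite h' in h2].
by apply/subsetP => G; rewrite !inE -orbA => /or3P[] /eqP ->; [rewrite -q1|rewrite -q2|rewrite -q3].
Qed.

Local Open Scope R_scope.

(** * Symmetries of the base triangles *)

(** Symmetries that unfold the base triangles into fans: [sw0213] reverses the path and fixes the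
    side from the nuclear vertex to it, while [sw03] fixes the side from the nuclear vertex to the
    star. *)
Definition sw13 : {perm 'I_4} := tperm o1 o3.
Definition sw0213 : {perm 'I_4} := (sw02 * sw13)%g.
Definition sw03 : {perm 'I_4} := tperm o0 o3.

Lemma sw0213E : [/\ sw0213 o0 = o2, sw0213 o1 = o3, sw0213 o2 = o0 & sw0213 o3 = o1].
Proof.
have [h0 h1 h2 h3] := sw02E.
by split; rewrite permM ?h0 ?h1 ?h2 ?h3 /sw13 ?tpermL ?tpermR // tpermD.
Qed.

Lemma sw03E : [/\ sw03 o0 = o3, sw03 o1 = o1, sw03 o2 = o2 & sw03 o3 = o0].
Proof. by split; rewrite /sw03 ?tpermL ?tpermR // tpermD. Qed.

Lemma sw03K : (sw03 * sw03)%g = 1%g.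
Proof. by apply/permP => x; rewrite permM perm1 /sw03 tpermK. Qed.

Lemma sw0213K : (sw0213 * sw0213)%g = 1%g.
Proof.
have [h0 h1 h2 h3] := sw0213E.
by apply/permP; apply: ord4P; rewrite permM perm1 ?h0 ?h1 ?h2 ?h3.
Qed.

Lemma sw0213_sw02 : (sw0213 * sw02)%g = (sw02 * sw0213)%g.
Proof.
have [h0 h1 h2 h3] := sw0213E; have [k0 k1 k2 k3] := sw02E.
by apply/permP; apply: ord4P; rewrite [LHS]permM [RHS]permM ?k0 ?k1 ?k2 ?k3 ?h0 ?h1 ?h2 ?h3 ?k0 ?k1 ?k2 ?k3.
Qed.

Lemma imset_pair (sg : {perm 'I_4}) (a b : 'I_4) : sg @: [set a; b] = [set sg a; sg b].
Proof. by rewrite imsetU !imset_set1. Qed.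

Lemma imset_perm_T (sg : {perm 'I_4}) : sg @: [set: 'I_4] = [set: 'I_4].
Proof. by apply/eqP; rewrite eqEcard subsetT card_imset ?leqnn //; exact: perm_inj. Qed.

Lemma relab_Nuc sg : relab sg Nuc = Nuc.
Proof. by rewrite /relab imset_set1 imset_perm_T. Qed.

Lemma relab3 (sg : {perm 'I_4}) (A B C : {set 'I_4}) :
  relab sg [set A; B; C] = [set sg @: A; sg @: B; sg @: C].
Proof. by rewrite /relab !imsetU !imset_set1. Qed.

Lemma relab_sw02_Str : relab sw02 Str = Str.
Proof.
have [h0 h1 h2 h3] := sw02E; rewrite relab3 !imset_pair h0 h1 h2 h3.
rewrite (setUC [set o2]) (setUC [set o1] [set o0]) -/e12 -/e01 -/e13.
by apply/setP => E; rewrite !inE; case: (E == e12); case: (E == e01).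
Qed.

Lemma relab_sw0213_Pth : relab sw0213 Pth = Pth.
Proof.
have [h0 h1 h2 h3] := sw0213E; rewrite relab3 !imset_pair h0 h1 h2 h3.
rewrite (setUC [set o3]) -/e23 -/e01 -/e13.
by apply/setP => E; rewrite !inE; case: (E == e23); case: (E == e01); case: (E == e13).
Qed.

Lemma relab_sw03_Str : relab sw03 Str = Str.
Proof.
have [h0 h1 h2 h3] := sw03E; rewrite relab3 !imset_pair h0 h1 h2 h3.
rewrite (setUC [set o3]) (setUC [set o1] [set o0]) -/e12 -/e01 -/e13.
by apply/setP => E; rewrite !inE; case: (E == e12); case: (E == e01); case: (E == e13).
Qed.

Lemma carries_leaf (E0 : {set {set 'I_4}}) (i : 'I_4) (D : {set 'I_4}) :
  (forall E, E \in E0 -> forall d j, d \in E -> j \in E -> d != i -> j != i -> d \in D -> j \in D) ->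
  carries E0 i D.
Proof. by move=> H; apply/carriesP => E d j /H; apply. Qed.

Ltac carries_tac := apply: carries_leaf => ?; rewrite !inE -?orbA;
  repeat (case/orP); move/eqP=> ->; apply: ord4P; apply: ord4P; rewrite !inE.

Lemma carries_Mid : carries Mid o1 D0. Proof. by carries_tac. Qed.
Lemma carries_Pth : carries Pth o1 D0. Proof. by carries_tac. Qed.
Lemma carries_Str : carries Str o1 D0. Proof. by carries_tac. Qed.
Lemma carries_Str02 : carries Str o1 D02. Proof. by carries_tac. Qed.

Definition D2 : {set 'I_4} := [set o2].

Lemma carries_Pth2 : carries Pth o3 D2. Proof. by carries_tac. Qed.

Definition e012 : {set 'I_4} := [set o0; o1; o2].
Definition e013 : {set 'I_4} := [set o0; o1; o3].

Lemma mem_perm_imset (sg : {perm 'I_4}) k i (E : {set 'I_4}) : sg k = i -> (i \in sg @: E) = (k \in E).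
Proof. by move=> <-; rewrite mem_imset //; exact: perm_inj. Qed.

Lemma relab2 (sg : {perm 'I_4}) (A B : {set 'I_4}) : relab sg [set A; B] = [set sg @: A; sg @: B].
Proof. by rewrite /relab imsetU !imset_set1. Qed.

Lemma relab_sw0213_Mid : relab sw0213 Mid = [set e23; e013].
Proof.
have [h0 h1 h2 h3] := sw0213E; have m := mem_perm_imset.
rewrite relab2; congr [set _; _]; apply: set4P;
  by rewrite ?(m _ _ _ _ h0) ?(m _ _ _ _ h1) ?(m _ _ _ _ h2) ?(m _ _ _ _ h3) !inE.
Qed.

Lemma relab_sw03_Mid : relab sw03 Mid = [set e13; e012].
Proof.
have [h0 h1 h2 h3] := sw03E; have m := mem_perm_imset.
rewrite relab2; congr [set _; _]; apply: set4P;
  by rewrite ?(m _ _ _ _ h0) ?(m _ _ _ _ h1) ?(m _ _ _ _ h2) ?(m _ _ _ _ h3) !inE.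
Qed.

Lemma relab_sw02_sw03_Mid : relab sw02 (relab sw03 Mid) = relab sw03 Mid.
Proof.
have [h0 h1 h2 h3] := sw02E; have m := mem_perm_imset.
rewrite relab_sw03_Mid relab2; congr [set _; _]; apply: set4P;
  by rewrite ?(m _ _ _ _ h0) ?(m _ _ _ _ h1) ?(m _ _ _ _ h2) ?(m _ _ _ _ h3) !inE.
Qed.

Lemma carries_sw0213_Mid : carries (relab sw0213 Mid) o3 D2.
Proof. by rewrite relab_sw0213_Mid; carries_tac. Qed.

Lemma carries_sw03_Mid : carries (relab sw03 Mid) o1 D02.
Proof. by rewrite relab_sw03_Mid; carries_tac. Qed.

Definition swap02 : vtx 4 -> vtx 4 := actp sw02.
Definition swap0213 : vtx 4 -> vtx 4 := actp sw0213.
Definition swap03 : vtx 4 -> vtx 4 := actp sw03.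
Definition conj10 : vtx 4 -> vtx 4 := actc o1 D0.
Definition conj32 : vtx 4 -> vtx 4 := actc o3 D2.

Lemma vinvol_swap02 : vinvol swap02. Proof. exact: vinvol_actp sw02K. Qed.
Lemma vinvol_swap0213 : vinvol swap0213. Proof. exact: vinvol_actp sw0213K. Qed.
Lemma vinvol_swap03 : vinvol swap03. Proof. exact: vinvol_actp sw03K. Qed.
Lemma vinvol_conj10 : vinvol conj10. Proof. by apply: vinvol_actc; rewrite !inE. Qed.
Lemma vinvol_conj32 : vinvol conj32. Proof. by apply: vinvol_actc; rewrite !inE. Qed.

Lemma base_conj T : vconj (base T). Proof. exact: conjugating_idA. Qed.

Lemma actp_base_fixed sg T : relab sg T = T -> veq (actp sg (base T)) (base T).
Proof. by move=> e; rewrite -{2}e; exact: actp_base. Qed.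

Lemma swap02_Nuc : veq (swap02 (base Nuc)) (base Nuc). Proof. exact: actp_base_fixed (relab_Nuc _). Qed.
Lemma swap02_Str : veq (swap02 (base Str)) (base Str). Proof. exact: actp_base_fixed relab_sw02_Str. Qed.
Lemma swap0213_Nuc : veq (swap0213 (base Nuc)) (base Nuc). Proof. exact: actp_base_fixed (relab_Nuc _). Qed.
Lemma swap0213_Pth : veq (swap0213 (base Pth)) (base Pth). Proof. exact: actp_base_fixed relab_sw0213_Pth. Qed.
Lemma swap03_Nuc : veq (swap03 (base Nuc)) (base Nuc). Proof. exact: actp_base_fixed (relab_Nuc _). Qed.
Lemma swap03_Str : veq (swap03 (base Str)) (base Str). Proof. exact: actp_base_fixed relab_sw03_Str. Qed.
Lemma conj10_Mid : veq (conj10 (base Mid)) (base Mid).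
Proof. by apply: actc_base carries_Mid; rewrite !inE. Qed.
Lemma conj10_Pth : veq (conj10 (base Pth)) (base Pth).
Proof. by apply: actc_base carries_Pth; rewrite !inE. Qed.
Lemma conj10_Str : veq (conj10 (base Str)) (base Str).
Proof. by apply: actc_base carries_Str; rewrite !inE. Qed.
Lemma conj32_Pth : veq (conj32 (base Pth)) (base Pth).
Proof. by apply: actc_base carries_Pth2; rewrite !inE. Qed.

Lemma fixed_transport F (u w : vtx 4) : vinvol F -> vconj w -> veq w u -> veq (F u) u -> veq (F w) w.
Proof.
move=> HF Cw e fu; have Fw := vinvol_conj HF Cw.
apply: (veq_trans Fw (vinvol_veq HF Cw e)).
exact: (veq_trans (vinvol_conj HF (veq_vconj Cw e)) fu (veq_sym Cw e)).
Qed.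

Lemma swap02_swap0213_Nuc : veq (swap02 (swap0213 (base Nuc))) (swap0213 (base Nuc)).
Proof.
apply: fixed_transport vinvol_swap02 _ swap0213_Nuc swap02_Nuc.
by apply: (vinvol_conj vinvol_swap0213); exact: base_conj.
Qed.

Lemma swap02_swap0213_Str : veq (swap02 (swap0213 (base Str))) (swap0213 (base Str)).
Proof.
apply: (fixed_transport vinvol_swap02 _ (actp_base _ _)).
  by apply: (vinvol_conj vinvol_swap0213); exact: base_conj.
by apply: actp_base_fixed; rewrite relabM sw0213_sw02 -relabM relab_sw02_Str.
Qed.

Lemma conj32_swap0213_Pth : veq (conj32 (swap0213 (base Pth))) (swap0213 (base Pth)).
Proof.
apply: fixed_transport vinvol_conj32 _ swap0213_Pth conj32_Pth.
by apply: (vinvol_conj vinvol_swap0213); exact: base_conj.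
Qed.

Lemma conj32_swap0213_Mid : veq (conj32 (swap0213 (base Mid))) (swap0213 (base Mid)).
Proof.
apply: (fixed_transport vinvol_conj32 _ (actp_base _ _)).
  by apply: (vinvol_conj vinvol_swap0213); exact: base_conj.
by apply: actc_base carries_sw0213_Mid; rewrite !inE.
Qed.

Lemma conj10_conj32_Pth : veq (conj10 (conj32 (base Pth))) (conj32 (base Pth)).
Proof.
apply: fixed_transport vinvol_conj10 _ conj32_Pth conj10_Pth.
by apply: (vinvol_conj vinvol_conj32); exact: base_conj.
Qed.

(** The automorphisms x_{1,{0}} and x_{3,{2}} commute, so the first can be moved to the right, where
    [Mid] carries it. *)
Lemma conj10_conj32_Mid : veq (conj10 (conj32 (base Mid))) (conj32 (base Mid)).
Proof.
have CX := @conjugating_pc 4 o1 D0; have CY := @conjugating_pc 4 o3 D2.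
have Cy : vconj (conj32 (base Mid)) by by apply: (vinvol_conj vinvol_conj32); exact: base_conj.
have IX := conjugating_involutory CX.
apply: veq_sym => //; split; first by rewrite /= !relab1.
have eY : aeq (conj32 (base Mid)).1 (pc o3 D2).
  apply: aeq_trans (actc_aeq o3 D2 (base Mid)) _; exact: comp_idr.
have cX : carriedf (conj32 (base Mid)).2 (pc o1 D0).
  by rewrite /= relab1; apply: carriedf_pc carries_Mid; rewrite !inE.
apply: (carried_rel Cy cX).
apply: aeq_trans (actc_aeq o1 D0 (conj32 (base Mid))) _.
apply: aeq_trans (comp_aeqr IX eY) _.
apply: aeq_trans (pc_comm _ _ _ _) _; rewrite ?inE //.
  by apply/pred0P; apply: ord4P; rewrite /= !inE.
exact: comp_aeql (aeq_sym eY).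
Qed.

Lemma conj10_swap03_Str : veq (conj10 (swap03 (base Str))) (base Str).
Proof.
have C := vinvol_conj vinvol_conj10 (vinvol_conj vinvol_swap03 (base_conj Str)).
apply: (veq_trans C _ conj10_Str); apply: (vinvol_veq vinvol_conj10 _ swap03_Str).
by apply: (vinvol_conj vinvol_swap03); exact: base_conj.
Qed.

Lemma conj10_swap03_Mid_aeq : aeq (conj10 (swap03 (base Mid))).1 (pc o1 D0).
Proof.
have IX := conjugating_involutory (@conjugating_pc 4 o1 D0).
apply: aeq_trans (actc_aeq o1 D0 (swap03 (base Mid))) _; apply: aeq_trans (comp_aeqr IX _) (comp_idr _).
apply: aeq_trans (actp_aeq sw03 (base Mid)) _; exact: conjp_idA.
Qed.

Lemma conj10_swap03_Mid_tree : (conj10 (swap03 (base Mid))).2 = relab sw03 Mid.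
Proof. by rewrite /= relab1. Qed.

Lemma swap02_conj10_swap03_Str : veq (swap02 (conj10 (swap03 (base Str)))) (conj10 (swap03 (base Str))).
Proof.
apply: fixed_transport vinvol_swap02 _ conj10_swap03_Str swap02_Str.
by apply: (vinvol_conj vinvol_conj10); apply: (vinvol_conj vinvol_swap03); exact: base_conj.
Qed.

(** The swap sends the marking x_{1,{0}} to x_{1,{2}}. The two differ by x_{1,{0,2}}, which the tree
    {{1,3},{0,1,2}} carries. *)
Lemma swap02_conj10_swap03_Mid : veq (swap02 (conj10 (swap03 (base Mid)))) (conj10 (swap03 (base Mid))).
Proof.
have CX := @conjugating_pc 4 o1 D0; have C2 := @conjugating_pc 4 o1 D2.
have I2 := conjugating_involutory C2.
set q := conj10 (swap03 (base Mid)).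
have Cq : vconj q by by apply: (vinvol_conj vinvol_conj10); apply: (vinvol_conj vinvol_swap03); exact: base_conj.
have CFq := vinvol_conj vinvol_swap02 Cq.
have tq : (swap02 q).2 = relab sw03 Mid.
  by rewrite -[(swap02 q).2]/(relab sw02 q.2) conj10_swap03_Mid_tree relab_sw02_sw03_Mid.
have eF : aeq (swap02 q).1 (pc o1 D2).
  have [h0 h1 h2 h3] := sw02E.
  apply: aeq_trans (actp_aeq sw02 q) _; apply: aeq_trans (aeq_conjp _ conj10_swap03_Mid_aeq) _.
  apply: aeq_trans (conjp_pc _ _ _) _; rewrite h1 imset_set1 h0; exact: aeq_refl.
split; first by rewrite tq conj10_swap03_Mid_tree.
rewrite tq; apply: (carried_rel CFq (carriedf_pc _ carries_sw03_Mid)); first by rewrite !inE.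
apply: aeq_trans conj10_swap03_Mid_aeq _.
apply: aeq_sym; apply: aeq_trans (comp_aeql _ eF) _.
by move=> i; rewrite red_comp /pc /fm; move: i; apply: ord4P; rewrite !inE //= !inE.
Qed.

(** * The four link inequalities *)

Definition wt3 (a b c : R) (i : nat) : R :=
  match i with 0%N => a | 1%N => b | _ => c end.

Definition p1 (a b c : R) : pt 4 := Pt T1 (wt3 a b c).
Definition p2 (a b c : R) : pt 4 := Pt T2 (wt3 a b c).

Definition bary (a b c : R) : Prop := [/\ 0 <= a, 0 <= b, 0 <= c & a + b + c = 1].

Lemma rsum3 (f : nat -> R) : rsum 3 f = f 0%N + f 1%N + f 2%N.
Proof. by rewrite !rsumS rsum0; lra. Qed.

Lemma wt3_valid s a b c : chain s -> size s = 3%N -> bary a b c -> validpt (Pt (n := 4) s (wt3 a b c)).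
Proof.
move=> Hs sz [a0 b0 c0 e]; split => //=; rewrite sz rsum3; split => //.
by case=> [|[|[|i]]].
Qed.

Lemma p1_valid a b c : bary a b c -> validpt (p1 a b c).
Proof. exact: wt3_valid chain_T1 _. Qed.

Lemma p2_valid a b c : bary a b c -> validpt (p2 a b c).
Proof. exact: wt3_valid chain_T2 _. Qed.

Lemma indic0 (P : Prop) : indic P 0 = 0.
Proof. by rewrite /indic; case: excluded_middle_informative. Qed.

Lemma p1_p2 a b : samept (p1 a b 0) (p2 a b 0).
Proof. by move=> v; rewrite !cwE /= !rsum3 /= !indic0. Qed.

Lemma p2_vpt0 : samept (vpt (base Nuc)) (p2 1 0 0).
Proof. by move=> v; rewrite cw_vpt cwE /= rsum3 /= !indic0; lra. Qed.

Lemma p1_vpt1 : samept (vpt (base Mid)) (p1 0 1 0).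
Proof. by move=> v; rewrite cw_vpt cwE /= rsum3 /= !indic0; lra. Qed.

Lemma p2_vpt1 : samept (vpt (base Mid)) (p2 0 1 0).
Proof. by move=> v; rewrite cw_vpt cwE /= rsum3 /= !indic0; lra. Qed.

Lemma p1_vpt2 : samept (vpt (base Pth)) (p1 0 0 1).
Proof. by move=> v; rewrite cw_vpt cwE /= rsum3 /= !indic0; lra. Qed.

Lemma p2_vpt2 : samept (vpt (base Str)) (p2 0 0 1).
Proof. by move=> v; rewrite cw_vpt cwE /= rsum3 /= !indic0; lra. Qed.

Lemma vpt_mappt F (v : vtx 4) : vinvol F -> validV v -> veq (F v) v -> samept (vpt v) (mappt F (vpt v)).
Proof.
move=> HF Hv fv; apply: mappt_fixed_pt => //; first exact: vpt_valid.
by case.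
Qed.

Lemma wt3_fixed F s a b c : vinvol F -> chain s -> size s = 3%N -> bary a b c ->
  (a <> 0 -> veq (F (nth (v0 4) s 0)) (nth (v0 4) s 0)) ->
  (b <> 0 -> veq (F (nth (v0 4) s 1)) (nth (v0 4) s 1)) ->
  (c <> 0 -> veq (F (nth (v0 4) s 2)) (nth (v0 4) s 2)) ->
  samept (Pt s (wt3 a b c)) (mappt F (Pt s (wt3 a b c))).
Proof.
move=> HF Hs sz Hb h0 h1 h2; apply: mappt_fixed_pt => //; first exact: wt3_valid.
by case=> [|[|[|i]]] /=; rewrite sz // => _ p; [apply: h0|apply: h1|apply: h2]; lra.
Qed.

Lemma bary1 t : 0 <= t <= 1 -> [/\ bary (1 - t) t 0, bary (1 - t) 0 t & bary 0 (1 - t) t] /\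
  [/\ bary t (1 - t) 0, bary t 0 (1 - t) & bary 0 t (1 - t)].
Proof. by move=> t01; split; split; split; lra. Qed.

Definition path_side : vtx 4 -> Prop := parity_side o3 o2 o1.
Definition star_side : vtx 4 -> Prop := parity_side o1 o0 o2.

Lemma path_side_veq (w w' : vtx 4) : validV w -> validV w' -> veq w w' -> path_side w -> path_side w'.
Proof. by move=> Hw _; apply: parity_side_veq => //; exact: valid_vconj. Qed.

Lemma star_side_veq (w w' : vtx 4) : validV w -> validV w' -> veq w w' -> star_side w -> star_side w'.
Proof. by move=> Hw _; apply: parity_side_veq => //; exact: valid_vconj. Qed.

Lemma path_separated (w w' : vtx 4) : validV w -> validV w' ->
  veq (conj10 w) w -> veq (conj10 w') w' -> ~ veq w (base Pth) -> ~ veq w' (base Pth) ->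
  comparable w (base Pth) -> comparable w' (base Pth) -> vle w w' ->
  (path_side w <-> path_side w').
Proof.
move=> Hw Hw' fw fw' nw nw' cw cw'.
by apply: parity_side_separated => //; [exact: valid_vconj|exact: path_fixed_edge|exact: path_fixed_edge].
Qed.

Lemma star_separated (w w' : vtx 4) : validV w -> validV w' ->
  veq (swap02 w) w -> veq (swap02 w') w' -> ~ veq w (base Str) -> ~ veq w' (base Str) ->
  comparable w (base Str) -> comparable w' (base Str) -> vle w w' ->
  (star_side w <-> star_side w').
Proof.
move=> Hw Hw' fw fw' nw nw' cw cw'.
by apply: parity_side_separated => //; [exact: valid_vconj|exact: star_fixed_edge|exact: star_fixed_edge].
Qed.

Section Links.
Variables (kap : model) (rz : realization 4).
Hypothesis HP : PMetric kap rz.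
Hypothesis HE : equivariant (dlen kap rz).
Hypothesis HC : CAT kap (dlen kap rz).

Notation sd := (sdist kap rz).
Notation D := (dd kap rz).

Lemma iso_actp sg x y : validpt x -> validpt y ->
  dlen kap rz (mappt (actp sg) x) (mappt (actp sg) y) = dlen kap rz x y.
Proof. by move=> Hx Hy; apply: (HE (g := (@idA 4, sg))) => //; exact: isAut0_idA. Qed.

Lemma iso_actc i (E : {set 'I_4}) x y : i \notin E -> validpt x -> validpt y ->
  dlen kap rz (mappt (actc i E) x) (mappt (actc i E) y) = dlen kap rz x y.
Proof. by move=> iE Hx Hy; apply: (HE (g := (pc i E, 1%g))) => //; exact: isAut0_pc. Qed.

Lemma iso_conj10 x y : validpt x -> validpt y ->
  dlen kap rz (mappt conj10 x) (mappt conj10 y) = dlen kap rz x y.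
Proof. by apply: iso_actc; rewrite !inE. Qed.

Lemma iso_conj32 x y : validpt x -> validpt y ->
  dlen kap rz (mappt conj32 x) (mappt conj32 y) = dlen kap rz x y.
Proof. by apply: iso_actc; rewrite !inE. Qed.

Lemma D_iso F x y : (forall x y, validpt x -> validpt y ->
    dlen kap rz (mappt F x) (mappt F y) = dlen kap rz x y) ->
  validpt x -> validpt y -> D (mappt F x) (mappt F y) = D x y.
Proof. by move=> H Hx Hy; rewrite /dd H. Qed.

Lemma D_fixl F x y : (forall x y, validpt x -> validpt y ->
    dlen kap rz (mappt F x) (mappt F y) = dlen kap rz x y) ->
  validpt x -> validpt y -> samept x (mappt F x) -> D x (mappt F y) = D x y.
Proof.
move=> H Hx Hy fx; rewrite (dd_samept kap rz fx (@samept_refl 4 (mappt F y))).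
exact: D_iso.
Qed.

(** Replaces distances to v by simplex distances, legitimate near v. The second point y may be a
    mirror image lying outside the base triangles; only its distance to v has to be realized in one
    of them. *)
Lemma link_separation F v (P : vtx 4 -> Prop) : vinvol F ->
  (forall x y, validpt x -> validpt y -> dlen kap rz (mappt F x) (mappt F y) = dlen kap rz x y) ->
  validV v ->
  (forall w w', validV w -> validV w' -> veq w w' -> P w -> P w') ->
  (forall w w', validV w -> validV w' -> veq (F w) w -> veq (F w') w' ->
     ~ veq w v -> ~ veq w' v -> comparable w v -> comparable w' v -> vle w w' ->
     (P w <-> P w')) ->
  exists2 eps, 0 < eps & forall s a e s' a' e' y,
    validpt (Pt s a) -> validpt (Pt s e) -> samept (vpt v) (Pt s e) ->
    validpt (Pt s' a') -> validpt (Pt s' e') -> samept (vpt v) (Pt s' e') ->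
    validpt y -> D (vpt v) y = D (vpt v) (Pt s' a') ->
    samept (Pt s a) (mappt F (Pt s a)) -> samept y (mappt F y) ->
    (forall i, (i < size s)%N -> 0 < a i -> veq (nth (v0 4) s i) v \/ P (nth (v0 4) s i)) ->
    (forall i, (i < size (psx y))%N -> 0 < pwt y i ->
       veq (nth (v0 4) (psx y) i) v \/ ~ P (nth (v0 4) (psx y) i)) ->
    sd s e a < eps -> sd s' e' a' < eps ->
    sd s e a + sd s' e' a' <= D (Pt s a) y.
Proof.
move=> HF iso HV Pveq Pcomp.
have [eps1 e1 sep] := separation HP HC HF iso HV Pveq Pcomp.
have V0 := vpt_valid HV; have [eps2 e2 loc] := local_metric HP V0.
exists (Rmin eps1 eps2); first exact: Rmin_pos.
have lt1 := Rmin_l eps1 eps2; have lt2 := Rmin_r eps1 eps2.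
have B s a e : validpt (Pt s a) -> validpt (Pt s e) -> samept (vpt v) (Pt s e) ->
    sd s e a < Rmin eps1 eps2 -> sd s e a <= D (vpt v) (Pt s a) < eps1.
  move=> Ha He ve lt.
  have le : D (vpt v) (Pt s a) <= sd s e a.
    by rewrite (dd_samept kap rz ve (samept_refl (Pt s a))); exact: dd_simplex.
  split; last lra.
  have [|_ H] := loc (Pt s a) _ Ha (dlen_dd HC V0 Ha); first lra.
  exact: H.
move=> s a e s' a' e' y Ha He ve Ha' He' ve' Hy ey fx fy Px Py lt lt'.
have [b1 b2] := B s a e Ha He ve lt; have [b3 b4] := B s' a' e' Ha' He' ve' lt'.
rewrite -ey in b3 b4; have := sep (Pt s a) y Ha Hy fx fy Px Py b2 b4; lra.
Qed.

(* Stars 1 and 3 in the link of the nuclear vertex. *)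
Lemma nuc_link_ineq : exists2 eps, 0 < eps & forall t r u,
  0 <= t <= 1 -> 0 <= r <= 1 -> 0 <= u <= 1 ->
  sd T2 (wt3 1 0 0) (wt3 (1 - t) 0 t) < eps ->
  sd T2 (wt3 1 0 0) (wt3 (1 - t) 0 t) <=
  sd T2 (wt3 (1 - t) 0 t) (wt3 (1 - r) r 0) + sd T1 (wt3 (1 - r) r 0) (wt3 (1 - u) 0 u).
Proof.
have HV := base_valid hypertree_Nuc.
have [eps e0 sep] := @link_separation swap02 (base Nuc) (fun w => carries w.2 o1 D02)
  vinvol_swap02 (@iso_actp sw02) HV
  (fun w w' _ _ e h => eq_ind _ (fun T => carries T o1 D02) h _ (proj1 e)) nuc_separated.
exists eps => // t r u /bary1[[_ bt _] _] /bary1[[br _ _] _] /bary1[[_ bu _] _] lt.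
have H1 : validpt (p2 1 0 0) by apply: p2_valid; split; lra.
have Hx := p2_valid bt; set x := p2 (1 - t) 0 t in Hx.
have Hy := vinvol_validpt vinvol_swap0213 Hx; set y := mappt swap0213 x in Hy.
have Dy : D (vpt (base Nuc)) y = D (vpt (base Nuc)) x.
  apply: D_fixl (vpt_valid HV) Hx (vpt_mappt vinvol_swap0213 HV swap0213_Nuc); exact: iso_actp.
have fx : samept x (mappt swap02 x).
  by apply: (wt3_fixed vinvol_swap02 chain_T2) => // _; [exact: swap02_Nuc|exact: swap02_Str].
have fy : samept y (mappt swap02 y).
  apply: mappt_fixed_pt => //; first exact: vinvol_swap02.
  by case=> [|[|[|i]]] //= _; [move=> _; exact: swap02_swap0213_Nuc|lra|move=> _; exact: swap02_swap0213_Str].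
have main := sep _ _ _ _ _ _ y Hx H1 p2_vpt0 Hx H1 p2_vpt0 Hy Dy fx fy _ _ lt lt.
have {}main : sd T2 (wt3 1 0 0) (wt3 (1 - t) 0 t) + sd T2 (wt3 1 0 0) (wt3 (1 - t) 0 t) <= D x y.
  apply: main.
    case=> [|[|[|i]]] //= _; [move=> _; left|lra|move=> _; right].
      exact: veq_refl (base_conj _).
    exact: carries_Str02.
  case=> [|[|[|i]]] //= _; [move=> _; left; exact: swap0213_Nuc|lra|move=> _; right].
  (* The mirrored star has centre 3, and its edge {2,3} prevents it from carrying x_{1,{0,2}}. *)
  have [h0 h1 h2 h3] := sw0213E; move/carriesP => /(_ (sw0213 @: e01) o2 o3).
  rewrite mem_relab -{1}h0 -{1}h1 !mem_imset; try exact: perm_inj.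
  move=> H; have : o3 \in D02 by apply: H; rewrite ?Str_e01 ?inE.
  by rewrite !inE.
have Hz := p1_valid bu; set z := p1 (1 - u) 0 u in Hz.
have fz : samept z (mappt swap0213 z).
  by apply: (wt3_fixed vinvol_swap0213 chain_T1) => // _; [exact: swap0213_Nuc|exact: swap0213_Pth].
(* The point z lies on the mirror of [swap0213], so the second half of the fan is the reflection of
   the first and d(x,y) <= 2 d(x,z). *)
have Dzy : D z y = D z x by apply: D_fixl => //; exact: iso_actp.
have t1 := dd_triangle HC Hx Hz Hy; rewrite Dzy (dd_sym kap rz z) in t1.
have Hm := p2_valid br; have Hm' := p1_valid br.
have t2 := dd_triangle HC Hx Hm Hz.
have t3 : D x (p2 (1 - r) r 0) <= sd T2 (wt3 (1 - t) 0 t) (wt3 (1 - r) r 0) by exact: dd_simplex.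
have t4 : D (p2 (1 - r) r 0) z <= sd T1 (wt3 (1 - r) r 0) (wt3 (1 - u) 0 u).
  rewrite -(dd_samept kap rz (p1_p2 _ _) (samept_refl z)); exact: dd_simplex.
lra.
Qed.

(* A path and a star in the link of the middle vertex. *)
Lemma mid_link_ineq : exists2 eps, 0 < eps & forall t u r,
  0 <= t <= 1 -> 0 <= u <= 1 -> 0 <= r <= 1 ->
  sd T1 (wt3 0 1 0) (wt3 0 (1 - t) t) < eps -> sd T2 (wt3 0 1 0) (wt3 0 (1 - u) u) < eps ->
  sd T1 (wt3 0 1 0) (wt3 0 (1 - t) t) + sd T2 (wt3 0 1 0) (wt3 0 (1 - u) u) <=
  sd T1 (wt3 0 (1 - t) t) (wt3 r (1 - r) 0) + sd T2 (wt3 r (1 - r) 0) (wt3 0 (1 - u) u).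
Proof.
have HV := base_valid hypertree_Mid.
have [eps e0 sep] := @link_separation conj10 (base Mid) (fun w => e23 \in w.2) vinvol_conj10 iso_conj10 HV
  (fun w w' _ _ e h => eq_ind _ (fun T : {set {set 'I_4}} => is_true (e23 \in T)) h _ (proj1 e))
  mid_separated.
exists eps => // t u r /bary1[[_ _ bt] _] /bary1[[_ _ bu] _] /bary1[_ [br _ _]] lt lt'.
have b1 : bary 0 1 0 by split; lra.
have Hx := p1_valid bt; have H1 := p1_valid b1; set x := p1 0 (1 - t) t in Hx.
have Hy := p2_valid bu; have H2 := p2_valid b1; set y := p2 0 (1 - u) u in Hy.
have fx : samept x (mappt conj10 x).
  by apply: (wt3_fixed vinvol_conj10 chain_T1) => // _; [exact: conj10_Mid|exact: conj10_Pth].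
have fy : samept y (mappt conj10 y).
  by apply: (wt3_fixed vinvol_conj10 chain_T2) => // _; [exact: conj10_Mid|exact: conj10_Str].
have main := sep _ _ _ _ _ _ y Hx H1 p1_vpt1 Hy H2 p2_vpt1 Hy (erefl _) fx fy _ _ lt lt'.
have {}main : sd T1 (wt3 0 1 0) (wt3 0 (1 - t) t) + sd T2 (wt3 0 1 0) (wt3 0 (1 - u) u) <= D x y.
  apply: main; case=> [|[|[|i]]] //= _; try lra; move=> _; [left|right|left|right].
  - exact: veq_refl (base_conj _).
  - exact: Pth_e23.
  - exact: veq_refl (base_conj _).
  - by rewrite !inE ![e23 == _]eq_sym (negbTE e01_e23) (negbTE e12_e23) (negbTE e13_e23).
have Hm := p2_valid br; have Hm' := p1_valid br.
have t2 := dd_triangle HC Hx Hm Hy.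
have t3 : D x (p2 r (1 - r) 0) <= sd T1 (wt3 0 (1 - t) t) (wt3 r (1 - r) 0).
  rewrite -(dd_samept kap rz (samept_refl x) (p1_p2 _ _)); exact: dd_simplex.
have t4 : D (p2 r (1 - r) 0) y <= sd T2 (wt3 r (1 - r) 0) (wt3 0 (1 - u) u) by exact: dd_simplex.
lra.
Qed.

(* Two opposite middle vertices in the link of a path. *)
Lemma path_link_ineq : exists2 eps, 0 < eps & forall t r u,
  0 <= t <= 1 -> 0 <= r <= 1 -> 0 <= u <= 1 ->
  sd T1 (wt3 0 0 1) (wt3 0 t (1 - t)) < eps ->
  sd T1 (wt3 0 0 1) (wt3 0 t (1 - t)) <=
  sd T1 (wt3 0 t (1 - t)) (wt3 r 0 (1 - r)) + sd T1 (wt3 r 0 (1 - r)) (wt3 0 u (1 - u)).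
Proof.
have HV := base_valid hypertree_Pth.
have [eps e0 sep] := @link_separation conj10 (base Pth) path_side vinvol_conj10 iso_conj10 HV
  path_side_veq path_separated.
exists eps => // t r u /bary1[_ [_ _ bt]] /bary1[_ [_ br _]] /bary1[_ [_ _ bu]] lt.
have H1 : validpt (p1 0 0 1) by apply: p1_valid; split; lra.
have Hx := p1_valid bt; set x := p1 0 t (1 - t) in Hx.
have Hy := vinvol_validpt vinvol_conj32 Hx; set y := mappt conj32 x in Hy.
have Dy : D (vpt (base Pth)) y = D (vpt (base Pth)) x.
  exact: D_fixl iso_conj32 (vpt_valid HV) Hx (vpt_mappt vinvol_conj32 HV conj32_Pth).
have fx : samept x (mappt conj10 x).
  by apply: (wt3_fixed vinvol_conj10 chain_T1) => // _; [exact: conj10_Mid|exact: conj10_Pth].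
have fy : samept y (mappt conj10 y).
  apply: mappt_fixed_pt => //; first exact: vinvol_conj10.
  by case=> [|[|[|i]]] //= _; [lra|move=> _; exact: conj10_conj32_Mid|move=> _; exact: conj10_conj32_Pth].
have main := sep _ _ _ _ _ _ y Hx H1 p1_vpt2 Hx H1 p1_vpt2 Hy Dy fx fy _ _ lt lt.
have {}main : sd T1 (wt3 0 0 1) (wt3 0 t (1 - t)) + sd T1 (wt3 0 0 1) (wt3 0 t (1 - t)) <= D x y.
  apply: main.
    case=> [|[|[|i]]] //= _; [lra|move=> _; right|move=> _; left; exact: veq_refl (base_conj _)].
    split; last by rewrite !ev_idA.
    by exists e123; rewrite Mid_e123 !inE.
  case=> [|[|[|i]]] //= _; [lra|move=> _; right|move=> _; left; exact: conj32_Pth].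
  (* The marking x_{3,{2}} has odd parity at 2 and even parity at 1, so y lies on the other side. *)
  case=> _; rewrite !(ev_aeq _ _ (actc_aeq o3 D2 (base Mid))).
  have CY := @conjugating_pc 4 o3 D2; have CI := @conjugating_idA 4.
  by rewrite !ev_comp // !ev_pc // !ev_idA // !inE.
(* The fan is folded twice: z is on the mirror of [conj32], halving the way from x to y, and the
   point m below is on the mirror of [swap0213], bringing z back to z0 in T1. *)
have Hz0 := p1_valid bu; set z0 := p1 0 u (1 - u) in Hz0.
have Hz := vinvol_validpt vinvol_swap0213 Hz0; set z := mappt swap0213 z0 in Hz.
have fz : samept z (mappt conj32 z).
  apply: mappt_fixed_pt => //; first exact: vinvol_conj32.
  by case=> [|[|[|i]]] //= _; [lra|move=> _; exact: conj32_swap0213_Mid|move=> _; exact: conj32_swap0213_Pth].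
have Dzy : D z y = D z x by apply: D_fixl => //; exact: iso_conj32.
have t1 := dd_triangle HC Hx Hz Hy; rewrite Dzy (dd_sym kap rz z) in t1.
have Hm := p1_valid br; set m := p1 r 0 (1 - r) in Hm.
have fm' : samept m (mappt swap0213 m).
  by apply: (wt3_fixed vinvol_swap0213 chain_T1) => // _; [exact: swap0213_Nuc|exact: swap0213_Pth].
have Dmz : D m z = D m z0 by apply: D_fixl => //; exact: iso_actp.
have t2 := dd_triangle HC Hx Hm Hz; rewrite Dmz in t2.
have t3 : D x m <= sd T1 (wt3 0 t (1 - t)) (wt3 r 0 (1 - r)) by exact: dd_simplex.
have t4 : D m z0 <= sd T1 (wt3 r 0 (1 - r)) (wt3 0 u (1 - u)) by exact: dd_simplex.
lra.
Qed.

(* A nuclear vertex and an opposite middle vertex in the link of a star. *)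
Lemma star_link_ineq : exists2 eps, 0 < eps & forall t r w u,
  0 <= t <= 1 -> 0 <= r <= 1 -> 0 <= w <= 1 -> 0 <= u <= 1 ->
  sd T2 (wt3 0 0 1) (wt3 t 0 (1 - t)) < eps -> sd T2 (wt3 0 0 1) (wt3 0 u (1 - u)) < eps ->
  sd T2 (wt3 0 0 1) (wt3 t 0 (1 - t)) + sd T2 (wt3 0 0 1) (wt3 0 u (1 - u)) <=
  sd T2 (wt3 t 0 (1 - t)) (wt3 0 r (1 - r)) + sd T2 (wt3 0 r (1 - r)) (wt3 w 0 (1 - w)) +
  sd T2 (wt3 w 0 (1 - w)) (wt3 0 u (1 - u)).
Proof.
have HV := base_valid hypertree_Str.
have [eps e0 sep] := @link_separation swap02 (base Str) star_side vinvol_swap02 (@iso_actp sw02) HV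
  star_side_veq star_separated.
exists eps => // t r w u /bary1[_ [_ bt _]] /bary1[_ [_ _ br]] /bary1[_ [_ bw _]] /bary1[_ [_ _ bu]] lt lt'.
have H1 : validpt (p2 0 0 1) by apply: p2_valid; split; lra.
have Hx := p2_valid bt; set x := p2 t 0 (1 - t) in Hx.
have Hy0 := p2_valid bu; set y0 := p2 0 u (1 - u) in Hy0.
have Hy1 := vinvol_validpt vinvol_swap03 Hy0; set y1 := mappt swap03 y0 in Hy1.
have Hy := vinvol_validpt vinvol_conj10 Hy1; set y := mappt conj10 y1 in Hy.
have Dy : D (vpt (base Str)) y = D (vpt (base Str)) y0.
  rewrite (D_fixl iso_conj10 (vpt_valid HV) Hy1 (vpt_mappt vinvol_conj10 HV conj10_Str)).
  apply: D_fixl (vpt_valid HV) Hy0 (vpt_mappt vinvol_swap03 HV swap03_Str); exact: iso_actp.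
have fx : samept x (mappt swap02 x).
  by apply: (wt3_fixed vinvol_swap02 chain_T2) => // _; [exact: swap02_Nuc|exact: swap02_Str].
have fy : samept y (mappt swap02 y).
  apply: mappt_fixed_pt => //; first exact: vinvol_swap02.
  by case=> [|[|[|i]]] //= _; [lra|move=> _; exact: swap02_conj10_swap03_Mid|move=> _; exact: swap02_conj10_swap03_Str].
have main := sep _ _ _ _ _ _ y Hx H1 p2_vpt2 Hy0 H1 p2_vpt2 Hy Dy fx fy _ _ lt lt'.
have {}main : sd T2 (wt3 0 0 1) (wt3 t 0 (1 - t)) + sd T2 (wt3 0 0 1) (wt3 0 u (1 - u)) <= D x y.
  apply: main.
    case=> [|[|[|i]]] //= _; [move=> _; right|lra|move=> _; left; exact: veq_refl (base_conj _)].
    split; last by rewrite !ev_idA.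
    by exists setT; rewrite !inE.
  case=> [|[|[|i]]] //= _; [lra|move=> _; right|move=> _; left; exact: conj10_swap03_Str].
  by case=> _; rewrite !(ev_aeq _ _ conj10_swap03_Mid_aeq) !ev_pc // !inE.
(* The three triangles are T2 and its images under [conj10] and [conj10] after [swap03]. Crossing
   points lie on the shared sides: m is fixed by [conj10], and k is the image of a point fixed by
   [swap03]. *)
have Hm := p2_valid br; set m := p2 0 r (1 - r) in Hm.
have Hk0 := p2_valid bw; set k0 := p2 w 0 (1 - w) in Hk0.
have Hk := vinvol_validpt vinvol_conj10 Hk0; set k := mappt conj10 k0 in Hk.
have fm' : samept m (mappt conj10 m).
  by apply: (wt3_fixed vinvol_conj10 chain_T2) => // _; [exact: conj10_Mid|exact: conj10_Str].
have fk0 : samept k0 (mappt swap03 k0).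
  by apply: (wt3_fixed vinvol_swap03 chain_T2) => // _; [exact: swap03_Nuc|exact: swap03_Str].
have Dmk : D m k = D m k0 by apply: D_fixl => //; exact: iso_conj10.
have Dky : D k y = D k0 y0.
  by rewrite (D_iso iso_conj10 Hk0 Hy1); apply: D_fixl => //; exact: iso_actp.
have t1 := dd_triangle HC Hx Hm Hy; have t2 := dd_triangle HC Hm Hk Hy.
rewrite Dmk Dky in t2.
have t3 : D x m <= sd T2 (wt3 t 0 (1 - t)) (wt3 0 r (1 - r)) by exact: dd_simplex.
have t4 : D m k0 <= sd T2 (wt3 0 r (1 - r)) (wt3 w 0 (1 - w)) by exact: dd_simplex.
have t5 : D k0 y0 <= sd T2 (wt3 w 0 (1 - w)) (wt3 0 u (1 - u)) by exact: dd_simplex.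
lra.
Qed.

End Links.

(** * Angles of triangles in the model planes *)

Definition lenk (kap : model) (a : R) : R := if kap is Hyp then sinh a else a.

Definition ipr (kap : model) (a b c : R) : R :=
  if kap is Hyp then cosh a * cosh b - cosh c else (a ^ 2 + b ^ 2 - c ^ 2) / 2.

(** Law of cosines: the angle between the sides a and b, opposite to c. *)
Definition cosang (kap : model) (a b c : R) : R := ipr kap a b c / (lenk kap a * lenk kap b).

Record triangle (a b c : R) : Prop := Triangle {
  tri_a : 0 < a; tri_b : 0 < b; tri_c : 0 < c;
  tri_abc : a <= b + c; tri_bca : b <= a + c; tri_cab : c <= a + b }.

Lemma cosangC kap a b c : cosang kap a b c = cosang kap b a c.
Proof. by rewrite /cosang (Rmult_comm (lenk kap a)); case: kap => /=; rewrite /Rdiv; congr (_ * _); ring. Qed.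

Lemma lenk_gt0 kap a : 0 < a -> 0 < lenk kap a.
Proof. by case: kap => //=; exact: sinh_gt0. Qed.

(* Heron's expression, and its hyperbolic analogue (the Gram determinant). *)
Definition heron (kap : model) (a b c : R) : R :=
  if kap is Hyp then 1 + 2 * cosh a * cosh b * cosh c - cosh a ^ 2 - cosh b ^ 2 - cosh c ^ 2
  else (2 * a ^ 2 * b ^ 2 + 2 * b ^ 2 * c ^ 2 + 2 * a ^ 2 * c ^ 2 - a ^ 4 - b ^ 4 - c ^ 4) / 4.

Lemma heron_ge0 kap a b c : triangle a b c -> 0 <= heron kap a b c.
Proof.
case=> a0 b0 c0 h1 h2 h3; case: kap => /=.
  have -> : (2 * (a * (a * 1)) * (b * (b * 1)) + 2 * (b * (b * 1)) * (c * (c * 1)) +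
      2 * (a * (a * 1)) * (c * (c * 1)) - a * (a * (a * (a * 1))) -
      b * (b * (b * (b * 1))) - c * (c * (c * (c * 1)))) / 4 =
      ((a + b - c) * (a + b + c)) * ((c - a + b) * (c + a - b)) / 4 by field.
  have p1 : 0 <= (a + b - c) * (a + b + c) by apply: Rmult_le_pos; lra.
  have p2 : 0 <= (c - a + b) * (c + a - b) by apply: Rmult_le_pos; lra.
  have := Rmult_le_pos _ _ p1 p2; lra.
have e1 : cosh c <= cosh (a + b) by apply: cosh_le; lra.
have e2 : cosh (a - b) <= cosh c.
  case: (Rle_lt_dec b a) => ab; first by apply: cosh_le; lra.
  by rewrite -cosh_opp; apply: cosh_le; lra.
rewrite cosh_add in e1; rewrite /Rminus cosh_add cosh_opp sinh_opp in e2.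
have ca := cosh_sinh_sqr a; have cb := cosh_sinh_sqr b.
have p1 : 0 <= cosh a * cosh b + sinh a * sinh b - cosh c by lra.
have p2 : 0 <= cosh c - cosh a * cosh b + sinh a * sinh b by lra.
have := Rmult_le_pos _ _ p1 p2.
have -> : (cosh a * cosh b + sinh a * sinh b - cosh c) * (cosh c - cosh a * cosh b + sinh a * sinh b) =
  (sinh a ^ 2) * (sinh b ^ 2) - (cosh c - cosh a * cosh b) ^ 2 by ring.
have -> : sinh a ^ 2 = cosh a ^ 2 - 1 by lra.
have -> : sinh b ^ 2 = cosh b ^ 2 - 1 by lra.
lra.
Qed.

Lemma lenk_ipr kap a b c : (lenk kap a * lenk kap b) ^ 2 - ipr kap a b c ^ 2 = heron kap a b c.
Proof.
case: kap => /=; first by field.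
have ca := cosh_sinh_sqr a; have cb := cosh_sinh_sqr b.
have -> : sinh a * sinh b * (sinh a * sinh b * 1) = sinh a ^ 2 * sinh b ^ 2 by ring.
have -> : sinh a ^ 2 = cosh a ^ 2 - 1 by lra.
have -> : sinh b ^ 2 = cosh b ^ 2 - 1 by lra.
ring.
Qed.

Lemma cosang_sqr kap a b c : 0 < a -> 0 < b ->
  1 - cosang kap a b c ^ 2 = heron kap a b c / (lenk kap a * lenk kap b) ^ 2.
Proof.
move=> /(lenk_gt0 kap) a0 /(lenk_gt0 kap) b0.
by rewrite -lenk_ipr /cosang; field; lra.
Qed.

Lemma cosang_bound kap a b c : triangle a b c -> -1 <= cosang kap a b c <= 1.
Proof.
move=> T; have [a0 b0 _ _ _ _] := T.
have : 0 <= 1 - cosang kap a b c ^ 2.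
  rewrite cosang_sqr //; apply: Rmult_le_pos; first exact: heron_ge0.
  left; apply: Rinv_0_lt_compat; apply: pow_lt.
  by apply: Rmult_lt_0_compat; exact: lenk_gt0.
nra.
Qed.

Lemma heron_swap kap a b c : heron kap a b c = heron kap a c b.
Proof. by case: kap => /=; [field|ring]. Qed.

(** Dual law of cosines. By [cosang_sqr] the right-hand side is the product of the sines of the two
    angles along a, times cosh a in the hyperbolic case. *)
Lemma cosang_mul_add kap a b c : 0 < a -> 0 < b -> 0 < c ->
  cosang kap a b c * cosang kap a c b + cosang kap b c a =
  (if kap is Hyp then cosh a else 1) * heron kap a b c / (lenk kap a ^ 2 * lenk kap b * lenk kap c).
Proof.
move=> /(lenk_gt0 kap) a0 /(lenk_gt0 kap) b0 /(lenk_gt0 kap) c0.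
have -> : (if kap is Hyp then cosh a else 1) * heron kap a b c =
    ipr kap a b c * ipr kap a c b + lenk kap a ^ 2 * ipr kap b c a.
  case: (kap) => /=; first by field.
  have -> : sinh a * (sinh a * 1) = cosh a ^ 2 - 1 by have := cosh_sinh_sqr a; lra.
  ring.
by rewrite /cosang; field; lra.
Qed.

(** Says that two angles sum to at most pi, which is needed before the cosine of their sum can be
    compared on [0, pi]. After clearing denominators the sum factors into nonnegative terms. *)
Lemma cosang_add_ge0 kap a b c : triangle a b c -> 0 <= cosang kap a b c + cosang kap a c b.
Proof.
case=> a0 b0 c0 h1 h2 h3.
have la := lenk_gt0 kap a0; have lb := lenk_gt0 kap b0; have lc := lenk_gt0 kap c0.
have -> : cosang kap a b c + cosang kap a c b =
   (lenk kap c * ipr kap a b c + lenk kap b * ipr kap a c b) / (lenk kap a * lenk kap b * lenk kap c).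
  by rewrite /cosang; field; lra.
apply: Rmult_le_pos; last first.
  by left; apply: Rinv_0_lt_compat; do 2 apply: Rmult_lt_0_compat => //.
case: (kap) => /=.
  have -> : c * ((a * (a * 1) + b * (b * 1) - c * (c * 1)) / 2) +
     b * ((a * (a * 1) + c * (c * 1) - b * (b * 1)) / 2) = (b + c) * ((a - b + c) * (a + b - c)) / 2 by field.
  have p : 0 <= (a - b + c) * (a + b - c) by apply: Rmult_le_pos; lra.
  have := Rmult_le_pos (b + c) _ ltac:(lra) p; lra.
have e2 : cosh (b - c) <= cosh a.
  case: (Rle_lt_dec c b) => bc; first by apply: cosh_le; lra.
  by rewrite -cosh_opp; apply: cosh_le; lra.
have -> : sinh c * (cosh a * cosh b - cosh c) + sinh b * (cosh a * cosh c - cosh b) =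
  sinh (b + c) * (cosh a - cosh (b - c)).
  rewrite sinh_add /Rminus cosh_add cosh_opp sinh_opp.
  have cb := cosh_sinh_sqr b; have cc := cosh_sinh_sqr c.
  have e : sinh b * cosh b * (cosh c ^ 2 - sinh c ^ 2) + sinh c * cosh c * (cosh b ^ 2 - sinh b ^ 2) =
     sinh b * cosh b + sinh c * cosh c by rewrite cb cc; ring.
  rewrite -[LHS]Rplus_0_r; have -> : 0 = sinh b * cosh b + sinh c * cosh c - (sinh b * cosh b + sinh c * cosh c) by ring.
  rewrite -{2}e; ring.
apply: Rmult_le_pos; last lra.
by apply: sinh_ge0; lra.
Qed.

Lemma acos_sum (A B C : R) : -1 <= A <= 1 -> -1 <= B <= 1 -> -1 <= C <= 1 ->
  0 <= A + B -> 0 <= A * B + C -> (1 - A ^ 2) * (1 - B ^ 2) <= (A * B + C) ^ 2 ->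
  acos A + acos B + acos C <= PI.
Proof.
move=> HA HB HC AB ABC H.
have bA := acos_bound A; have bB := acos_bound B; have bC := acos_bound C.
have sum : acos A + acos B <= PI.
  have : acos A <= PI - acos B; last lra.
  apply: cos_decr_0; try lra.
  by rewrite Rtrigo_facts.cos_pi_minus !cos_acos; lra.
have : acos A + acos B <= PI - acos C; last lra.
apply: cos_decr_0; try lra.
rewrite Rtrigo_facts.cos_pi_minus cos_plus !cos_acos // !sin_acos //.
have pA : 0 <= 1 - Rsqr A by rewrite /Rsqr; nra.
have pB : 0 <= 1 - Rsqr B by rewrite /Rsqr; nra.
rewrite -sqrt_mult //.
have : sqrt ((1 - Rsqr A) * (1 - Rsqr B)) <= A * B + C; last lra.
rewrite -[A * B + C]sqrt_pow2 //; apply: sqrt_le_1_alt.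
by move: H; rewrite /Rsqr; lra.
Qed.

(** The factor cosh a >= 1 in the dual law gives cos A cos B + cos C >= sin A sin B, that is cos(A +
    B) >= cos(pi - C). Degenerate triangles are included. *)
Lemma angle_sum kap a b c : triangle a b c ->
  acos (cosang kap a b c) + acos (cosang kap a c b) + acos (cosang kap b c a) <= PI.
Proof.
move=> T; have [a0 b0 c0 h1 h2 h3] := T.
have la := lenk_gt0 kap a0; have lb := lenk_gt0 kap b0; have lc := lenk_gt0 kap c0.
have H0 := heron_ge0 kap T.
have ch1 : 1 <= (if kap is Hyp then cosh a else 1) by case: (kap); [lra|exact: cosh_ge1].
have T' : triangle a c b by split; lra.
have T'' : triangle b c a by split; lra.
apply: acos_sum; try exact: cosang_bound.
- exact: cosang_add_ge0.
- rewrite cosang_mul_add //; apply: Rmult_le_pos.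
    by apply: Rmult_le_pos => //; lra.
  left; apply: Rinv_0_lt_compat; apply: Rmult_lt_0_compat => //; apply: Rmult_lt_0_compat => //; exact: pow_lt.
- rewrite cosang_mul_add // !cosang_sqr // -(heron_swap kap a b c).
  move: (lenk kap a) (lenk kap b) (lenk kap c) la lb lc => x y z x0 y0 z0.
  move: (heron _ _ _ _) H0 => h h0; move: (if kap is Hyp then cosh a else 1) ch1 => ch ch1.
  have -> : h / (x * y) ^ 2 * (h / (x * z) ^ 2) = 1 * (h / (x ^ 2 * y * z)) ^ 2 by field; lra.
  have -> : (ch * h / (x ^ 2 * y * z)) ^ 2 = ch ^ 2 * (h / (x ^ 2 * y * z)) ^ 2 by field; lra.
  by apply: Rmult_le_compat_r; [exact: pow2_ge_0|nra].
Qed.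

(** * Distances between points on two sides of a triangle *)

(* Points with barycentric parameters [t], [t'] on the sides of lengths [a], [b]
   issuing from a vertex of a triangle with third side [c] have distance [D]. *)
Definition raydist (kap : model) (a b c t t' D : R) : Prop :=
  0 <= D /\
  if kap is Hyp then
    cosh D ^ 2 * (((1 - t) ^ 2 + 2 * t * (1 - t) * cosh a + t ^ 2) *
                  ((1 - t') ^ 2 + 2 * t' * (1 - t') * cosh b + t' ^ 2)) =
    ((1 - t) * (1 - t') + (1 - t) * t' * cosh b + t * (1 - t') * cosh a + t * t' * cosh c) ^ 2
  else D ^ 2 = t ^ 2 * a ^ 2 + t' ^ 2 * b ^ 2 - t * t' * (a ^ 2 + b ^ 2 - c ^ 2).

(** In the hyperboloid, (1-t)p + tq has component 1 - t + t cosh a along p and t sinh a orthogonal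
    to it, so t sinh a / alf is tanh of the distance from p. *)
Definition alf (kap : model) (a t : R) : R := if kap is Hyp then 1 + t * (cosh a - 1) else 1.

Definition loc_dist (c x y : R) : R := sqrt (x ^ 2 + y ^ 2 - 2 * x * y * c).

Lemma alf_ge1 kap a t : 0 <= t -> 1 <= alf kap a t.
Proof.
by move=> t0; case: kap => /=; [lra|have := cosh_ge1 a; nra].
Qed.

Lemma loc_dist_arg c x y : -1 <= c <= 1 -> 0 <= x -> 0 <= y -> 0 <= x ^ 2 + y ^ 2 - 2 * x * y * c.
Proof.
move=> [c1 c2] x0 y0; have := Rmult_le_compat_l _ _ _ (Rmult_le_pos _ _ x0 y0) c2.
have := pow2_ge_0 (x - y); nra.
Qed.

(* In the parameter [x = tanh(distance from the vertex)], hyperbolic distances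
   are dominated by Euclidean ones up to the factors [alf]. *)
Lemma raydist_le kap a b c t t' D x y : triangle a b c ->
  0 <= t <= 1 -> 0 <= t' <= 1 -> 0 <= x -> 0 <= y ->
  t * lenk kap a = x * alf kap a t -> t' * lenk kap b = y * alf kap b t' ->
  raydist kap a b c t t' D ->
  D <= alf kap a t * alf kap b t' * loc_dist (cosang kap a b c) x y.
Proof.
move=> T [t0 t1] [t0' t1'] x0 y0 ex ey [D0 H]; have [a0 b0 _ _ _ _] := T.
have la := lenk_gt0 kap a0; have lb := lenk_gt0 kap b0.
have al := @alf_ge1 kap a t t0; have be := @alf_ge1 kap b t' t0'.
set c0 := cosang kap a b c.
have cb := cosang_bound kap T; rewrite -/c0 in cb.
have ek : ipr kap a b c = lenk kap a * lenk kap b * c0 by rewrite /c0 /cosang; field; lra.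
rewrite -[D]sqrt_pow2 // /loc_dist.
rewrite -[alf kap a t * alf kap b t']sqrt_pow2; last by apply: Rmult_le_pos; lra.
rewrite -sqrt_mult; [|exact: pow2_ge_0|exact: loc_dist_arg].
apply: sqrt_le_1_alt.
have -> : (alf kap a t * alf kap b t') ^ 2 * (x ^ 2 + y ^ 2 - 2 * x * y * c0) =
   (x * alf kap a t) ^ 2 * alf kap b t' ^ 2 + (y * alf kap b t') ^ 2 * alf kap a t ^ 2 -
   2 * alf kap a t * alf kap b t' * (x * alf kap a t) * (y * alf kap b t') * c0 by ring.
rewrite -ex -ey.
have -> : 2 * alf kap a t * alf kap b t' * (t * lenk kap a) * (t' * lenk kap b) * c0 =
   2 * alf kap a t * alf kap b t' * t * t' * ipr kap a b c by rewrite ek; ring.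
have lk := lenk_ipr kap a b c; have H0 := heron_ge0 kap T.
case: kap H al be lk H0 {la lb c0 cb ek ex ey} => /= H al be lk H0.
  by rewrite H; right; field.
have ca := cosh_sinh_sqr a; have cb := cosh_sinh_sqr b.
have a1 := cosh_ge1 a; have b1 := cosh_ge1 b.
set X := cosh a in H al be lk H0 ca a1 *; set Y := cosh b in H al be lk H0 cb b1 *; set Z := cosh c in H lk H0 *.
have D2 := cosh_ge_quad D0; have C1 := cosh_ge1 D.
set C := cosh D in H D2 C1.
set Q := (1 - t) * ((1 - t) * 1) + _ + _ in H; set Q' := (1 - t') * ((1 - t') * 1) + _ + _ in H.
have Q1 : 1 <= Q by rewrite /Q; have := Rmult_le_pos _ _ t0 (_ : 0 <= 1 - t) => /(_ ltac:(lra)); nra.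
have Q1' : 1 <= Q' by rewrite /Q'; have := Rmult_le_pos _ _ t0' (_ : 0 <= 1 - t') => /(_ ltac:(lra)); nra.
have QQ : 1 <= Q * Q' by nra.
(* Chain of estimates: D^2 <= 2 (cosh D - 1) <= C^2 - 1 <= (C^2 - 1) Q Q', and the last expression
   is polynomial in the data. *)
have : (C ^ 2 - 1) * 1 <= (C ^ 2 - 1) * (Q * Q') by apply: Rmult_le_compat_l; nra.
have eH : C ^ 2 * (Q * Q') = ((1 - t) * (1 - t') + (1 - t) * t' * Y + t * (1 - t') * X + t * t' * Z) ^ 2.
  by rewrite -[C ^ 2]/(C * (C * 1)) H; ring.
have eQ : Q = (1 + t * (X - 1)) ^ 2 - t ^ 2 * sinh a ^ 2.
  by have -> : sinh a ^ 2 = X ^ 2 - 1 by [lra]; rewrite /Q; ring.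
have eQ' : Q' = (1 + t' * (Y - 1)) ^ 2 - t' ^ 2 * sinh b ^ 2.
  by have -> : sinh b ^ 2 = Y ^ 2 - 1 by [lra]; rewrite /Q'; ring.
have eN : (1 - t) * (1 - t') + (1 - t) * t' * Y + t * (1 - t') * X + t * t' * Z =
   (1 + t * (X - 1)) * (1 + t' * (Y - 1)) - t * t' * (X * Y - Z) by ring.
have -> : (C ^ 2 - 1) * (Q * Q') = C ^ 2 * (Q * Q') - Q * Q' by ring.
rewrite eH eN eQ eQ'.
set al' := 1 + t * (X - 1) in al *; set be' := 1 + t' * (Y - 1) in be *.
move=> K.
(* The subtracted last term is t^2 t'^2 times the Gram determinant, hence nonnegative; dropping it
   leaves the Euclidean expression. *)
have E : (al' * be' - t * t' * (X * Y - Z)) ^ 2 - (al' ^ 2 - t ^ 2 * sinh a ^ 2) * (be' ^ 2 - t' ^ 2 * sinh b ^ 2) =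
  (t * sinh a) ^ 2 * be' ^ 2 + (t' * sinh b) ^ 2 * al' ^ 2 - 2 * al' * be' * t * t' * (X * Y - Z)
  - t ^ 2 * t' ^ 2 * ((sinh a * sinh b) ^ 2 - (X * Y - Z) ^ 2) by ring.
rewrite E in K.
have P : 0 <= t ^ 2 * t' ^ 2 * ((sinh a * sinh b) ^ 2 - (X * Y - Z) ^ 2).
  apply: Rmult_le_pos; first by apply: Rmult_le_pos; exact: pow2_ge_0.
  by move: lk H0; rewrite -/X -/Y -/Z; lra.
have C2 : 2 * (C - 1) <= C ^ 2 - 1 by nra.
lra.
Qed.

(** With t' = 0 the second point is the vertex. Then x equals D in the Euclidean case and tanh D in
    the hyperbolic one, and tanh D <= D. *)
Lemma raydist_ge kap a b c t D x : 0 < a -> 0 <= t <= 1 ->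
  t * lenk kap a = x * alf kap a t -> raydist kap a b c t 0 D -> x <= D.
Proof.
move=> a0 [t0 t1]; case: kap => /= ex [D0 H].
  apply: Rsqr_incr_0_var => //; rewrite /Rsqr.
  have -> : x = t * a by lra.
  nra.
have ca := cosh_sinh_sqr a; have a1 := cosh_ge1 a.
have al : 1 <= 1 + t * (cosh a - 1) by nra.
have cD := cosh_sinh_sqr D; have C1 := cosh_ge1 D.
have s0 := sinh_ge0 D0; have sc := sinh_le_mul_cosh D0.
set al' := 1 + _ in ex al.
have eH : cosh D ^ 2 * (al' ^ 2 - (t * sinh a) ^ 2) = al' ^ 2.
  transitivity (cosh D ^ 2 * ((1 - t) ^ 2 + 2 * t * (1 - t) * cosh a + t ^ 2)).
    have -> : (t * sinh a) ^ 2 = t ^ 2 * (cosh a ^ 2 - 1) by rewrite -ca; ring.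
    by rewrite /al'; ring.
  have -> : al' ^ 2 = ((1 - t) * (1 - 0) + (1 - t) * 0 * cosh b + t * (1 - 0) * cosh a + t * 0 * cosh c) ^ 2.
    by rewrite /al'; ring.
  by rewrite -H; ring.
have al2 : 0 < al' ^ 2 by apply: pow_lt; lra.
have eS : sinh D ^ 2 = cosh D ^ 2 * x ^ 2.
  apply: (Rmult_eq_reg_r (al' ^ 2)); last lra.
  have -> : cosh D ^ 2 * x ^ 2 * al' ^ 2 = cosh D ^ 2 * (t * sinh a) ^ 2 by rewrite ex; ring.
  have -> : sinh D ^ 2 = cosh D ^ 2 - 1 by lra.
  lra.
have x0 : 0 <= x.
  have p : 0 <= t * sinh a by apply: Rmult_le_pos => //; apply: sinh_ge0; lra.
  apply: (Rmult_le_reg_r al'); lra.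
apply: (Rmult_le_reg_r (cosh D)); first lra.
apply: (Rle_trans _ (sinh D)); last exact: sc.
apply: Rsqr_incr_0_var => //; rewrite /Rsqr; nra.
Qed.

Lemma ray_param kap a s : 0 < a -> 0 <= s ->
  exists2 M, 0 < M & forall M', M <= M' -> forall h, 0 < h -> h * M' <= 1 ->
    exists t, [/\ 0 <= t <= 1, t * lenk kap a = (h * s) * alf kap a t & alf kap a t <= 1 + M' * h].
Proof.
move=> a0 s0; have l0 := lenk_gt0 kap a0.
set la := lenk kap a in l0 *.
pose g := if kap is Hyp then cosh a - 1 else 0.
have g0 : 0 <= g by rewrite /g; case: (kap); have := cosh_ge1 a; lra.
have ga t : alf kap a t = 1 + t * g by rewrite /alf /g; case: (kap); ring.
have il := Rinv_0_lt_compat _ l0.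
have ll : la * / la = 1 by apply: Rinv_r; lra.
have gs : 0 <= g * s by exact: Rmult_le_pos.
have p1 : 0 <= s / la by apply: Rmult_le_pos => //; lra.
have p2 : 0 <= g * s / la by apply: Rmult_le_pos => //; lra.
(* The bound h M' <= 1 makes both h s / la and h g s / la at most 1/2, so t is at most 1 and the
   denominator below at least 1/2. *)
exists (2 * (s / la) + 2 * (g * s / la) + 1); first lra.
move=> M' MM h h0 hM.
have hs : h * (s / la) <= 1 / 2.
  have : h * (2 * (s / la)) <= h * M' by apply: Rmult_le_compat_l; lra.
  lra.
have hg : h * (g * s / la) <= 1 / 2.
  have : h * (2 * (g * s / la)) <= h * M' by apply: Rmult_le_compat_l; lra.
  lra.
pose den := 1 - h * (g * s / la).
have d0 : 1 / 2 <= den by rewrite /den; lra.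
have id : / den <= 2.
  have -> : 2 = / (1 / 2) by field.
  by apply: Rinv_le_contravar; lra.
have id0 : 0 < / den by apply: Rinv_0_lt_compat; lra.
have dd : den * / den = 1 by apply: Rinv_r; lra.
have hs0 : 0 <= h * (s / la) by apply: Rmult_le_pos; lra.
(* Solution of the linear equation t la = h s (1 + t g). *)
exists (h * (s / la) * / den); split.
- split; first by apply: Rmult_le_pos; lra.
  have := Rmult_le_compat_l _ _ _ hs0 id; lra.
- rewrite ga.
  apply: (Rmult_eq_reg_r (den * / la)); last by apply: Rmult_integral_contrapositive_currified; lra.
  have -> : h * (s / la) * / den * la * (den * / la) = h * (s / la) * (den * / den) * (la * / la) by ring.
  have -> : h * s * (1 + h * (s / la) * / den * g) * (den * / la) =
     h * (s / la) * (den + h * (s / la) * g * (den * / den)) by rewrite /Rdiv; ring.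
  by rewrite dd ll /den /Rdiv; ring.
- rewrite ga.
  have : h * (s / la) * / den * g = (h * (g * s / la)) * / den by rewrite /Rdiv; ring.
  move=> ->.
  have : h * (g * s / la) * / den <= h * (g * s / la) * 2.
    by apply: Rmult_le_compat_l => //; apply: Rmult_le_pos; lra.
  have : (2 * (g * s / la)) * h <= M' * h by apply: Rmult_le_compat_r; lra.
  lra.
Qed.

Lemma scale_limit (A B M : R) : 0 < M -> 0 <= B ->
  (forall h, 0 < h -> h * M <= 1 -> h * A <= (1 + M * h) ^ 2 * (h * B)) -> A <= B.
Proof.
move=> M0 B0 H; case: (Rle_lt_dec A B) => // BA; exfalso.
(* As M h <= 1, (1 + M h)^2 <= 1 + 3 M h; the constant 6 makes the error 3 M h B at most half of A -
   B. *)
pose h := Rmin (/ M) ((A - B) / (6 * M * (B + 1))).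
have iM := Rinv_0_lt_compat _ M0.
have den : 0 < 6 * M * (B + 1) by apply: Rmult_lt_0_compat; lra.
have q0 : 0 < (A - B) / (6 * M * (B + 1)) by apply: Rdiv_lt_0_compat; lra.
have h0 : 0 < h by exact: Rmin_pos.
have h1 : h * M <= 1.
  have := Rmult_le_compat_r M _ _ ltac:(lra) (Rmin_l (/ M) ((A - B) / (6 * M * (B + 1)))).
  rewrite -/h Rinv_l; lra.
have h2 : h * (6 * M * (B + 1)) <= A - B.
  have := Rmult_le_compat_r (6 * M * (B + 1)) _ _ ltac:(lra) (Rmin_r (/ M) ((A - B) / (6 * M * (B + 1)))).
  rewrite -/h; have -> : (A - B) / (6 * M * (B + 1)) * (6 * M * (B + 1)) = A - B by field; lra.
  by [].
have := H h h0 h1.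
have -> : (1 + M * h) ^ 2 * (h * B) = h * ((1 + M * h) ^ 2 * B) by ring.
move=> /(Rmult_le_reg_l _ _ _ h0) K.
have Mh : 0 < M * h by exact: Rmult_lt_0_compat.
have : (1 + M * h) ^ 2 * B <= (1 + 3 * (M * h)) * B by apply: Rmult_le_compat_r => //; nra.
have : 6 * (M * h) * (B + 1) <= A - B by lra.
have := Rmult_le_pos _ _ (Rlt_le _ _ Mh) B0; nra.
Qed.

Lemma loc_dist_scale c h x y : 0 < h -> loc_dist c (h * x) (h * y) = h * loc_dist c x y.
Proof.
move=> h0; rewrite /loc_dist.
have -> : (h * x) ^ 2 + (h * y) ^ 2 - 2 * (h * x) * (h * y) * c = h ^ 2 * (x ^ 2 + y ^ 2 - 2 * x * y * c) by ring.
rewrite sqrt_mult_alt; last exact: pow2_ge_0.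
by rewrite sqrt_pow2 //; lra.
Qed.

Lemma loc_distC c x y : loc_dist c x y = loc_dist c y x.
Proof. by rewrite /loc_dist; congr sqrt; ring. Qed.

Lemma loc_dist_ge0 c x y : 0 <= loc_dist c x y.
Proof. exact: sqrt_pos. Qed.

Lemma sqrt_1p_le (x : R) : 0 <= 1 + x -> sqrt (1 + x) <= 1 + x / 2.
Proof.
move=> x0; rewrite -[1 + x / 2]sqrt_pow2; last lra.
by apply: sqrt_le_1_alt; nra.
Qed.

(** * First variation estimates *)

(** Planar picture: no path from a unit point across the middle ray to the last ray is shorter than
    1. If the angles summed to less than a right angle, stepping to the middle ray and then dropping
    a perpendicular would be shorter. *)
Lemma quarter_turn (c1 c2 : R) : -1 <= c1 <= 1 -> -1 <= c2 <= 1 ->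
  (forall r u, 0 <= r -> 0 <= u -> 1 <= loc_dist c2 1 r + loc_dist c1 r u) ->
  PI / 2 <= acos c1 + acos c2.
Proof.
move=> H1 H2 H; have b1 := acos_bound c1; have b2 := acos_bound c2.
case: (Rle_lt_dec c1 0) => c10.
  have : PI / 2 <= acos c1; last lra.
  apply: cos_decr_0; try lra; rewrite cos_PI2 cos_acos //.
have lt : acos c1 < PI / 2.
  apply: cos_decreasing_0; try lra; rewrite cos_PI2 cos_acos //.
have : PI / 2 - acos c1 <= acos c2; last lra.
apply: cos_decr_0; try lra.
rewrite cos_shift sin_acos // cos_acos //.
have p : 0 <= 1 - Rsqr c1 by rewrite /Rsqr; nra.
set m := sqrt _; have m0 : 0 <= m by exact: sqrt_pos.
have mm : m * m = 1 - c1 * c1 by rewrite sqrt_sqrt.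
case: (Rle_lt_dec c2 m) => // cm.
have m1 : m <= 1 by nra.
have r0 : 0 <= c2 - m by lra.
(* Here m is the sine of the first angle, so c2 - m is the excess to be refuted. The second argument
   is the foot of the perpendicular from radius r, at distance r m. *)
have := H (c2 - m) ((c2 - m) * c1) r0 (Rmult_le_pos _ _ r0 (Rlt_le _ _ c10)).
set r := c2 - m in r0 *.
have -> : loc_dist c1 r (r * c1) = r * m.
  rewrite /loc_dist -[r * m]sqrt_pow2; last exact: Rmult_le_pos.
  congr sqrt; have -> : (r * m) ^ 2 = r ^ 2 * (m * m) by ring.
  by rewrite mm; ring.
move=> K.
have K2 : (1 - r * m) ^ 2 <= 1 ^ 2 + r ^ 2 - 2 * 1 * r * c2.
  rewrite -[X in _ <= X]sqrt_sqrt; last by apply: loc_dist_arg; lra.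
  have r1 : r <= 1 by rewrite /r; lra.
  have rm : 0 <= 1 - r * m by have := Rmult_le_compat _ _ _ _ r0 m0 r1 m1; lra.
  move: K; rewrite /loc_dist; set S := sqrt _ => K; nra.
have r1 : 0 < r by rewrite /r; lra.
have K3 : 2 * (c2 - m) <= r * (1 - m * m).
  apply: (Rmult_le_reg_l r) => //; nra.
rewrite mm -/r in K3; nra.
Qed.

Lemma half_turn (c1 c2 : R) : -1 <= c1 <= 1 -> -1 <= c2 <= 1 ->
  (forall r, 0 <= r -> 2 <= loc_dist c1 1 r + loc_dist c2 r 1) ->
  PI <= acos c1 + acos c2.
Proof.
move=> H1 H2 H; have b1 := acos_bound c1; have b2 := acos_bound c2.
have : PI - acos c2 <= acos c1; last lra.
apply: cos_decr_0; try lra.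
rewrite Rtrigo_facts.cos_pi_minus !cos_acos //.
case: (Rle_lt_dec c1 (- c2)) => // h.
(* With sqrt(1 + z) <= 1 + z/2 the two lengths sum to at most 2 + r^2 - r (c1 + c2); this r
   minimizes it, with value 2 - r^2. *)
have r0 : 0 <= (c1 + c2) / 2 by lra.
have := H _ r0; rewrite (loc_distC c2) /loc_dist; set r := (c1 + c2) / 2.
have e c : 1 ^ 2 + r ^ 2 - 2 * 1 * r * c = 1 + (r ^ 2 - 2 * r * c) by ring.
have s c : -1 <= c <= 1 -> sqrt (1 ^ 2 + r ^ 2 - 2 * 1 * r * c) <= 1 + (r ^ 2 - 2 * r * c) / 2.
  move=> Hc; rewrite e; apply: sqrt_1p_le; rewrite -e; apply: loc_dist_arg => //; lra.
have := s c1 H1; have := s c2 H2; rewrite /r; nra.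
Qed.

Lemma third_turn (c : R) : -1 <= c <= 1 ->
  (forall r, 0 <= r -> 2 <= loc_dist c 1 r + loc_dist c r r + loc_dist c r 1) ->
  PI / 3 <= acos c.
Proof.
move=> Hc H; have b := acos_bound c; have pi0 := PI_RGT_0.
apply: cos_decr_0; try lra.
rewrite cos_PI3 cos_acos //.
case: (Rle_lt_dec c (1 / 2)) => // h.
(* The linearized total is 2 + r (r - 2c + sqrt(2 - 2c)). This r makes the bracket sqrt(2 - 2c) - 1,
   negative when c > 1/2. *)
have r0 : 0 <= 2 * c - 1 by lra.
have := H _ r0; rewrite (loc_distC c _ 1); set r := 2 * c - 1.
have -> : loc_dist c r r = r * sqrt (2 - 2 * c).
  have := @loc_dist_scale c r 1 1 ltac:(rewrite /r; lra); rewrite !Rmult_1_r => ->.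
  by congr (_ * _); rewrite /loc_dist; congr sqrt; ring.
have s : loc_dist c 1 r <= 1 + (r ^ 2 - 2 * r * c) / 2.
  rewrite /loc_dist (_ : 1 ^ 2 + r ^ 2 - 2 * 1 * r * c = 1 + (r ^ 2 - 2 * r * c)); last by ring.
  apply: sqrt_1p_le; have := @loc_dist_arg c 1 r Hc ltac:(lra) r0; lra.
have q : sqrt (2 - 2 * c) < 1 by have <- := sqrt_1; apply: sqrt_lt_1_alt; lra.
have rp : 0 < r by rewrite /r; lra.
rewrite /r in s rp *; nra.
Qed.

(** * Angles of the base triangles *)

Lemma bil3 (G : nat -> nat -> R) (g a b c a' b' c' : R) :
  (forall i j, G i j = G j i) -> (forall i, (i < 3)%N -> G i i = g) ->
  bil 3 G (wt3 a b c) (wt3 a' b' c') =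
  g * (a * a' + b * b' + c * c') + G 0%N 1%N * (a * b' + b * a') +
  G 0%N 2%N * (a * c' + c * a') + G 1%N 2%N * (b * c' + c * b').
Proof.
move=> GC Gg; rewrite /bil !rsum3 /= (GC 1%N 0%N) (GC 2%N 0%N) (GC 2%N 1%N).
by rewrite (Gg 0%N) // (Gg 1%N) // (Gg 2%N) //; ring.
Qed.

Lemma raydist_sym kap a b c t t' D : raydist kap a b c t t' D -> raydist kap b a c t' t D.
Proof.
case=> D0 H; split => //; case: kap H => H; first by rewrite H; ring.
by rewrite [X in _ * X]Rmult_comm H; ring.
Qed.

Section Angles.
Variables (kap : model) (rz : realization 4).
Hypothesis HP : PMetric kap rz.

Notation sd := (sdist kap rz).

Definition side (s : seq (vtx 4)) (i j : nat) : R :=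
  vdist kap (rz s).1 ((rz s).2 i) ((rz s).2 j).

Section Triangle.
Variable L : {set {set 'I_4}}.
Hypothesis HL : chain (chain3 L).
Let s := chain3 L.

Lemma vertex_inspace i : (i < 3)%N -> inspace kap (rz s).1 ((rz s).2 i).
Proof. by move=> i3; apply: (@goodreal_inspace kap 3 _ (rz s).2 i (proj1 HP s HL)). Qed.

Lemma sgramC i j : sgram kap rz s i j = sgram kap rz s j i.
Proof. by rewrite /sgram /vgram vdistC. Qed.

Lemma sgram_diag i : (i < 3)%N -> sgram kap rz s i i = gram kap 0.
Proof. by move=> i3; rewrite /sgram /vgram vdist_refl //; exact: vertex_inspace. Qed.

Lemma sd_bil a b c a' b' c' : bary a b c -> bary a' b' c' ->
  let B x y z x' y' z' := gram kap 0 * (x * x' + y * y' + z * z') +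
     gram kap (side s 0 1) * (x * y' + y * x') + gram kap (side s 0 2) * (x * z' + z * x') +
     gram kap (side s 1 2) * (y * z' + z * y') in
  let d := sd s (wt3 a b c) (wt3 a' b' c') in
  if kap is Hyp then [/\ 0 < B a b c a b c, 0 < B a' b' c' a' b' c' &
     cosh d = B a b c a' b' c' / (sqrt (B a b c a b c) * sqrt (B a' b' c' a' b' c'))]
  else d ^ 2 = B a b c a' b' c' - B a b c a b c / 2 - B a' b' c' a' b' c' / 2.
Proof.
move=> Ha Hb B d.
have Va := validpt_weights (wt3_valid HL (erefl _) Ha).
have Vb := validpt_weights (wt3_valid HL (erefl _) Hb).
have := spoint_gram (proj1 HP s HL) Va Vb.
have E x y z x' y' z' : bil 3 (vgram kap (rz s).1 (rz s).2) (wt3 x y z) (wt3 x' y' z') = B x y z x' y' z'.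
  by rewrite (@bil3 _ (gram kap 0)) //; [exact: sgramC|exact: sgram_diag].
by rewrite -[size s]/3%N !E.
Qed.

Lemma sd_ge0 a b c a' b' c' : bary a b c -> bary a' b' c' -> 0 <= sd s (wt3 a b c) (wt3 a' b' c').
Proof. by move=> Ha Hb; apply: sdist_ge0 => //; exact: wt3_valid. Qed.

Lemma raydist_bil a b c t t' D (ab aa bb : R) : 0 <= D ->
  (if kap is Hyp then [/\ 0 < aa, 0 < bb & cosh D = ab / (sqrt aa * sqrt bb)]
   else D ^ 2 = ab - aa / 2 - bb / 2) ->
  (if kap is Hyp then
    [/\ aa = (1 - t) ^ 2 + 2 * t * (1 - t) * cosh a + t ^ 2,
        bb = (1 - t') ^ 2 + 2 * t' * (1 - t') * cosh b + t' ^ 2 &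
        ab = (1 - t) * (1 - t') + (1 - t) * t' * cosh b + t * (1 - t') * cosh a + t * t' * cosh c]
   else ab - aa / 2 - bb / 2 = t ^ 2 * a ^ 2 + t' ^ 2 * b ^ 2 - t * t' * (a ^ 2 + b ^ 2 - c ^ 2)) ->
  raydist kap a b c t t' D.
Proof.
move=> D0 H K; split => //; case: (kap) H K => [-> -> //|[a0 b0 ->] [<- <- <-]].
have sa := sqrt_lt_R0 _ a0; have sb := sqrt_lt_R0 _ b0.
have ea := sqrt_sqrt aa ltac:(lra); have eb := sqrt_sqrt bb ltac:(lra).
have -> : aa * bb = (sqrt aa * sqrt aa) * (sqrt bb * sqrt bb) by rewrite ea eb.
field; lra.
Qed.

Ltac ray_tac := move=> /bary1[[b1 b2 b3] [b4 b5 b6]] /bary1[[c1 c2 c3] [c4 c5 c6]];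
  apply: raydist_bil (sd_ge0 _ _) (sd_bil _ _) _ => //;
  case: (kap) => /=; rewrite ?cosh_0; [field | split; ring].

Lemma raydist0 t t' : 0 <= t <= 1 -> 0 <= t' <= 1 ->
  raydist kap (side s 0 1) (side s 0 2) (side s 1 2) t t'
    (sd s (wt3 (1 - t) t 0) (wt3 (1 - t') 0 t')).
Proof. by ray_tac. Qed.

Lemma raydist1 t t' : 0 <= t <= 1 -> 0 <= t' <= 1 ->
  raydist kap (side s 0 1) (side s 1 2) (side s 0 2) t t'
    (sd s (wt3 t (1 - t) 0) (wt3 0 (1 - t') t')).
Proof. by ray_tac. Qed.

Lemma raydist2 t t' : 0 <= t <= 1 -> 0 <= t' <= 1 ->
  raydist kap (side s 0 2) (side s 1 2) (side s 0 1) t t'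
    (sd s (wt3 t 0 (1 - t)) (wt3 0 t' (1 - t'))).
Proof. by ray_tac. Qed.

Lemma side_gt0_of (a b c a' b' c' x : R) (i : nat) : bary a b c -> bary a' b' c' -> (i < 3)%N ->
  0 < wt3 a b c i -> wt3 a' b' c' i = 0 -> 0 <= x ->
  raydist kap x x x 1 0 (sd s (wt3 a b c) (wt3 a' b' c')) -> 0 < x.
Proof.
move=> Ha Hb i3 ai bi x0 [d0 H]; case: (Rle_lt_or_eq_dec 0 x x0) => // ex; subst x; exfalso.
have [eta e0 far] := sdist_far_from_faces HP (wt3_valid HL (erefl _) Ha).
have := far _ i (wt3_valid HL (erefl _) Hb) i3 ai bi.
set d := sdist _ _ _ _ _ in d0 H *; suff -> : d = 0 by lra.
case: (kap) H => H; first by nra.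
rewrite cosh_0 in H; apply: cosh_inj; rewrite ?cosh_0; try lra.
have := cosh_ge1 d; nra.
Qed.

Lemma side_ge0 i j : (i < 3)%N -> (j < 3)%N -> 0 <= side s i j.
Proof. by move=> i3 j3; apply: vdist_ge0; exact: vertex_inspace. Qed.

Lemma raydist_any a b c b' c' t D : raydist kap a b c t 0 D -> raydist kap a b' c' t 0 D.
Proof.
case=> D0 H; split => //; case: (kap) H => H; first by rewrite H; ring.
transitivity (cosh D ^ 2 * (((1 - t) ^ 2 + 2 * t * (1 - t) * cosh a + t ^ 2) *
   ((1 - 0) ^ 2 + 2 * 0 * (1 - 0) * cosh b + 0 ^ 2))); first by ring.
by rewrite H; ring.
Qed.

Lemma side_triangle : triangle (side s 0 1) (side s 0 2) (side s 1 2).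
Proof.
have e01 : 0 <= 1 <= 1 by lra.
have e00 : 0 <= 0 <= 1 by lra.
have m : 1 - 1 = 0 by ring.
have T i j k : (i < 3)%N -> (j < 3)%N -> (k < 3)%N -> side s i k <= side s i j + side s j k.
  by move=> i3 j3 k3; apply: vdist_triangle; exact: vertex_inspace.
have C i j : side s i j = side s j i by exact: vdistC.
have [[_ _ b1] [b2 b3 b4]] := bary1 e01; have [[_ _ c1] [c2 c3 c4]] := bary1 e00.
have r0 := raydist_any (side s 0 1) (side s 0 1) (raydist0 e01 e00).
have r2 := raydist_any (side s 0 2) (side s 0 2) (raydist2 e01 e00).
have r1 := raydist_any (side s 1 2) (side s 1 2) (raydist_sym (raydist1 e00 e01)).
have [d1 [d2 d3]] : bary (1 - 1) 1 0 /\ bary (1 - 0) 0 0 /\ bary 0 (1 - 0) 0 by split; [|split]; split; lra.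
have d4 : bary 0 0 (1 - 0) by split; lra.
have d5 : bary 1 0 (1 - 1) by split; lra.
have d6 : bary 0 (1 - 1) 1 by split; lra.
split.
- by apply: (side_gt0_of (i := 1) d1 d2 _ _ _ (side_ge0 _ _) r0) => //=; lra.
- by apply: (side_gt0_of (i := 0) d5 d4 _ _ _ (side_ge0 _ _) r2) => //=; lra.
- rewrite sdistC in r1.
  by apply: (side_gt0_of (i := 2) d6 d3 _ _ _ (side_ge0 _ _) r1) => //=; lra.
- by rewrite [side s 1 2]C; exact: T.
- exact: T.
- by rewrite [side s 0 1]C; exact: T.
Qed.

End Triangle.

Lemma raydist_step a b c t t' D x y h M : triangle a b c ->
  0 <= t <= 1 -> 0 <= t' <= 1 -> 0 < h -> 0 <= x -> 0 <= y -> 0 <= M ->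
  t * lenk kap a = (h * x) * alf kap a t -> t' * lenk kap b = (h * y) * alf kap b t' ->
  alf kap a t <= 1 + M * h -> alf kap b t' <= 1 + M * h ->
  raydist kap a b c t t' D -> D <= (1 + M * h) ^ 2 * (h * loc_dist (cosang kap a b c) x y).
Proof.
move=> T t01 t01' h0 x0 y0 M0 e e' al al' H.
have hx : 0 <= h * x by apply: Rmult_le_pos; lra.
have hy : 0 <= h * y by apply: Rmult_le_pos; lra.
have := raydist_le T t01 t01' hx hy e e' H; rewrite loc_dist_scale // => K.
apply: (Rle_trans _ _ _ K); apply: Rmult_le_compat_r.
  by apply: Rmult_le_pos; [lra|exact: loc_dist_ge0].
have a1 := @alf_ge1 kap a t ltac:(lra); have b1 := @alf_ge1 kap b t' ltac:(lra).
by rewrite /= Rmult_1_r; apply: Rmult_le_compat; lra.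
Qed.

(** The distance to the vertex is at most (1 + M h)^2 h <= 4 h, and h (4/eps + 1) <= 1 makes this
    less than eps. *)
Lemma raydist_small a b c t D h M eps : triangle a b c ->
  0 <= t <= 1 -> 0 < h -> 0 < eps -> 4 / eps + 1 <= M -> h * M <= 1 ->
  t * lenk kap a = (h * 1) * alf kap a t -> alf kap a t <= 1 + M * h ->
  raydist kap a b c t 0 D -> h <= D < eps.
Proof.
move=> T t01 h0 e0 eM hM e al H; have [a0 _ _ _ _ _] := T.
have q0 : 0 < 4 / eps by apply: Rdiv_lt_0_compat; lra.
have M0 : 0 <= M by lra.
split; first by rewrite -[h]Rmult_1_r; exact: raydist_ge a0 t01 e H.
have z : 0 <= 0 <= 1 by lra.
have K := @raydist_step a b c t 0 D 1 0 h M T t01 z h0 ltac:(lra) ltac:(lra) M0 e _ al _ H.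
have {K} : D <= (1 + M * h) ^ 2 * (h * loc_dist (cosang kap a b c) 1 0).
  apply: K; first by ring.
  have : 0 <= M * h by apply: Rmult_le_pos; lra.
  by rewrite /alf; case: (kap); lra.
have -> : loc_dist (cosang kap a b c) 1 0 = 1.
  by rewrite /loc_dist (_ : _ - _ = 1) ?sqrt_1 //; ring.
have Mh : 0 <= M * h <= 1 by split; [apply: Rmult_le_pos|]; lra.
have : (1 + M * h) ^ 2 * (h * 1) <= 4 * (h * 1) by apply: Rmult_le_compat_r; [lra|nra].
have : h * (4 / eps + 1) <= 1 by apply: (Rle_trans _ _ _ _ hM); apply: Rmult_le_compat_l; lra.
have : 4 * h = (h * (4 / eps)) * eps by field; lra.
nra.
Qed.

(** * Angle bounds for the two base triangles *)

Hypothesis HE : equivariant (dlen kap rz).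
Hypothesis HC : CAT kap (dlen kap rz).

(** The shared side p joins the nuclear and middle vertices; q and w join the path or star (index 1
    or 2) to the nuclear and to the middle vertex respectively. *)
Let p := side T1 0 1.
Let q1 := side T1 0 2.
Let w1 := side T1 1 2.
Let q2 := side T2 0 2.
Let w2 := side T2 1 2.

Lemma shared_side : side T2 0 1 = p.
Proof.
by apply: (proj2 HP) => //; [exact: chain_T2|exact: chain_T1| |]; apply: veq_refl; exact: base_conj.
Qed.

Lemma tri1 : triangle p q1 w1.
Proof. exact: side_triangle chain_T1. Qed.

Lemma tri2 : triangle p q2 w2.
Proof. by rewrite -shared_side; exact: side_triangle chain_T2. Qed.

Lemma tri_perms a b c : triangle a b c ->
  [/\ triangle a c b, triangle b a c, triangle b c a, triangle c a b & triangle c b a].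
Proof. by case=> *; split; split; lra. Qed.

(** One M and one scale h serve all points of a fan, so that a single limit in h can be taken. The
    star fan has four points; shorter fans repeat a slot. *)
Lemma ray_params a1 x1 a2 x2 a3 x3 a4 x4 eps : 0 < eps ->
  0 < a1 -> 0 < a2 -> 0 < a3 -> 0 < a4 -> 0 <= x1 -> 0 <= x2 -> 0 <= x3 -> 0 <= x4 ->
  let ray a x h M t := [/\ 0 <= t <= 1, t * lenk kap a = (h * x) * alf kap a t &
                           alf kap a t <= 1 + M * h] in
  exists M, [/\ 0 < M, 4 / eps + 1 <= M & forall h, 0 < h -> h * M <= 1 ->
    exists t1 t2 t3 t4, [/\ ray a1 x1 h M t1, ray a2 x2 h M t2, ray a3 x3 h M t3 & ray a4 x4 h M t4]].
Proof.
move=> e0 h1 h2 h3 h4 p1 p2 p3 p4 ray.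
have [M1 m1 P1] := @ray_param kap a1 x1 h1 p1; have [M2 m2 P2] := @ray_param kap a2 x2 h2 p2.
have [M3 m3 P3] := @ray_param kap a3 x3 h3 p3; have [M4 m4 P4] := @ray_param kap a4 x4 h4 p4.
have q0 : 0 < 4 / eps by apply: Rdiv_lt_0_compat; lra.
pose M := M1 + M2 + M3 + M4 + (4 / eps + 1).
have l1 : M1 <= M by rewrite /M; lra.
have l2 : M2 <= M by rewrite /M; lra.
have l3 : M3 <= M by rewrite /M; lra.
have l4 : M4 <= M by rewrite /M; lra.
exists M; split; [by rewrite /M; lra|by rewrite /M; lra|move=> h h0 hM].
have [t1 r1] := P1 M l1 h h0 hM; have [t2 r2] := P2 M l2 h h0 hM.
have [t3 r3] := P3 M l3 h h0 hM; have [t4 r4] := P4 M l4 h h0 hM.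
by exists t1, t2, t3, t4.
Qed.

(** The last ray, towards the path, is a mirror, so the half turn of the full fan becomes a quarter
    turn with a free endpoint on that ray. *)
Lemma nuc_angles : PI / 2 <= acos (cosang kap p q1 w1) + acos (cosang kap p q2 w2).
Proof.
have [_ T2' _ _ _] := tri_perms tri2; have U1 := tri1.
have [a0 b0 c0 _ _ _] := tri1; have [_ b0' c0' _ _ _] := tri2.
rewrite (cosangC kap p q2); apply: quarter_turn; try exact: cosang_bound.
move=> r u r0 u0; have [eps e0 H] := nuc_link_ineq HP HE HC.
have i01 : 0 <= 1 by lra.
have [M [M0 eM HM]] := @ray_params q2 1 p r q1 u q1 u eps e0 b0' a0 b0 b0 i01 r0 u0 u0.
apply: (@scale_limit _ _ M) => //.
  by apply: Rplus_le_le_0_compat; exact: loc_dist_ge0.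
move=> h h0 hM.
have [t [t' [v [u' [[t01 et at_] [t01' et' at'] [v01 ev av] [u01 eu au]]]]]] := HM h h0 hM.
have z : 0 <= 0 <= 1 by lra.
have M0' : 0 <= M by lra.
have R0 := raydist_sym (raydist0 chain_T2 z t01); rewrite Rminus_0_r shared_side in R0.
have [l0 s0] := raydist_small T2' t01 h0 e0 eM hM et at_ R0.
have R1 := raydist_sym (raydist0 chain_T2 t01' t01); rewrite shared_side sdistC in R1.
have K1 := raydist_step T2' t01 t01' h0 i01 r0 M0' et et' at_ at' R1.
have R2 := raydist0 chain_T1 t01' v01.
have K2 := raydist_step U1 t01' v01 h0 r0 u0 M0' et' ev at' av R2.
have := H t t' v t01 t01' v01 s0.
rewrite /T1 /T2 Rmult_plus_distr_l Rmult_plus_distr_l; lra.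
Qed.

Lemma mid_angles : PI <= acos (cosang kap p w1 q1) + acos (cosang kap p w2 q2).
Proof.
have [U2 _ _ _ _] := tri_perms tri2; have [_ _ _ U1 _] := tri_perms tri1.
have [a0 b0 c0 _ _ _] := tri1; have [_ b0' c0' _ _ _] := tri2.
rewrite (cosangC kap p w1); apply: half_turn; [|exact: cosang_bound U2|].
  by apply: cosang_bound; exact: U1.
move=> r r0; have [eps e0 H] := mid_link_ineq HP HE HC.
have i01 : 0 <= 1 by lra.
have [M [M0 eM HM]] := @ray_params w1 1 p r w2 1 w2 1 eps e0 c0 a0 c0' c0' i01 r0 i01 i01.
apply: (@scale_limit _ _ M) => //.
  by apply: Rplus_le_le_0_compat; exact: loc_dist_ge0.
move=> h h0 hM.
have [t [t' [v [u' [[t01 et at_] [t01' et' at'] [v01 ev av] [u01 eu au]]]]]] := HM h h0 hM.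
have z : 0 <= 0 <= 1 by lra.
have M0' : 0 <= M by lra.
have [_ _ _ _ U2'] := tri_perms tri2; have [_ _ _ U2'' _] := tri_perms tri2.
have R0 := raydist_sym (raydist1 chain_T1 z t01); rewrite Rminus_0_r in R0.
have [l0 s0] := raydist_small U1 t01 h0 e0 eM hM et at_ R0.
have R0' := raydist_sym (raydist1 chain_T2 z v01); rewrite Rminus_0_r shared_side in R0'.
have [l0' s0'] := raydist_small U2'' v01 h0 e0 eM hM ev av R0'.
have R1 := raydist_sym (raydist1 chain_T1 t01' t01); rewrite sdistC in R1.
have K1 := raydist_step U1 t01 t01' h0 i01 r0 M0' et et' at_ at' R1.
have R2 := raydist1 chain_T2 t01' v01; rewrite shared_side in R2.
have K2 := raydist_step U2 t01' v01 h0 r0 i01 M0' et' ev at' av R2.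
have := H t v t' t01 v01 t01' s0 s0'.
rewrite /T1 /T2 Rmult_plus_distr_l Rmult_plus_distr_l; lra.
Qed.

(** After both foldings the same angle of T1 occurs twice in a quarter turn. *)
Lemma path_angle : PI / 2 <= acos (cosang kap q1 w1 p) + acos (cosang kap q1 w1 p).
Proof.
have [_ _ U1 _ U1'] := tri_perms tri1; have [a0 b0 c0 _ _ _] := tri1.
apply: quarter_turn; try exact: cosang_bound.
move=> r u r0 u0; have [eps e0 H] := path_link_ineq HP HE HC.
have i01 : 0 <= 1 by lra.
have [M [M0 eM HM]] := @ray_params w1 1 q1 r w1 u w1 u eps e0 c0 b0 c0 c0 i01 r0 u0 u0.
apply: (@scale_limit _ _ M) => //.
  by apply: Rplus_le_le_0_compat; exact: loc_dist_ge0.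
move=> h h0 hM.
have [t [t' [v [u' [[t01 et at_] [t01' et' at'] [v01 ev av] [u01 eu au]]]]]] := HM h h0 hM.
have z : 0 <= 0 <= 1 by lra.
have M0' : 0 <= M by lra.
have R0 := raydist_sym (raydist2 chain_T1 z t01); rewrite Rminus_0_r in R0.
have [l0 s0] := raydist_small U1' t01 h0 e0 eM hM et at_ R0.
have R1 := raydist_sym (raydist2 chain_T1 t01' t01); rewrite sdistC in R1.
have K1 := raydist_step U1' t01 t01' h0 i01 r0 M0' et et' at_ at' R1.
have R2 := raydist2 chain_T1 t01' v01.
have K2 := raydist_step U1 t01' v01 h0 r0 u0 M0' et' ev at' av R2.
rewrite cosangC in K1.
have := H t t' v t01 t01' v01 s0.
rewrite /T1 /T2 Rmult_plus_distr_l Rmult_plus_distr_l; lra.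
Qed.

Lemma star_angle : PI / 3 <= acos (cosang kap q2 w2 p).
Proof.
have [_ _ U1 _ U1'] := tri_perms tri2; have [a0 b0 c0 _ _ _] := tri2.
apply: third_turn; first exact: cosang_bound.
move=> r r0; have [eps e0 H] := star_link_ineq HP HE HC.
have i01 : 0 <= 1 by lra.
have [M [M0 eM HM]] := @ray_params q2 1 w2 r q2 r w2 1 eps e0 b0 c0 b0 c0 i01 r0 r0 i01.
apply: (@scale_limit _ _ M) => //.
  by apply: Rplus_le_le_0_compat; [apply: Rplus_le_le_0_compat|]; exact: loc_dist_ge0.
move=> h h0 hM.
have [t [t' [v [u [[t01 et at_] [t01' et' at'] [v01 ev av] [u01 eu au]]]]]] := HM h h0 hM.
have z : 0 <= 0 <= 1 by lra.
have M0' : 0 <= M by lra.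
have R0 := raydist2 chain_T2 t01 z; rewrite Rminus_0_r sdistC shared_side in R0.
have [l0 s0] := raydist_small U1 t01 h0 e0 eM hM et at_ R0.
have R0' := raydist_sym (raydist2 chain_T2 z u01); rewrite Rminus_0_r shared_side in R0'.
have [l0' s0'] := raydist_small U1' u01 h0 e0 eM hM eu au R0'.
have R1 := raydist2 chain_T2 t01 t01'; rewrite shared_side in R1.
have K1 := raydist_step U1 t01 t01' h0 i01 r0 M0' et et' at_ at' R1.
have R2 := raydist2 chain_T2 v01 t01'; rewrite shared_side sdistC in R2.
have K2 := raydist_step U1 v01 t01' h0 r0 r0 M0' ev et' av at' R2.
have R3 := raydist2 chain_T2 v01 u01; rewrite shared_side in R3.
have K3 := raydist_step U1 v01 u01 h0 r0 i01 M0' ev eu av au R3.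
have := H t t' v u t01 t01' v01 u01 s0 s0'; rewrite /T2.
have -> : (1 + M * h) ^ 2 * (h * (loc_dist (cosang kap q2 w2 p) 1 r + loc_dist (cosang kap q2 w2 p) r r +
    loc_dist (cosang kap q2 w2 p) r 1)) =
  (1 + M * h) ^ 2 * (h * loc_dist (cosang kap q2 w2 p) 1 r) +
  (1 + M * h) ^ 2 * (h * loc_dist (cosang kap q2 w2 p) r r) +
  (1 + M * h) ^ 2 * (h * loc_dist (cosang kap q2 w2 p) r 1) by ring.
lra.
Qed.

Lemma no_equivariant_CAT : False.
Proof.
have := angle_sum kap tri1; have := angle_sum kap tri2.
have := nuc_angles; have := mid_angles; have := path_angle; have := star_angle.
have := PI_RGT_0; lra.
Qed.

End Angles.

Theorem theorem6p6 :
  ~ (exists rz : realization 4,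
       PMetric Euc rz /\ equivariant (dlen Euc rz) /\ CAT Euc (dlen Euc rz)) /\
  ~ (exists rz : realization 4,
       PMetric Hyp rz /\ equivariant (dlen Hyp rz) /\ CAT Hyp (dlen Hyp rz)).
Proof.
by split=> -[rz [HP [HE HC]]]; exact: no_equivariant_CAT HP HE HC.
Qed.
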